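(* Let $G$ be a connected graph of order $n$ with minimum degree $\delta(G)\ge 2$. If $G$ is not a cycle, then $s^+(G)\ge n$.
   Context: All graphs are finite, simple and undirected. The order of a graph is its number of vertices. For a graph $G$ of order $n$ with adjacency matrix $A(G)$ and adjacency eigenvalues $\lambda_1,\dots,\lambda_n$ (counted with multiplicity), the positive square energy is $s^+(G)=\sum_{\lambda_i>0}\lambda_i^2$. *)

(* Defs.v *)
From HB Require Import structures.
From mathcomp Require Import all_boot all_order all_algebra.
From mathcomp Require Import polyrcf reals.

Set Implicit Arguments.
Unset Strict Implicit.
Unset Printing Implicit Defensive.

Import Order.TTheory GRing.Theory Num.Theory.
Local Open Scope ring_scope.

Record sgraph := SGraph {
  vertex :> finType;
  edge : rel vertex;
  edge_sym : symmetric edge;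
  edge_irrefl : irreflexive edge }.

Definition isomorphic (G H : sgraph) : Prop :=
  exists2 f : G -> H, bijective f & forall x y, edge (f x) (f y) = edge x y.

(* The graph with no vertices is not considered connected. *)
Definition connected_graph (G : sgraph) : Prop :=
  (0 < #|G|)%N /\ forall x y : G, connect (@edge G) x y.

Definition degree (G : sgraph) (x : G) : nat := #|[set y | edge x y]|.

(* All degrees are below #|G|, so the default value #|G| of the iterated
   minimum is never attained when G has a vertex. *)
Definition min_degree (G : sgraph) : nat :=
  \big[minn/#|G|]_(x : G) degree x.

(* ordS is the successor modulo n; i != j only matters for n = 1. *)
Definition cycle_edge (n : nat) : rel 'I_n :=
  [rel i j | (i != j) && ((j == ordS i) || (i == ordS j))].

Lemma cycle_edge_sym n : symmetric (@cycle_edge n).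
Proof. by move=> i j; rewrite /cycle_edge /= eq_sym orbC. Qed.

Lemma cycle_edge_irrefl n : irreflexive (@cycle_edge n).
Proof. by move=> i; rewrite /cycle_edge /= eqxx. Qed.

Definition cycle_graph (n : nat) : sgraph :=
  SGraph (@cycle_edge_sym n) (@cycle_edge_irrefl n).

Definition is_cycle (G : sgraph) : Prop :=
  exists2 n : nat, (2 < n)%N & isomorphic G (cycle_graph n).

Definition adjacency (R : rcfType) (G : sgraph) : 'M[R]_#|G| :=
  \matrix_(i, j) (edge (enum_val i) (enum_val j))%:R.

(* The real eigenvalues, each repeated according to its algebraic
   multiplicity (mup); for a symmetric matrix these are all the eigenvalues. *)
Definition eigenvalues (R : rcfType) (n : nat) (A : 'M[R]_n) : seq R :=
  flatten [seq nseq (mup x (char_poly A)) x | x <- rootsR (char_poly A)].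

Lemma eigenvalues_perm (R : rcfType) (n : nat) (A : 'M[R]_n) (s : seq R) :
  char_poly A = \prod_(x <- s) ('X - x%:P) -> perm_eq (eigenvalues A) s.
Proof.
move=> As; have p0 : char_poly A != 0 by rewrite monic_neq0 ?char_poly_monic.
apply/allP => x _; apply/eqP; rewrite /= -(mu_prod_XsubC x s) -As.
rewrite /eigenvalues count_flatten -map_comp.
rewrite (@eq_map _ _ _ (fun y => (y == x) * mup x (char_poly A))%N); last first.
  by move=> y /=; rewrite count_nseq /=; case: eqVneq => [->|].
have [rx|/mupNroot ->] := boolP (root (char_poly A) x); last first.
  by elim: (rootsR _) => //= y r ->; rewrite muln0.
have: x \in rootsR (char_poly A).
  by rewrite -(roots_on_rootsR p0) rx andbT in_itv.
have: uniq (rootsR (char_poly A)) by exact: uniq_roots.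
elim: (rootsR _) => // y r IHr /= /andP[yNr ur].
rewrite inE => /orP[/eqP xy|xr]; last first.
  rewrite IHr //; suff /negPf -> : y != x by [].
  by apply: contraNneq yNr => ->.
rewrite -xy eqxx mul1n -[RHS]addn0; congr (_ + _)%N.
move: yNr; rewrite -xy; elim: r {IHr ur} => //= z r IHr.
by rewrite inE negb_or eq_sym => /andP[/negPf -> /IHr ->].
Qed.

Definition pos_square_energy (R : rcfType) (G : sgraph) : R :=
  \sum_(x <- eigenvalues (adjacency R G) | 0 < x) x ^+ 2.

(* Main.v *)
(* Write F(U) for the positive square energy of the subgraph induced on U and c(U)
   for the number of its 2-regular components.  By induction on U,
     sum over U of min(deg, 2) <= 2 F(U) + c(U),
   without the term c(U) when U is connected and not 2-regular; under the
   hypotheses this reads 2 n <= 2 F.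

   The energy is controlled from below by F >= 2 tr(A Y) - tr(Y Y) for positive
   semidefinite Y.  Testing on the positive part of the adjacency matrix of a
   smaller induced subgraph H plus a matrix supported near the deleted vertices
   gives lower bounds for F(U) - F(H) in terms of codegrees only.

   - Maximum degree at least 4: delete a vertex of maximum degree, or, in two
     borderline cases, three to five twins of degree 2.
   - Maximum degree at most 3: if two vertices of degree 3 are adjacent on a cycle,
     delete one of them; if two of them share a cycle, delete a path of degree-2
     vertices (an ear), except for theta graphs, which are computed directly.
     Otherwise delete a degree-2 vertex on some odd cycle as long as there is one;
     what remains is a connected bipartite graph, for which F is the number of
     edges. *)

Require Import Defs.
From HB Require Import structures.
From mathcomp Require Import all_boot all_order all_algebra.
From mathcomp Require Import polyrcf boolp reals complex ring lra zify.

Set Implicit Arguments.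
Unset Strict Implicit.
Unset Printing Implicit Defensive.

Import Order.TTheory GRing.Theory Num.Theory.
Local Open Scope ring_scope.

(** Minimum degree 2 does not survive deletions, so degrees are capped at 2 instead. Cycles must be
    excepted: the 5-cycle has energy about 4.76, and deletions can create such components, whence
    the term c(U). Deleting a vertex v from a connected U costs at most 2 for v itself, 1 for each
    neighbour of degree at most 2, and 1 for each new 2-regular component. Every such component
    contains a neighbour of v, which has degree 3 in U. Hence the cost is at most 2 + tau with tau
    at most deg v, and an energy gain of 1 + tau/2 suffices. The gain from attaching v is limited by
    how strongly the negative part of the smaller graph acts on the neighbourhood B of v. Scalar
    inequalities between a function of x and a quadratic polynomial in x, applied to each
    eigenvalue, estimate this from the squared norm of A 1_B and from the inner product of 1_B and A
    1_B alone. Vertices that contribute to tau begin few walks of length two back to B, so a large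
    cost comes with a small codegree sum. *)

(** * The spectral theorem for symmetric matrices over a real closed field *)

(** Over [R[i]] the matrix becomes hermitian, so its spectral diagonal is real; a real root of the
    characteristic polynomial there is a root over [R]. *)
Lemma sym_eigenvalue (R : rcfType) n (A : 'M[R]_n.+1) :
  A^T = A -> exists x, eigenvalue A x.
Proof.
move=> symA; pose f := real_complex R; pose B := map_mx f A.
have hB : B \is hermsymmx.
  apply: realsym_hermsym.
    apply/is_hermitianmxP; rewrite expr0 scale1r map_mx_id //.
    by rewrite /B map_trmx symA.
  by apply/mxOverP => i j; rewrite mxE; apply/complex_realP; exists (A i j).
have /hermitian_normalmx /orthomx_spectralP eqB := hB.
have /mxOverP/(_ 0 0)/complex_realP[x def_x] := hermitian_spectral_diag_real hB.
exists x; rewrite eigenvalue_root_char -(fmorph_root f) map_char_poly.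
rewrite -/B -eigenvalue_root_char; apply/eigenvalueP.
set P := spectralmx B in eqB; have uP : P \in unitmx by exact: spectral_unit.
exists (row 0 P).
  rewrite eqB -row_mul -mulmxA mulKVmx // row_mul row_diag_mx -scalemxAl.
  by rewrite -rowE def_x.
apply/eqP => /(congr1 (mulmx^~ (invmx P))).
rewrite mul0mx -row_mul mulmxV // => /matrixP/(_ 0 0) /eqP.
by rewrite !mxE eqxx oner_eq0.
Qed.

(** The reflection in the hyperplane orthogonal to [w = e - v] exchanges the unit vectors [e] and
    [v]; when [w] is zero the identity serves. *)
Lemma householder (R : rcfType) n (v : 'rV[R]_n.+1) :
  v *m v^T = 1%:M -> exists2 Q : 'M[R]_n.+1, Q *m Q^T = 1%:M & row 0 Q = v.
Proof.
move=> vv; pose e : 'rV[R]_n.+1 := 'e_0; pose w := e - v.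
pose s := (w *m w^T) 0 0.
have ww : w *m w^T = s%:M by rewrite [LHS]mx11_scalar.
have ee : e *m e^T = 1%:M.
  by rewrite /e trmx_delta mul_delta_mx; apply/matrixP => i j; rewrite !ord1 !mxE.
have [s0|sN0] := eqVneq s 0.
  exists 1%:M; first by rewrite trmx1 mulmx1.
  suff /subr0_eq <- : w = 0 by rewrite row1.
  apply/rowP => j; rewrite [RHS]mxE; apply/eqP; rewrite -sqrf_eq0; apply/eqP.
  have : \sum_j w 0 j ^+ 2 = 0.
    by rewrite -[RHS]s0 /s mxE; apply: eq_bigr => k _; rewrite !mxE expr2.
  by move/psumr_eq0P => ->// k _; rewrite sqr_ge0.
have ew : e *m w^T = (s / 2)%:M.
  have ve : v *m e^T = e *m v^T.
    apply: trmx_inj; rewrite !trmx_mul !trmxK.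
    rewrite [LHS]mx11_scalar [RHS]mx11_scalar; congr _%:M; rewrite !mxE.
    by apply: eq_bigr => i _; rewrite !mxE mulrC.
  have : w *m w^T = e *m w^T + e *m w^T.
    rewrite /w [(e - v)^T]linearB /= !mulmxBr !mulmxBl ee vv ve.
    by rewrite opprB.
  rewrite ww [e *m _]mx11_scalar -raddfD /= => /matrixP/(_ 0 0).
  by rewrite !mxE eqxx !mulr1n => ->; congr _%:M; field.
have ewv : e - w = v by rewrite opprB addrC subrK.
clearbody s w; exists (1%:M - (2 / s) *: (w^T *m w)).
  rewrite [(_ - _)^T]linearB /= trmx1 [(_ *: _)^T]linearZ /= trmx_mul trmxK.
  rewrite mulmxBl !mulmxBr !mulmx1 !mul1mx -!scalemxAl -!scalemxAr mulmxA -(mulmxA w^T) ww.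
  rewrite mul_mx_scalar -!scalemxAl !scalerA.
  have -> : 2 / s * (2 / s * s) = 2 / s + 2 / s by field.
  by rewrite scalerDl opprB addrK subrK.
rewrite rowE mulmxBr mulmx1 -scalemxAr mulmxA ew mul_scalar_mx scalerA.
have -> : 2 / s * (s / 2) = 1 by field.
by rewrite scale1r.
Qed.

(** Deflation: an orthogonal [Q] whose first row is a unit eigenvector makes [Q A Q^T] block
    diagonal, since symmetry clears the first column together with the first row. *)
Lemma real_spectral (R : rcfType) n (A : 'M[R]_n) : A^T = A ->
  exists P : 'M[R]_n, exists d : 'rV[R]_n,
    P *m P^T = 1%:M /\ A = P^T *m diag_mx d *m P.
Proof.
elim: n A => [|n IHn] A symA.
  by exists 1%:M, 0; split; apply/matrixP; case.
have [x /eigenvalueP[v0 v0A v0N0]] := sym_eigenvalue symA.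
pose q := (v0 *m v0^T) 0 0.
have qE : q = \sum_j v0 0 j ^+ 2.
  by rewrite /q mxE; apply: eq_bigr => j _; rewrite mxE expr2.
have q_gt0 : 0 < q.
  rewrite lt0r qE sumr_ge0 ?andbT => [|j _]; last exact: sqr_ge0.
  apply: contraNneq v0N0 => /psumr_eq0P z; apply/eqP/rowP => j.
  rewrite [RHS]mxE; apply/eqP; rewrite -sqrf_eq0 z // => k _; exact: sqr_ge0.
pose v := (Num.sqrt q)^-1 *: v0.
have vA : v *m A = x *: v by rewrite -scalemxAl v0A scalerA mulrC -scalerA.
have vv : v *m v^T = 1%:M.
  rewrite /v [(_ *: _)^T]linearZ /= -scalemxAl -scalemxAr scalerA -invfM -expr2 sqr_sqrtr ?ltW //.
  rewrite [v0 *m _]mx11_scalar -/q -scalemx1 scalerA mulVf ?lt0r_neq0 //.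
  by rewrite scale1r.
have [Q QQ Q0] := householder vv.
have QtQ : Q^T *m Q = 1%:M by apply: mulmx1C.
pose B := Q *m A *m Q^T.
have symB : B^T = B by rewrite /B !trmx_mul trmxK symA mulmxA.
have B0 : row 0 B = x *: 'e_0.
  rewrite /B !row_mul Q0 vA -scalemxAl; congr (_ *: _).
  by rewrite -Q0 -row_mul QQ row1.
have BQ : B = Q *m A *m Q^T by [].
clearbody B; pose C : 'M[R]_n := drsubmx (B : 'M_(1 + n)).
have symC : C^T = C by rewrite /C trmx_drsub symB.
have [P [d [PP CE]]] := IHn C symC.
have BE : B = block_mx x%:M 0 0 C :> 'M_(1 + n).
  have B0j j : B 0 j = x * (j == 0)%:R.
    by transitivity (row 0 B 0 j); [rewrite [RHS]mxE | rewrite B0 !mxE eqxx].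
  have Bj0 j : B j 0 = x * (j == 0)%:R by rewrite -B0j -[in LHS]symB mxE.
  have l0 : lshift n (0 : 'I_1) = 0 :> 'I_(1 + n) by apply: val_inj.
  rewrite -[LHS](@submxK R 1 n 1 n); congr (@block_mx R 1 n 1 n _ _ _ _).
  - apply/matrixP => i j; rewrite !mxE !ord1 l0.
    by rewrite B0j mulr1.
  - apply/matrixP => i j; rewrite !mxE !ord1 l0 B0j.
    by rewrite -val_eqE /= mulr0.
  - by apply/matrixP => i j; rewrite !mxE !ord1 l0 Bj0 -val_eqE /= mulr0.
pose P1 : 'M_(1 + n) := block_mx 1%:M 0 0 P.
have PP1 : P1 *m P1^T = 1%:M.
  rewrite /P1 tr_block_mx mulmx_block !trmx0 !mulmx0 !mul0mx !addr0 !add0r.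
  by rewrite trmx1 mulmx1 PP -scalar_mx_block.
exists (P1 *m Q), (row_mx x%:M d); split.
  by rewrite trmx_mul mulmxA -(mulmxA P1) QQ mulmx1.
have BE' : B = P1^T *m diag_mx (row_mx x%:M d) *m P1.
  rewrite diag_mx_row BE CE /P1 tr_block_mx !trmx0 !mulmx_block.
  rewrite !(mulmx0, mul0mx, addr0, add0r) trmx1 mul1mx mulmx1.
  congr (@block_mx R 1 n 1 n _ _ _ _).
  by apply/matrixP => i j; rewrite !mxE !ord1 eqxx mulr1n.
have -> : A = Q^T *m B *m Q.
  by rewrite BQ !mulmxA QtQ mul1mx -mulmxA QtQ mulmx1.
by rewrite BE' trmx_mul !mulmxA.
Qed.

(** * Positive and negative parts *)

Section Energy.
Variable R : rcfType.
Implicit Types n : nat.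

Definition dot n (u v : 'cV[R]_n) : R := (u^T *m v) 0 0.

Definition psd n (M : 'M[R]_n) : Prop :=
  M^T = M /\ forall u : 'cV_n, 0 <= dot u (M *m u).

Definition pos_energy n (A : 'M[R]_n) : R :=
  \sum_(x <- eigenvalues A | 0 < x) x ^+ 2.

Definition posp (x : R) := Num.max x 0.

(** The eigenvalues are defined through the characteristic polynomial, which orthogonal conjugation
    preserves; any diagonalisation therefore computes the energy. *)
Lemma pos_energyE n (A P : 'M[R]_n) (d : 'rV_n) :
  P *m P^T = 1%:M -> A = P^T *m diag_mx d *m P ->
  pos_energy A = \sum_i posp (d 0 i) ^+ 2.
Proof.
move=> PP AE; have PtP : P^T *m P = 1%:M by apply: mulmx1C.
rewrite /pos_energy (perm_big [seq d 0 i | i <- enum 'I_n]) /=; last first.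
  apply: eigenvalues_perm; rewrite big_map big_enum /=.
  pose p := map_mx (@polyC R) P.
  have pp : p^T *m p = 1%:M by rewrite /p map_trmx -map_mxM PtP map_mx1.
  have -> : char_poly A = \det (char_poly_mx (diag_mx d)).
    rewrite /char_poly /char_poly_mx AE !map_mxM -/p -map_trmx -/p.
    have -> : 'X%:M - p^T *m map_mx polyC (diag_mx d) *m p =
        p^T *m ('X%:M - map_mx polyC (diag_mx d)) *m p.
      have e : p^T *m 'X%:M *m p = 'X%:M by rewrite scalar_mxC -mulmxA pp mulmx1.
      by rewrite mulmxBr mulmxBl e.
    rewrite !det_mulmx mulrAC -det_mulmx pp det1 mul1r //.
  rewrite -[LHS]/(char_poly _) char_poly_trig ?diag_mx_is_trig //.
  by apply: eq_bigr => i _; rewrite mxE eqxx mulr1n.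
rewrite big_map big_enum_cond /= [RHS](bigID (fun i => 0 < d 0 i)) /=.
rewrite [X in _ = _ + X]big1 ?addr0 => [|i]; last first.
  by rewrite -leNgt /posp => /max_idPr ->; rewrite expr0n.
by apply: eq_big => // i /ltW d0; rewrite /posp (max_idPl _).
Qed.

Lemma dotE n (u v : 'cV[R]_n) : dot u v = \sum_i u i 0 * v i 0.
Proof. by rewrite /dot mxE; apply: eq_bigr => i _; rewrite mxE. Qed.

Lemma dotC n (u v : 'cV[R]_n) : dot u v = dot v u.
Proof. by rewrite !dotE; apply: eq_bigr => i _; rewrite mulrC. Qed.

Lemma dotDr n (u v w : 'cV[R]_n) : dot u (v + w) = dot u v + dot u w.
Proof. by rewrite /dot mulmxDr mxE. Qed.

Lemma dotZr n a (u v : 'cV[R]_n) : dot u (a *: v) = a * dot u v.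
Proof. by rewrite /dot -scalemxAr mxE. Qed.

Lemma dotDl n (u v w : 'cV[R]_n) : dot (v + w) u = dot v u + dot w u.
Proof. by rewrite dotC dotDr !(dotC u). Qed.

Lemma dotZl n a (u v : 'cV[R]_n) : dot (a *: u) v = a * dot u v.
Proof. by rewrite dotC dotZr dotC. Qed.

Lemma dotBr n (u v w : 'cV[R]_n) : dot u (v - w) = dot u v - dot u w.
Proof. by rewrite dotDr -scaleN1r dotZr mulN1r. Qed.

Lemma dot_ge0 n (u : 'cV[R]_n) : 0 <= dot u u.
Proof. by rewrite dotE sumr_ge0 // => i _; rewrite -expr2 sqr_ge0. Qed.

Lemma dot_eq0 n (u : 'cV[R]_n) : dot u u = 0 -> u = 0.
Proof.
rewrite dotE => /psumr_eq0P z; apply/colP => i; rewrite [RHS]mxE.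
by apply/eqP; rewrite -sqrf_eq0 expr2 z // => k _; rewrite -expr2 sqr_ge0.
Qed.

Lemma dot_mulmx n m (u : 'cV[R]_n) (M : 'M_(n, m)) v :
  dot u (M *m v) = dot (M^T *m u) v.
Proof. by rewrite /dot trmx_mul trmxK mulmxA. Qed.

Definition negp (x : R) := Num.max (- x) 0.

Lemma negp_ge0 x : 0 <= negp x. Proof. by rewrite /negp le_max lexx orbT. Qed.
Lemma posp_ge0 x : 0 <= posp x. Proof. by rewrite /posp le_max lexx orbT. Qed.

Lemma pospB x : posp x - negp x = x.
Proof.
by rewrite /posp /negp; case: (leP x 0) => x0; case: (leP (- x) 0) => x1; lra.
Qed.

Lemma posp_negp x : posp x * negp x = 0.
Proof.
by rewrite /posp /negp; case: (leP x 0) => x0; case: (leP (- x) 0) => x1; nra.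
Qed.

(** [negp x = (|x| - x) / 2], and [|x| <= (t + x ^+ 2 / t) / 2] by the arithmetic-geometric mean
    inequality; the bound is sharp where [|x| = t]. *)
Lemma negp_le t x : 0 < t -> negp x <= (t + x ^+ 2 / t) / 4 - x / 2.
Proof.
move=> t0; have : 0 <= (x + t) ^+ 2 / t /\ 0 <= (x - t) ^+ 2 / t.
  by rewrite !divr_ge0 ?sqr_ge0 ?ltW.
have -> : (x + t) ^+ 2 / t = x ^+ 2 / t + 2 * x + t by field; rewrite lt0r_neq0.
have -> : (x - t) ^+ 2 / t = x ^+ 2 / t - 2 * x + t by field; rewrite lt0r_neq0.
by move=> [h1 h2]; rewrite /negp; case: (leP (- x) 0) => x1; lra.
Qed.

(* The parabola is tangent to [1 / (l - x)] at [x = - a] and its maximum is the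
   constant value [1 / l] on the nonnegative axis. *)
Lemma resolvent_parabola (l a x : R) : 0 < l -> 0 < a ->
  l^-1 - l / (4 * a * (l + a) ^+ 3) * (x - (a + 2 * a ^+ 2 / l)) ^+ 2
  <= (l + negp x)^-1.
Proof.
move=> l0 a0; set g := l / _; set c := a + _.
have la0 : 0 < l + a by rewrite addr_gt0.
have g0 : 0 < g by rewrite divr_gt0 // !mulr_gt0 // exprn_gt0.
rewrite /negp; case: (leP (- x) 0) => x0.
  by rewrite addr0 lerBlDr lerDl mulr_ge0 ?sqr_ge0 ?ltW.
have ly0 : 0 < l - x by rewrite subr_gt0 (lt_trans _ l0) // -oppr_gt0.
rewrite -subr_ge0.
suff -> : (l - x)^-1 - (l^-1 - g * (x - c) ^+ 2) =
   g * (x + a) ^+ 2 + (x + a) ^+ 2 / ((l + a) ^+ 2 * (l - x)).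
  apply: addr_ge0; first by rewrite mulr_ge0 ?sqr_ge0 ?ltW.
  apply: divr_ge0; first exact: sqr_ge0.
  by apply: mulr_ge0; [exact: sqr_ge0 | exact: ltW].
by rewrite /g /c; field; rewrite !lt0r_neq0.
Qed.

Section Spectral.
Variables (n : nat) (P : 'M[R]_n).
Hypothesis PP : P *m P^T = 1%:M.

Let PtP : P^T *m P = 1%:M. Proof. exact: mulmx1C. Qed.

(** Functional calculus in the orthonormal eigenbasis formed by the rows of [P]: if [A = fmx d],
    then [fmx (g \o d)] is [g] applied to [A]. *)
Definition fmx (g : 'I_n -> R) : 'M[R]_n := P^T *m diag_mx (\row_i g i) *m P.

Lemma fmx_sym g : (fmx g)^T = fmx g.
Proof. by rewrite /fmx !trmx_mul trmxK tr_diag_mx mulmxA. Qed.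

Lemma fmxE g (u : 'cV[R]_n) i :
  (P *m (fmx g *m u)) i 0 = g i * (P *m u) i 0.
Proof.
by rewrite /fmx !mulmxA PP mul1mx -mulmxA mul_diag_mx mxE mxE.
Qed.

Lemma dot_basis (u v : 'cV[R]_n) : dot u v = \sum_i (P *m u) i 0 * (P *m v) i 0.
Proof. by rewrite -dotE dot_mulmx mulmxA PtP mul1mx. Qed.

Lemma dot_fmx g (u v : 'cV[R]_n) :
  dot u (fmx g *m v) = \sum_i g i * ((P *m u) i 0 * (P *m v) i 0).
Proof. by rewrite dot_basis; apply: eq_bigr => i _; rewrite fmxE mulrCA. Qed.

Lemma dot_fmx2 g (u : 'cV[R]_n) :
  dot (fmx g *m u) (fmx g *m u) = \sum_i g i ^+ 2 * (P *m u) i 0 ^+ 2.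
Proof. by rewrite dot_basis; apply: eq_bigr => i _; rewrite fmxE; ring. Qed.

Lemma psd_fmx g : (forall i, 0 <= g i) -> psd (fmx g).
Proof.
move=> g0; split=> [|u]; first exact: fmx_sym.
by rewrite dot_fmx sumr_ge0 // => i _; rewrite mulr_ge0 // -expr2 sqr_ge0.
Qed.

Lemma tr_fmx_mul g Y :
  \tr (fmx g *m Y) = \sum_i g i * (P *m Y *m P^T) i i.
Proof.
rewrite /fmx -!mulmxA mxtrace_mulC -!mulmxA.
by apply: eq_bigr => i _; rewrite mul_diag_mx mxE mxE !mulmxA.
Qed.

Lemma tr_fmx2 g h : \tr (fmx g *m fmx h) = \sum_i g i * h i.
Proof.
rewrite tr_fmx_mul; apply: eq_bigr => i _; congr (_ * _).
by rewrite /fmx !mulmxA PP mul1mx -mulmxA PP mulmx1 !mxE eqxx.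
Qed.

End Spectral.

Lemma spectralE n (A : 'M[R]_n) : A^T = A ->
  exists P : 'M[R]_n, exists d : 'I_n -> R,
    [/\ P *m P^T = 1%:M, A = fmx P d & pos_energy A = \sum_i posp (d i) ^+ 2].
Proof.
move=> /real_spectral[P [d [PP AE]]]; exists P, (d 0).
have AE' : A = fmx P (d 0).
  by rewrite AE /fmx; congr (_ *m diag_mx _ *m _); apply/rowP => i; rewrite mxE.
by split => //; exact: pos_energyE PP AE.
Qed.

Lemma tr_sym2 n (Y : 'M[R]_n) : Y^T = Y ->
  \tr (Y *m Y) = \sum_i \sum_j Y i j ^+ 2.
Proof.
move=> symY; apply: eq_bigr => i _; rewrite mxE; apply: eq_bigr => j _.
by rewrite expr2 -[in X in _ * X]symY mxE.
Qed.

(** In an eigenbasis of [A], only the diagonal of [Z = P Y P^T] meets [A], and it is nonnegative.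
    Dropping the off-diagonal squares leaves [2 d z - z ^+ 2 <= posp d ^+ 2] for each eigenvalue [d]
    and [z >= 0]. *)
Lemma pos_energy_ge n (A Y : 'M[R]_n) : A^T = A -> psd Y ->
  2 * \tr (A *m Y) - \tr (Y *m Y) <= pos_energy A.
Proof.
move=> /spectralE[P [d [PP -> ->]]] [symY Y_ge0].
have PtP : P^T *m P = 1%:M by apply: mulmx1C.
rewrite tr_fmx_mul; set Z := P *m Y *m P^T.
have -> : \tr (Y *m Y) = \tr (Z *m Z).
  rewrite /Z !mulmxA -(mulmxA _ P^T P) PtP mulmx1 [RHS]mxtrace_mulC.
  by rewrite !mulmxA PtP mul1mx.
have Z_ge0 i : 0 <= Z i i.
  have := Y_ge0 (P^T *m (delta_mx i 0 : 'cV_n)).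
  rewrite /dot trmx_mul trmxK trmx_delta !mulmxA -(mulmxA _ P).
  by rewrite -(mulmxA _ (P *m Y)) -/Z -rowE -colE mxE mxE.
rewrite tr_sym2; last by rewrite /Z !trmx_mul trmxK symY mulmxA.
rewrite mulr_sumr -sumrB; apply: ler_sum => i _.
have Zi : Z i i ^+ 2 <= \sum_j Z i j ^+ 2.
  by rewrite (bigD1 i) //= lerDl sumr_ge0 // => k _; apply: sqr_ge0.
apply: le_trans (_ : 2 * (d i * Z i i) - Z i i ^+ 2 <= _).
  by rewrite lerB.
have := Z_ge0 i; rewrite /posp; case: (leP (d i) 0) => d0 z0.
  rewrite expr0n /=; have := mulr_le0_ge0 d0 z0; have := sqr_ge0 (Z i i); lra.
by have := sqr_ge0 (d i - Z i i); rewrite sqrrB; lra.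
Qed.

(** All clauses are scalar facts about [posp] and [negp] transferred through one eigenbasis; the [u]
    of the last clause is the resolvent of [N] applied to [b]. *)
Lemma pos_neg_parts n (A : 'M[R]_n) : A^T = A ->
  exists X N : 'M[R]_n,
  [/\ [/\ psd X, psd N, A = X - N & 2 * \tr (A *m X) - \tr (X *m X) = pos_energy A],
   forall u : 'cV_n, A *m u = 0 -> X *m u = 0 /\ N *m u = 0,
   forall (t : R) (u : 'cV_n), 0 < t ->
     dot u (N *m u) <= (t * dot u u + dot (A *m u) (A *m u) / t) / 4
                       - dot u (A *m u) / 2
 & forall (l a : R) (b : 'cV_n), 0 < l -> 0 < a ->
     let c := a + 2 * a ^+ 2 / l in
     exists2 u, l *: u + N *m u = b &
       dot b b / l - l / (4 * a * (l + a) ^+ 3) *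
         (dot (A *m b) (A *m b) - 2 * c * dot b (A *m b) + c ^+ 2 * dot b b)
       <= dot b u].
Proof.
move=> /spectralE[P [d [PP AE En]]].
have PtP : P^T *m P = 1%:M by apply: mulmx1C.
exists (fmx P (posp \o d)), (fmx P (negp \o d)); split.
- split; first by apply: psd_fmx => // i; exact: posp_ge0.
  + by apply: psd_fmx => // i; exact: negp_ge0.
  + rewrite AE /fmx -mulmxBl -mulmxBr -[diag_mx _ - _]linearB /=.
    congr (_ *m diag_mx _ *m _); apply/rowP => i.
    by rewrite !mxE pospB.
  + rewrite En AE !tr_fmx2 // mulr_sumr -sumrB; apply: eq_bigr => i _ /=.
    have -> : d i * posp (d i) = posp (d i) ^+ 2.
      by rewrite -{1}(pospB (d i)) mulrBl [negp _ * _]mulrC posp_negp subr0.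
    by ring.
(* Both parts are bounded by the absolute value, so they vanish on the kernel of [A]. *)
- have h (g : R -> R) : (forall x, g x ^+ 2 <= x ^+ 2) ->
      forall u : 'cV_n, A *m u = 0 -> fmx P (g \o d) *m u = 0.
    move=> gx u Au; apply: dot_eq0; apply: le_anti; rewrite dot_ge0 andbT.
    have <- : dot (A *m u) (A *m u) = 0.
      by rewrite Au /dot mulmx0 mxE.
    rewrite AE !dot_fmx2 //; apply: ler_sum => i _.
    by apply: ler_wpM2r; [exact: sqr_ge0 | exact: gx].
  by move=> u Au; split; apply: h Au => x; rewrite /posp /negp;
     [case: (leP x 0) | case: (leP (- x) 0)] => ?; nra.
- move=> t u t0; rewrite AE dot_fmx2 // !dot_fmx // (dot_basis PP).
  rewrite mulr_suml mulr_sumr -big_split /= !mulr_suml -sumrB.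
  apply: ler_sum => i _; rewrite -!expr2.
  have := ler_wpM2r (sqr_ge0 ((P *m u) i 0)) (negp_le (d i) t0).
  by move/le_trans; apply; rewrite le_eqVlt; apply/orP; left; apply/eqP; ring.
- move=> l a b l0 a0 c; exists (fmx P (fun i => (l + negp (d i))^-1) *m b).
    have e u v : P *m u = P *m v -> u = v :> 'cV[R]_n.
      by move/(congr1 (mulmx P^T)); rewrite !mulmxA PtP !mul1mx.
    apply: e; apply/colP => i.
    rewrite mulmxDr [LHS]mxE -scalemxAr [X in X + _]mxE !fmxE //=.
    have := negp_ge0 (d i) => n0; field.
    by rewrite lt0r_neq0 // ltr_wpDr.
  rewrite AE dot_fmx2 // !dot_fmx // (dot_basis PP).
  rewrite !mulr_suml !mulr_sumr -sumrB -big_split /= mulr_sumr -sumrB.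
  apply: ler_sum => i _; rewrite -!expr2.
  have := ler_wpM2r (sqr_ge0 ((P *m b) i 0)) (resolvent_parabola (d i) l0 a0).
  rewrite -/c; apply: le_trans.
  rewrite le_eqVlt; apply/orP; left; apply/eqP; ring.
Qed.
End Energy.

Lemma pos_energy_ge0 (R : rcfType) n (A : 'M[R]_n) : 0 <= pos_energy A.
Proof. by apply: sumr_ge0 => x _; apply: sqr_ge0. Qed.

Lemma pos_energyN (R : rcfType) n (A : 'M[R]_n) : A^T = A ->
  pos_energy A + pos_energy (- A) = \tr (A *m A).
Proof.
move=> /spectralE[P [d [PP AE ->]]].
have NE : - A = fmx P (fun i => - d i).
  rewrite AE /fmx -mulNmx -mulmxN; congr (_ *m _ *m _).
  by apply/matrixP => i j; rewrite !mxE mulNrn.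
rewrite (pos_energyE PP NE) AE tr_fmx2 // -big_split; apply: eq_bigr => i _.
rewrite /= mxE /posp.
by case: (leP (d i) 0) => d0; case: (leP (- d i) 0) => d1; nra.
Qed.

Lemma pos_energy_conj (R : rcfType) n (A D : 'M[R]_n) :
  A^T = A -> D *m D^T = 1%:M -> pos_energy (D *m A *m D^T) = pos_energy A.
Proof.
move=> /spectralE[P [d [PP AE ->]]] DD; have DtD : D^T *m D = 1%:M by apply: mulmx1C.
have QQ : (P *m D^T) *m (P *m D^T)^T = 1%:M.
  by rewrite trmx_mul trmxK mulmxA -(mulmxA P) DtD mulmx1.
rewrite (pos_energyE QQ (d := \row_i d i)); last first.
  by rewrite AE /fmx trmx_mul trmxK !mulmxA.
by apply: eq_bigr => i _; rewrite mxE.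
Qed.

(** Conjugation by the diagonal sign matrix of the colouring turns [A] into [- A], so positive and
    negative eigenvalues carry half of the trace each. *)
Lemma pos_energy_bipartite (R : rcfType) n (A : 'M[R]_n) (chi : pred 'I_n) :
  A^T = A -> (forall i j, chi i = chi j -> A i j = 0) ->
  2 * pos_energy A = \tr (A *m A).
Proof.
move=> symA bipA; pose s i : R := if chi i then 1 else - 1.
pose D := diag_mx (\row_i s i).
have DD : D *m D^T = 1%:M.
  rewrite tr_diag_mx mulmx_diag; apply/matrixP => i j; rewrite !mxE /s.
  by case: (chi i); rewrite ?mulr1 // mulrNN mulr1.
rewrite -pos_energyN // mulr2n mulrDl mul1r; congr (_ + _).
rewrite -(pos_energy_conj symA DD); congr pos_energy.
apply/matrixP => i j; rewrite tr_diag_mx mul_mx_diag mul_diag_mx !mxE /s.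
have := @bipA i j; case: (chi i); case: (chi j) => h;
  by rewrite ?(h erefl) ?mul0r ?mulr0 ?oppr0 //; ring.
Qed.

Lemma dot0l (R : rcfType) n (u : 'cV[R]_n) : dot 0 u = 0.
Proof. by rewrite /dot trmx0 mul0mx mxE. Qed.

Lemma psd_tr_ge0 (R : rcfType) n (M Y : 'M[R]_n) : psd M -> psd Y -> 0 <= \tr (M *m Y).
Proof.
move=> [symM M0] [symY Y0]; have [P [d [PP ME _]]] := spectralE symM.
have PtP : P^T *m P = 1%:M by apply: mulmx1C.
have bas i : P *m (P^T *m (delta_mx i 0 : 'cV_n)) = delta_mx i 0.
  by rewrite mulmxA PP mul1mx.
rewrite ME tr_fmx_mul; apply: sumr_ge0 => i _; apply: mulr_ge0.
  have := M0 (P^T *m (delta_mx i 0 : 'cV_n)).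
  rewrite ME dot_fmx // (bigD1 i) //= big1 ?addr0 => [|k ki]; last first.
    by rewrite bas mxE (negPf ki) mul0r mulr0.
  by rewrite bas mxE !eqxx !mulr1.
have := Y0 (P^T *m (delta_mx i 0 : 'cV_n)).
rewrite /dot trmx_mul trmxK trmx_delta !mulmxA -(mulmxA _ P).
by rewrite -(mulmxA _ (P *m Y)) -rowE -colE mxE mxE.
Qed.

Lemma psdD (R : rcfType) n (M Y : 'M[R]_n) : psd M -> psd Y -> psd (M + Y).
Proof.
move=> [sM M0] [sY Y0]; split=> [|u]; first by rewrite [LHS]linearD /= sM sY.
by rewrite mulmxDl dotDr addr_ge0.
Qed.

Lemma psd_rank1 (R : rcfType) n (t : R) (z : 'cV[R]_n) : 0 <= t -> psd (t *: (z *m z^T)).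
Proof.
move=> t0; split=> [|u]; first by rewrite [LHS]linearZ /= trmx_mul trmxK.
rewrite -scalemxAl dotZr mulr_ge0 // -mulmxA.
by rewrite [z^T *m u]mx11_scalar mul_mx_scalar dotZr -/(dot z u) dotC -expr2 sqr_ge0.
Qed.

Lemma psd_conj (R : rcfType) n m (Y : 'M[R]_n) (E : 'M_(m, n)) : psd Y -> psd (E *m Y *m E^T).
Proof.
move=> [sY Y0]; split=> [|u]; first by rewrite !trmx_mul trmxK sY mulmxA.
by rewrite -!mulmxA dot_mulmx.
Qed.

Lemma tr_rank1 (R : rcfType) n (M : 'M[R]_n) (z : 'cV[R]_n) :
  \tr (M *m (z *m z^T)) = dot z (M *m z).
Proof. by rewrite mulmxA mxtrace_mulC trace_mx11. Qed.

(* [B B^T] and [B^T B] have the same nonzero spectrum. *)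
Lemma pos_energy_gram (F : rcfType) m p (B : 'M[F]_(m, p)) :
  pos_energy (B^T *m B - 2%:M) <= pos_energy (B *m B^T - 2%:M).
Proof.
set C := B^T *m B - 2%:M.
have symC : C^T = C by rewrite [LHS]linearB /= trmx_mul trmxK tr_scalar_mx.
have [P [d [PP CE ->]]] := spectralE symC.
have PtP : P^T *m P = 1%:M by apply: mulmx1C.
(* If [B^T B w = (2 + d) w] with [d > 0], then [B w] is an eigenvector of [B B^T - 2] for [d], and
   the weight [d / (2 + d)] makes the test matrix [B *m fmx P g *m B^T] multiply it by [d], as the
   positive part does. *)
pose g i := posp (d i) / (2 + posp (d i)).
have g2 i : 0 < 2 + posp (d i) by rewrite ltr_wpDr // posp_ge0.
have g0 i : 0 <= g i by rewrite divr_ge0 ?posp_ge0 // ltW.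
have symD : (B *m B^T - 2%:M)^T = B *m B^T - 2%:M.
  by rewrite [LHS]linearB /= trmx_mul trmxK tr_scalar_mx.
have := pos_energy_ge symD (psd_conj B (psd_fmx PP g0)); apply: le_trans.
have BB : B^T *m B = fmx P (fun i => 2 + d i).
  have -> : B^T *m B = C + 2%:M by rewrite subrK.
  have -> : 2%:M = fmx P (fun=> 2).
    rewrite /fmx -[RHS]mulmxA (_ : diag_mx _ = 2%:M).
      by rewrite mul_scalar_mx -scalemxAr PtP scalemx1.
    by apply/matrixP => i j; rewrite !mxE.
  rewrite CE /fmx -mulmxDl -mulmxDr -[diag_mx _ + _]linearD /=.
  by congr (_ *m diag_mx _ *m _); apply/rowP => i; rewrite !mxE addrC.
have fM h k : fmx P h *m fmx P k = fmx P (fun i => h i * k i).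
  rewrite /fmx !mulmxA -(mulmxA _ P) PP mulmx1 -(mulmxA P^T) mulmx_diag.
  by congr (_ *m diag_mx _ *m _); apply/rowP => i; rewrite !mxE.
have -> : \tr ((B *m B^T - 2%:M) *m (B *m fmx P g *m B^T)) =
   \tr (fmx P (fun i => (2 + d i) * d i) *m fmx P g).
  have key : B^T *m (B *m B^T - 2%:M) *m B = B^T *m B *m C.
    rewrite mulmxBr mulmxBl [in RHS]mulmxBr !mul_mx_scalar -scalemxAl.
    by rewrite !mulmxA.
  by rewrite -fM -BB -CE -key !mulmxA [LHS]mxtrace_mulC !mulmxA.
have -> : \tr (B *m fmx P g *m B^T *m (B *m fmx P g *m B^T)) =
   \tr (fmx P (fun i => g i * (2 + d i)) *m fmx P (fun i => g i * (2 + d i))).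
  by rewrite -!fM -!BB !mulmxA [RHS]mxtrace_mulC !mulmxA.
rewrite !tr_fmx2 // mulr_sumr -sumrB; apply: ler_sum => i _.
rewrite /g; have := g2 i; rewrite /posp; case: (leP (d i) 0) => di h.
  by rewrite !(mul0r, mulr0) subr0 expr0n.
rewrite le_eqVlt; apply/orP; left; apply/eqP; field; exact: lt0r_neq0.
Qed.

(** * The incidence matrix of a path *)

Lemma sum_nat_delta m a (G : nat -> nat) :
  (\sum_(i < m) (i == a :> nat) * G i = (a < m) * G a)%N.
Proof.
case: ltnP => am; last first.
  by rewrite big1 // => i _; rewrite ltn_eqF // (leq_trans _ am).
rewrite (bigD1 (Ordinal am)) //= eqxx big1 ?addn0 // => i /eqP ia.
by case: eqP => // h; case: ia; apply: val_inj.
Qed.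

Lemma sum_nat_deltaS m a (G : nat -> nat) :
  (\sum_(i < m) (i.+1 == a :> nat) * G i = ((0 < a) && (a <= m)) * G a.-1)%N.
Proof.
case: a => [|a] /=; first by rewrite big1.
exact: sum_nat_delta.
Qed.

(* Vertex-edge incidence of the path [0 - 1 - 2 - ...], edge [i] joining [i] and [i.+1]. *)
Definition path_inc (v i : nat) : nat := (i == v) + (i.+1 == v).

Lemma path_inc_edges k i j : (i < k.+1)%N -> (j < k.+1)%N ->
  (\sum_(v < k.+2) path_inc v i * path_inc v j =
   ((i.+1 == j) || (j.+1 == i)) + 2 * (i == j))%N.
Proof.
move=> ik jk.
rewrite (eq_bigr (fun v : 'I_k.+2 => (v == i :> nat) * path_inc v j
          + (v == i.+1 :> nat) * path_inc v j)%N); last first.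
  by move=> v _; rewrite /path_inc mulnDl (eq_sym i) (eq_sym i.+1).
rewrite big_split /= (sum_nat_delta _ _ (fun v => path_inc v j)).
rewrite (sum_nat_delta _ _ (fun v => path_inc v j)) /path_inc; lia.
Qed.

(** The diagonal of [B B^T] records degrees, which are 2 except at the two ends of the path; the
    second summand on the left makes up for the ends. *)
Lemma path_inc_vertices k v w : (v < k.+2)%N -> (w < k.+2)%N ->
  (\sum_(i < k.+1) path_inc v i * path_inc w i + (v == w) * ((v == 0) + (v == k.+1)) =
   ((v.+1 == w) || (w.+1 == v)) + 2 * (v == w))%N.
Proof.
move=> vk wk; rewrite /path_inc.
under eq_bigr => i _ do rewrite mulnDl.
rewrite big_split /= (sum_nat_delta _ _ (path_inc w)).
rewrite (sum_nat_deltaS _ _ (path_inc w)) /path_inc.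
case: v vk => [|v] vk /=; lia.
Qed.

(** * Energies of induced subgraphs and the gain from enlarging them *)

Section Graph.
Variables (R : rcfType) (n : nat) (e : rel 'I_n).
Hypotheses (e_sym : symmetric e) (e_irr : irreflexive e).
Implicit Types (U H W B S : {set 'I_n}) (x y z : 'I_n).

(** All induced subgraphs share the index set ['I_n], with zero rows and columns outside [U]. This
    adds only zero eigenvalues, and the matrices of nested subgraphs can be added and compared
    directly. *)
Definition adjm U : 'M[R]_n := \matrix_(i, j) ([&& i \in U, j \in U & e i j])%:R.

Definition senergy U : R := pos_energy (adjm U).

Definition nbr U x : {set 'I_n} := [set y in U | e x y].

Definition deg U x : nat := #|nbr U x|.

Definition ind S : 'cV[R]_n := \col_i (i \in S)%:R.

Lemma adjm_sym U : (adjm U)^T = adjm U.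
Proof. by apply/matrixP => i j; rewrite !mxE e_sym andbCA. Qed.

Lemma senergy_ge0 U : 0 <= senergy U.
Proof. exact: pos_energy_ge0. Qed.

Lemma adjm_col U x : x \notin U -> adjm U *m (delta_mx x 0 : 'cV_n) = 0.
Proof.
move=> xU; rewrite -colE; apply/colP => i.
by rewrite !mxE (negPf xU) andbF.
Qed.

Lemma dot_ind S (u : 'cV[R]_n) : dot (ind S) u = \sum_(i in S) u i 0.
Proof.
rewrite dotE [RHS]big_mkcond; apply: eq_bigr => i _; rewrite mxE.
by case: (i \in S); rewrite ?mul1r ?mul0r.
Qed.

Lemma dot_indC S S' : dot (ind S) (ind S') = #|S :&: S'|%:R.
Proof.
rewrite dot_ind -sum1_card natr_sum big_mkcond [RHS]big_mkcond.
apply: eq_bigr => i _; rewrite mxE in_setI.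
by case: (i \in S); case: (i \in S').
Qed.

Lemma adjm_ind U S x :
  (adjm U *m ind S) x 0 = (x \in U)%:R * #|nbr U x :&: S|%:R.
Proof.
rewrite mxE; case: (boolP (x \in U)) => xU; last first.
  by rewrite mul0r big1 // => j _; rewrite !mxE (negPf xU) mul0r.
rewrite mul1r -sum1_card natr_sum [RHS]big_mkcond; apply: eq_bigr => j _.
rewrite !mxE xU inE [j \in nbr _ _]inE /=.
by case: (j \in U); case: (e x j); case: (j \in S); rewrite ?mulr1 ?mulr0.
Qed.

(* [X] and [N] are the positive and negative parts of [adjm U].  The last two
   clauses are [negp_le] and [resolvent_parabola] read through the spectrum. *)
Definition parts_of U (X N : 'M[R]_n) :=
  [/\ [/\ psd X, psd N, adjm U = X - N & 2 * \tr (adjm U *m X) - \tr (X *m X) = senergy U],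
   forall i j, (i \notin U) || (j \notin U) -> X i j = 0 /\ N i j = 0,
   forall (t : R) (u : 'cV_n), 0 < t ->
     dot u (N *m u) <= (t * dot u u + dot (adjm U *m u) (adjm U *m u) / t) / 4
                       - dot u (adjm U *m u) / 2
 & forall (l a : R) (b : 'cV_n), 0 < l -> 0 < a ->
     let c := a + 2 * a ^+ 2 / l in
     exists2 u, l *: u + N *m u = b &
       dot b b / l - l / (4 * a * (l + a) ^+ 3) *
         (dot (adjm U *m b) (adjm U *m b) - 2 * c * dot b (adjm U *m b) + c ^+ 2 * dot b b)
       <= dot b u].

Lemma partsP U : exists X N, parts_of U X N.
Proof.
have [X [N [[pX pN AE En] ker hN hV]]] := pos_neg_parts (adjm_sym U).
exists X, N; split => // i j.
have sX k l : X k l = X l k by case: pX => s _; rewrite -[in LHS]s mxE.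
have sN k l : N k l = N l k by case: pN => s _; rewrite -[in LHS]s mxE.
have h k l : l \notin U -> X k l = 0 /\ N k l = 0.
  move=> /adjm_col /ker[]; rewrite -!colE => /colP/(_ k) X0 /colP/(_ k) N0.
  by move: X0 N0; rewrite !mxE.
by case/orP => /h h0; [rewrite sX sN|].
Qed.

(* The variational bound [pos_energy_ge] for [adjm U], tested on [X + Z]. *)
Lemma senergy_gain U H X N Z : H \subset U -> parts_of H X N -> psd Z ->
  senergy H + 2 * \tr ((adjm U - X) *m Z) - \tr (Z *m Z) <= senergy U.
Proof.
move=> HU [[pX pN AE <-] supp _ _] pZ.
have := pos_energy_ge (adjm_sym U) (psdD pX pZ); apply: le_trans.
have -> : \tr (adjm H *m X) = \tr (adjm U *m X).
  apply: eq_bigr => i _; rewrite !mxE; apply: eq_bigr => j _; rewrite !mxE.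
  have [iH|iH] := boolP (i \in H); last by rewrite (supp j i _).1 ?iH ?orbT // !mulr0.
  have [jH|jH] := boolP (j \in H); last by rewrite (supp j i _).1 ?jH // !mulr0.
  by rewrite !(subsetP HU).
rewrite !mulmxDl !mulmxDr !mxtraceD mulNmx linearN /= (mxtrace_mulC Z X).
rewrite le_eqVlt; apply/orP; left; apply/eqP; ring.
Qed.

Lemma disjoint_tr0 (M Y : 'M[R]_n) H W : [disjoint H & W] ->
  (forall i j, (i \notin H) || (j \notin H) -> M i j = 0) ->
  (forall i j, (i \notin W) || (j \notin W) -> Y i j = 0) ->
  \tr (M *m Y) = 0.
Proof.
move=> dis M0 Y0; apply: big1 => i _; rewrite mxE; apply: big1 => j _.
have [iH|iH] := boolP (i \in H); last by rewrite M0 ?iH // mul0r.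
by rewrite Y0 ?mulr0 // (disjointFr dis iH) orbT.
Qed.

(** The sum of the positive parts of both sides is tested. Each is supported on its own side, so
    edges between [H] and [W] do not enter and the cross term vanishes. *)
Lemma senergyU H W : [disjoint H & W] ->
  senergy H + senergy W <= senergy (H :|: W).
Proof.
move=> dis; have [X [N pH]] := partsP H; have [Y [M pW]] := partsP W.
have [[_ _ AE _] s1 _ _] := pH; have [[pY _ AW <-] s2 _ _] := pW.
have := senergy_gain (subsetUl H W) pH pY; apply: le_trans.
suff -> : \tr ((adjm (H :|: W) - X) *m Y) = \tr (adjm W *m Y) by lra.
rewrite mulmxBl [LHS]raddfB /= [X in _ - X](disjoint_tr0 dis) ?subr0.
- apply: eq_bigr => i _; rewrite !mxE; apply: eq_bigr => j _; rewrite !mxE.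
  have [iH|iH] := boolP (i \in W); last by rewrite (s2 j i _).1 ?iH ?orbT // !mulr0.
  have [jH|jH] := boolP (j \in W); last by rewrite (s2 j i _).1 ?jH // !mulr0.
  by rewrite !inE iH jH !orbT.
- by move=> i j /s1[].
- by move=> i j /s2[].
Qed.

(** Tested on [(l / dot z z) z z^T]: a Rayleigh quotient of at least [l] for [adjm U - X] is worth
    [l ^+ 2]. *)
Lemma senergy_gain1 U H X N (z : 'cV[R]_n) (l : R) :
  H \subset U -> parts_of H X N -> 0 <= l -> z != 0 ->
  l * dot z z <= dot z ((adjm U - X) *m z) ->
  senergy H + l ^+ 2 <= senergy U.
Proof.
move=> HU pH l0 zN0 hz.
have z_gt0 : 0 < dot z z.
  by rewrite lt0r dot_ge0 andbT; apply: contraNneq zN0 => /dot_eq0 ->.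
have t0 : 0 <= l / dot z z by rewrite divr_ge0 // ltW.
have := senergy_gain HU pH (psd_rank1 z t0); apply: le_trans.
rewrite -!scalemxAr -!scalemxAl !mxtraceZ !tr_rank1 -addrA lerD2l.
have -> : dot z (z *m z^T *m z) = dot z z ^+ 2.
  rewrite -mulmxA [z^T *m z]mx11_scalar mul_mx_scalar dotZr.
  by rewrite -/(dot z z) expr2.
have : l ^+ 2 <= l / dot z z * dot z ((adjm U - X) *m z).
  apply: le_trans (_ : l / dot z z * (l * dot z z) <= _).
    by rewrite mulrCA mulfVK ?lt0r_neq0 // expr2.
  exact: ler_wpM2l.
have -> : l / dot z z * (l / dot z z * dot z z ^+ 2) = l ^+ 2.
  by field; exact: lt0r_neq0.
lra.
Qed.

(** This is the squared norm of [adjm H *m ind B]; for [B] inside [H] it counts the walks of length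
    two in [H] that start and end in [B]. *)
Definition codeg_sum H B : nat := \sum_(x in H) #|nbr H x :&: B| ^ 2.

(** For [B] inside [H], twice the number of edges within [B]. *)
Definition inner_deg H B : nat := \sum_(x in B) #|nbr H x :&: B|.

Lemma adjm_ind_sq H B :
  dot (adjm H *m ind B) (adjm H *m ind B) = (codeg_sum H B)%:R.
Proof.
rewrite dotE /codeg_sum natr_sum [RHS]big_mkcond; apply: eq_bigr => x _.
rewrite adjm_ind; case: (x \in H); last by rewrite !mul0r.
by rewrite !mul1r natrX expr2.
Qed.

Lemma dot_adjm_ind H B : B \subset H ->
  dot (ind B) (adjm H *m ind B) = (inner_deg H B)%:R.
Proof.
move=> BH; rewrite dot_ind /inner_deg natr_sum; apply: eq_bigr => x xB.
by rewrite adjm_ind (subsetP BH x xB) mul1r.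
Qed.

Lemma parts_ind0 H X N S : parts_of H X N -> [disjoint H & S] ->
  X *m ind S = 0 /\ N *m ind S = 0.
Proof.
move=> [_ s0 _ _] dis; split; apply/colP => i; rewrite !mxE big1 // => j _.
  rewrite mxE; case: (boolP (j \in S)) => jS; last by rewrite mulr0.
  by rewrite (s0 i j _).1 ?mul0r // (disjointFl dis jS) orbT.
rewrite mxE; case: (boolP (j \in S)) => jS; last by rewrite mulr0.
by rewrite (s0 i j _).2 ?mul0r // (disjointFl dis jS) orbT.
Qed.

(** * Attaching an independent set of twins with common neighbourhood B *)

Section Join.
Variables (U H W B : {set 'I_n}).
Hypotheses (UE : U = H :|: W) (HW : [disjoint H & W]) (BH : B \subset H).
Hypothesis eWB : forall w i, w \in W -> i \in U -> e w i = (i \in B).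

Lemma adjm_join (z : 'cV[R]_n) :
  dot z ((adjm U - adjm H) *m z) = 2 * (dot (ind W) z * dot (ind B) z).
Proof.
have -> : adjm U - adjm H = ind W *m (ind B)^T + ind B *m (ind W)^T.
  apply/matrixP => i j; rewrite !mxE !big_ord1 !mxE UE !inE.
  have BW k : k \in B -> (k \in H) * (k \in W = false).
    by move=> kB; rewrite (subsetP BH) // (disjointFr HW) ?(subsetP BH).
  have eW w k : w \in W -> k \in H -> e w k = (k \in B).
    by move=> wW kH; rewrite eWB // UE inE kH.
  have eWW w k : w \in W -> k \in W -> e w k = (k \in B).
    by move=> wW kH; rewrite eWB // UE inE kH orbT.
  have [iW|iW] := boolP (i \in W); have [jW|jW] := boolP (j \in W).
  - have iB : i \in B = false by apply/negP => /BW[_]; rewrite iW.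
    have jB : j \in B = false by apply/negP => /BW[_]; rewrite jW.
    rewrite eWW // iB jB !(disjointFl HW) //.
    by rewrite /= !mulr0n !(mulr0, mul0r, subr0, addr0).
  - have iB : i \in B = false by apply/negP => /BW[_]; rewrite iW.
    rewrite iB (disjointFl HW iW) /= orbF subr0 mul0r addr0 mul1r.
    case: (boolP (j \in H)) => jH; first by rewrite eW.
    by rewrite (contraNF (subsetP BH j) jH).
  - have jB : j \in B = false by apply/negP => /BW[_]; rewrite jW.
    rewrite jB (disjointFl HW jW) /= orbF andbF subr0 mul0r add0r mulr1.
    case: (boolP (i \in H)) => iH; first by rewrite e_sym eW.
    by rewrite (contraNF (subsetP BH i) iH).
  - by rewrite !orbF subrr !mul0r mulr0 addr0.
rewrite mulmxDl dotDr -!mulmxA.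
rewrite [(ind B)^T *m z]mx11_scalar [(ind W)^T *m z]mx11_scalar !mul_mx_scalar.
rewrite !dotZr -/(dot (ind B) z) -/(dot (ind W) z) !(dotC z); ring.
Qed.

Let ind_WB : dot (ind W) (ind B) = 0 :> R.
Proof.
rewrite dot_indC (_ : W :&: B = set0) ?cards0 //; apply/eqP.
rewrite setI_eq0 disjoint_sym; exact: disjointWl BH HW.
Qed.

(* The test vector is supported on [W] and on the solution [u] of
   [(l + N) u = r 1_B] with [l ^+ 2 = Lam]; on [H] it uses only the negative part
   of [adjm H]. *)
Lemma join_gain (xi Lam : R) : (0 < #|W|)%N -> 0 < xi -> 0 < Lam ->
  let s := #|W|%:R in let d := #|B|%:R in
  s * (codeg_sum H B)%:R / Lam + xi ^+ 2 * (1 + 2 * xi) ^+ 2 * (s * d)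
   - 2 * xi * (1 + 2 * xi) * (s * (inner_deg H B)%:R) / Num.sqrt Lam
   <= 4 * xi * (1 + xi) ^+ 3 * (s * d - Lam) ->
  senergy H + Lam <= senergy U.
Proof.
move=> W0 xi0 Lam0 s d hyp.
have HU : H \subset U by rewrite UE subsetUl.
have [X [N pH]] := partsP H; have [[pX [symN _] AE _] _ _ hV] := pH.
have [_ NW] := parts_ind0 pH HW.
pose l := Num.sqrt Lam; have l0 : 0 < l by rewrite sqrtr_gt0.
have l2 : l ^+ 2 = Lam by rewrite sqr_sqrtr // ltW.
have s0 : 0 < s by rewrite ltr0n.
(* The [s] twins act like one vertex attached with weight [r], the square root of their number. *)
pose r := Num.sqrt s; have r0 : 0 < r by rewrite sqrtr_gt0.
have r2 : r ^+ 2 = s by rewrite sqr_sqrtr // ltW.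
pose b : 'cV[R]_n := r *: ind B.
(* A tangency point proportional to [l] makes the estimate homogeneous, so that the ratio [xi] is
   the only free parameter. *)
have [u ub] := hV l (xi * l) b l0 (mulr_gt0 xi0 l0).
have bb : dot b b = s * d.
  by rewrite dotZl dotZr dot_indC setIid mulrA -expr2 r2.
have bA : dot b (adjm H *m b) = s * (inner_deg H B)%:R.
  by rewrite -scalemxAr dotZl dotZr dot_adjm_ind // mulrA -expr2 r2.
have bAA : dot (adjm H *m b) (adjm H *m b) = s * (codeg_sum H B)%:R.
  by rewrite -scalemxAr dotZl dotZr adjm_ind_sq mulrA -expr2 r2.
rewrite bb bA bAA => hu.
have {hu hyp} lbu : l <= dot b u.
  apply: le_trans hu; set m1 := s * (inner_deg H B)%:R in hyp *.
  set m2 := s * (codeg_sum H B)%:R in hyp *; set m0 := s * d in hyp *.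
  have xi1 : 0 < 1 + xi by rewrite addr_gt0.
  rewrite -(ler_pM2r (_ : 0 < 4 * xi * (1 + xi) ^+ 3 * l)); last first.
    by rewrite !mulr_gt0 // exprn_gt0.
  have -> : (m0 / l - l / (4 * (xi * l) * (l + xi * l) ^+ 3) *
     (m2 - 2 * (xi * l + 2 * (xi * l) ^+ 2 / l) * m1 +
      (xi * l + 2 * (xi * l) ^+ 2 / l) ^+ 2 * m0)) * (4 * xi * (1 + xi) ^+ 3 * l) =
    4 * xi * (1 + xi) ^+ 3 * m0 - (m2 / l ^+ 2 + xi ^+ 2 * (1 + 2 * xi) ^+ 2 * m0
       - 2 * xi * (1 + 2 * xi) * m1 / l).
    field; rewrite !lt0r_neq0 //.
    by rewrite addr_gt0 // mulr_gt0.
  have -> : l * (4 * xi * (1 + xi) ^+ 3 * l) = 4 * xi * (1 + xi) ^+ 3 * l ^+ 2.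
    by ring.
  rewrite l2; rewrite -/l in hyp; lra.
have Wu : dot (ind W) u = 0.
  have : l * dot (ind W) u = 0.
    have : dot (ind W) (l *: u + N *m u) = 0 by rewrite ub dotZr ind_WB mulr0.
    by rewrite dotDr dotZr dot_mulmx symN NW dot0l addr0.
  by move/eqP; rewrite mulf_eq0 (gt_eqF l0) => /eqP.
pose z : 'cV[R]_n := u + r^-1 *: ind W.
have Wz : dot (ind W) z = r.
  rewrite dotDr Wu add0r dotZr dot_indC setIid -/s -r2 expr2 mulrA mulVf ?mul1r //.
  exact: lt0r_neq0.
have Bz : dot (ind B) z = dot (ind B) u.
  by rewrite dotDr dotZr (dotC (ind B) (ind W)) ind_WB mulr0 addr0.
have Nz : dot z (N *m z) = dot b u - l * dot u u.
  have -> : N *m z = N *m u by rewrite mulmxDr -scalemxAr NW scaler0 addr0.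
  rewrite dotDl dotZl (dot_mulmx (ind W)) symN NW.
  by rewrite dot0l mulr0 addr0 -ub dotDl dotZl (dotC (N *m u)) addrAC subrr add0r.
have zz : dot z z = dot u u + 1.
  rewrite {1}/z dotDl dotZl Wz mulVf ?lt0r_neq0 //.
  by rewrite dotDr dotZr (dotC u (ind W)) Wu mulr0 addr0.
have bu : dot b u = r * dot (ind B) u by rewrite dotZl.
rewrite -l2; apply: (senergy_gain1 HU pH (ltW l0) (z := z)).
  apply: contraTneq r0 => z0; move: Wz.
  by rewrite z0 /dot mulmx0 mxE => <-; rewrite ltxx.
have -> : adjm U - X = (adjm U - adjm H) - N.
  by apply/matrixP => i j; rewrite AE !mxE; ring.
(* The form is [2 dot b u - (dot b u - l dot u u) = dot b u + l dot u u], to be compared with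
   [l (dot u u + 1)]; this is [lbu]. *)
by rewrite mulmxBl dotBr adjm_join Wz Bz Nz zz; lra.
Qed.

(** Edges inside [B] only help; dropping their term avoids the square root of [Lam]. *)
Lemma join_gain0 (xi Lam : R) : (0 < #|W|)%N -> 0 < xi -> 0 < Lam ->
  let s := #|W|%:R in let d := #|B|%:R in
  s * (codeg_sum H B)%:R / Lam + xi ^+ 2 * (1 + 2 * xi) ^+ 2 * (s * d)
   <= 4 * xi * (1 + xi) ^+ 3 * (s * d - Lam) ->
  senergy H + Lam <= senergy U.
Proof.
move=> W0 xi0 Lam0 s d hyp; apply: (join_gain W0 xi0 Lam0); apply: le_trans hyp.
rewrite lerBlDr lerDl divr_ge0 ?sqrtr_ge0 // !mulr_ge0 ?ler0n ?ltW //.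
by rewrite addr_gt0 // mulr_gt0.
Qed.

(** A cruder test for a single vertex: the vector is constant on [S], and the bound of [negp_le]
    replaces the resolvent. Restricting to [S] pays when the rest of [B] may have large
    codegrees. *)
Lemma join_gain_sub (S : {set 'I_n}) (a Lam : R) : #|W| = 1%N -> S \subset B ->
  (0 < #|S|)%N -> 0 < a -> 0 < Lam ->
  let t := #|S|%:R in
  Lam * t + (Lam * a * t + (codeg_sum H S)%:R / a) / 4 <= t ^+ 2 ->
  senergy H + Lam <= senergy U.
Proof.
move=> W1 SB S0 a0 Lam0 t hyp.
have HU : H \subset U by rewrite UE subsetUl.
have SH : S \subset H by apply: subset_trans BH.
have [X [N pH]] := partsP H; have [[pX [symN _] AE _] _ hN _] := pH.
have [_ NW] := parts_ind0 pH HW.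
pose l := Num.sqrt Lam; have l0 : 0 < l by rewrite sqrtr_gt0.
have l2 : l ^+ 2 = Lam by rewrite sqr_sqrtr // ltW.
have t0 : 0 < t by rewrite ltr0n.
have WS : W :&: S = set0.
  by apply/eqP; rewrite setI_eq0 disjoint_sym; exact: disjointWl SH HW.
(* With this weight the edges from the vertex to [S] contribute [2 l]: one [l] is the quotient
   required on the vertex itself, and the other has to cover the part on [S], which is the
   hypothesis. *)
pose r := l / t; have r0 : 0 < r by rewrite divr_gt0.
pose z : 'cV[R]_n := r *: ind S + ind W.
have Wz : dot (ind W) z = 1.
  by rewrite dotDr dotZr !dot_indC WS cards0 mulr0 add0r setIid W1.
have Bz : dot (ind B) z = r * t.
  by rewrite dotDr dotZr (dotC _ (ind W)) ind_WB addr0 dot_indC (setIidPr SB).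
have zz : dot z z = r ^+ 2 * t + 1.
  rewrite {1}/z dotDl dotZl Wz dotDr dotZr (dotC _ (ind W)) !dot_indC WS.
  by rewrite cards0 addr0 setIid mulrA.
have Nz : dot z (N *m z) = r ^+ 2 * dot (ind S) (N *m ind S).
  have -> : N *m z = r *: (N *m ind S) by rewrite mulmxDr -scalemxAr NW addr0.
  rewrite dotZr dotDl dotZl (dot_mulmx (ind W)) symN NW dot0l addr0.
  by rewrite mulrA.
have hNS : l * dot (ind S) (N *m ind S) <=
    (Lam * a * t + (codeg_sum H S)%:R / a) / 4.
  have := hN (l * a) (ind S) (mulr_gt0 l0 a0).
  rewrite dot_indC setIid -/t dot_adjm_ind // adjm_ind_sq.
  set q := dot _ _; set m := (codeg_sum H S)%:R; set m' := (inner_deg H S)%:R.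
  have m'0 : 0 <= m' by rewrite ler0n.
  move=> h; have {h} : q <= (l * a * t + m / (l * a)) / 4 by lra.
  move=> /(ler_wpM2l (ltW l0)) /le_trans; apply.
  rewrite le_eqVlt; apply/orP; left; apply/eqP; rewrite -l2; field.
  by rewrite !lt0r_neq0.
rewrite -l2; apply: (senergy_gain1 HU pH (ltW l0) (z := z)).
  apply: contraTneq r0 => z0; move: Wz.
  by rewrite z0 /dot mulmx0 mxE => /esym/eqP; rewrite oner_eq0.
have -> : adjm U - X = (adjm U - adjm H) - N.
  by apply/matrixP => i j; rewrite AE !mxE; ring.
rewrite mulmxBl dotBr adjm_join Wz Bz Nz zz mul1r.
have -> : r * t = l by rewrite /r mulfVK // lt0r_neq0.
have -> : r ^+ 2 * t = Lam / t by rewrite -l2 /r; field; rewrite lt0r_neq0.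
have -> : r ^+ 2 * dot (ind S) (N *m ind S) = l * (l * dot (ind S) (N *m ind S)) / t ^+ 2.
  by rewrite /r; field; rewrite lt0r_neq0.
have h : l * (l * dot (ind S) (N *m ind S)) / t ^+ 2 <= l * (t ^+ 2 - Lam * t) / t ^+ 2.
  rewrite ler_pM2r ?invr_gt0 ?exprn_gt0 // ler_pM2l //; lra.
have e2 : l * (t ^+ 2 - Lam * t) / t ^+ 2 = l - l * (Lam / t).
  by field; rewrite lt0r_neq0.
lra.
Qed.

End Join.

Lemma card_deg_sum U : (\sum_(x in U) deg U x)%:R = \tr (adjm U *m adjm U).
Proof.
rewrite tr_sym2 ?adjm_sym // natr_sum [LHS]big_mkcond; apply: eq_bigr => i _.
case: (boolP (i \in U)) => iU; last first.
  by rewrite big1 // => j _; rewrite mxE (negPf iU) expr0n.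
rewrite /deg -sum1_card natr_sum big_mkcond; apply: eq_bigr => j _.
by rewrite inE mxE iU /=; case: (_ && _); rewrite ?expr1n ?expr0n.
Qed.

Lemma senergy_bipartite U (chi : pred 'I_n) :
  (forall x y, x \in U -> y \in U -> e x y -> chi x != chi y) ->
  2 * senergy U = (\sum_(x in U) deg U x)%:R.
Proof.
move=> bip; rewrite (pos_energy_bipartite (chi := chi)) ?adjm_sym //.
  by rewrite card_deg_sum.
move=> i j chiE; rewrite mxE; case: and3P => // -[iU jU eij].
by have := bip i j iU jU eij; rewrite chiE eqxx.
Qed.

(** * Attaching an ear *)

Definition pathm k : 'M[R]_k :=
  \matrix_(i, j) ((i.+1 == j :> nat) || (j.+1 == i :> nat))%:R.

Lemma pathm_sym k : (pathm k)^T = pathm k.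
Proof. by apply/matrixP => i j; rewrite !mxE orbC. Qed.

Lemma pos_energy_pathm k : pos_energy (pathm k.+1) = k%:R.
Proof.
have bip (i j : 'I_k.+1) : odd i = odd j -> pathm k.+1 i j = 0.
  rewrite mxE => oij; case: eqP => [ij|_].
    by move: oij; rewrite -ij /=; case: odd.
  by case: eqP => [ij|//]; move: oij; rewrite -ij /=; case: odd.
have := pos_energy_bipartite (pathm_sym k.+1) bip.
rewrite tr_sym2 ?pathm_sym // => E.
suff S : \sum_i \sum_j pathm k.+1 i j ^+ 2 = 2 * k%:R by move: E; rewrite S; lra.
have S1 : \sum_(i < k.+1) \sum_(j < k.+1) (i.+1 == j :> nat)%:R = k%:R :> R.
  rewrite big_ord_recr /= [X in _ + X]big1 => [|j _]; last first.
    by rewrite gtn_eqF.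
  rewrite addr0 (eq_bigr (fun=> 1)) => [|i _]; first by rewrite sumr_const card_ord.
  rewrite (bigD1 (lift ord0 i)) //= big1 ?addr0 ?eqxx // => j /eqP ji.
  case: eqP => // ij; case: ji; apply: val_inj; rewrite /= -ij /bump /=; lia.
have S2 : \sum_(i < k.+1) \sum_(j < k.+1) (j.+1 == i :> nat)%:R = k%:R :> R.
  by rewrite exchange_big.
rewrite mulr2n mulrDl mul1r -{1}S1 -S2 -big_split; apply: eq_bigr => i _.
rewrite -big_split; apply: eq_bigr => j _; rewrite mxE /=.
case: (eqVneq i.+1 (j : nat)) => [ij|_] /=; last first.
  by case: eqP; rewrite ?expr1n ?expr0n ?add0r.
by case: eqP => [ji|_]; [lia | rewrite expr1n addr0].
Qed.

Definition loops k : 'M[R]_k.+2 :=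
  \matrix_(i, j) ((i == j) && ((i == ord0) || (i == ord_max)))%:R.

(* With incidence matrix [B], a path minus unit loops at its ends is [B B^T - 2],
   and [B^T B - 2] is the path with one vertex less. *)
Lemma pos_energy_loops k : k%:R <= pos_energy (pathm k.+2 - loops k).
Proof.
pose B : 'M[R]_(k.+2, k.+1) := \matrix_(v, i) (path_inc v i)%:R.
rewrite -pos_energy_pathm.
have -> : pathm k.+1 = B^T *m B - 2%:M.
  apply/matrixP => i j; rewrite !mxE.
  have -> : \sum_v B^T i v * B v j =
      (\sum_(v < k.+2) path_inc v i * path_inc v j)%:R :> R.
    by rewrite natr_sum; apply: eq_bigr => v _; rewrite !mxE natrM.
  rewrite path_inc_edges ?ltn_ord // natrD natrM val_eqE mulr_natr addrK.
  by rewrite mulrb.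
have -> : pathm k.+2 - loops k = B *m B^T - 2%:M.
  apply/matrixP => v w; rewrite !mxE.
  have -> : \sum_i B v i * B^T i w =
      (\sum_(i < k.+1) path_inc v i * path_inc w i)%:R :> R.
    by rewrite natr_sum; apply: eq_bigr => i _; rewrite !mxE natrM.
  have := path_inc_vertices (ltn_ord v) (ltn_ord w).
  set s := (\sum_(_ < _) _)%N => E; apply/eqP; rewrite subr_eq addrAC eq_sym subr_eq.
  apply/eqP.
  have -> : 2%:R *+ (v == w) = (2 * (v == w))%:R :> R by rewrite natrM mulr_natr.
  rewrite -!natrD -val_eqE /= -E; congr (_ + _)%:R.
  rewrite -!val_eqE /=; case: (v == w :> nat) => //=; rewrite mul1n.
  by case: eqP => [->|_]; case: eqP.
exact: pos_energy_gram.
Qed.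

(** Row by row, [(a p + c q) ^+ 2] is at most twice the sum of the two squares, and the entries [p]
    and [q] are 0 or 1. *)
Lemma dot_adjm_sq H (u : 'cV[R]_n) (x y : 'I_n) (a c : R) :
  u = a *: ind [set x] + c *: ind [set y] ->
  dot (adjm H *m u) (adjm H *m u) <=
  2 * (a ^+ 2 * (deg H x)%:R + c ^+ 2 * (deg H y)%:R).
Proof.
move=> ->; rewrite dotE mulrDr.
have sq w : \sum_i (i \in H)%:R * #|nbr H i :&: [set w]|%:R ^+ 2 <= (deg H w)%:R :> R.
  rewrite /deg -sum1_card natr_sum [X in _ <= X]big_mkcond; apply: ler_sum => i _.
  rewrite inE e_sym; case: (boolP (i \in H)) => iH; last by rewrite mul0r.
  rewrite mul1r; have [wi|wi] := boolP (e i w) => /=.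
    rewrite expr_le1 ?ler0n // (_ : 1 = 1%:R) // ler_nat -(cards1 w).
    exact/subset_leq_card/subsetIr.
  rewrite (_ : _ :&: _ = set0) ?cards0 ?expr0n //; apply/setP => z.
  by rewrite !inE; case: eqP => [->|_]; rewrite ?(negPf wi) ?andbF.
apply: le_trans (_ : 2 * (a ^+ 2 * \sum_i (i \in H)%:R * #|nbr H i :&: [set x]|%:R ^+ 2) +
  2 * (c ^+ 2 * \sum_i (i \in H)%:R * #|nbr H i :&: [set y]|%:R ^+ 2) <= _); last first.
  by apply: lerD; apply: ler_wpM2l => //; apply: ler_wpM2l; rewrite ?sqr_ge0.
rewrite !mulr_sumr -big_split; apply: ler_sum => i _.
rewrite mulmxDr -!scalemxAr.
have -> : (a *: (adjm H *m ind [set x]) + c *: (adjm H *m ind [set y])) i 0 =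
  a * (adjm H *m ind [set x]) i 0 + c * (adjm H *m ind [set y]) i 0.
  by rewrite mxE [X in X + _]mxE [X in _ + X]mxE.
rewrite !adjm_ind /=; case: (i \in H); last by rewrite !mul0r !mulr0 addr0 mul0r.
rewrite !mul1r.
set p := #|nbr H i :&: [set x]|%:R; set q := #|nbr H i :&: [set y]|%:R.
have := sqr_ge0 (a * p - c * q); rewrite sqrrB.
have -> : (a * p + c * q) * (a * p + c * q) =
  (a * p) ^+ 2 + 2 * (a * p * (c * q)) + (c * q) ^+ 2 by ring.
by rewrite !exprMn; lra.
Qed.

(* The test matrix is the positive part of the path with loops; the loops at the
   ends absorb the negative part of [adjm H]. *)
Lemma ear_gain U H k (f : 'I_k.+2 -> 'I_n) :
  injective f -> f ord0 \in H -> f ord_max \in H ->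
  (forall i, i != ord0 -> i != ord_max -> f i \notin H) ->
  U = H :|: [set f i | i : 'I_k.+2] ->
  (forall i j, e (f i) (f j) = (i.+1 == j :> nat) || (j.+1 == i :> nat)) ->
  (forall i z, i != ord0 -> i != ord_max -> z \in H -> e (f i) z ->
     z = f ord0 \/ z = f ord_max) ->
  ~~ e (f ord0) (f ord_max) ->
  (deg H (f ord0) <= 2)%N -> (deg H (f ord_max) <= 2)%N ->
  senergy H + k%:R <= senergy U.
Proof.
move=> finj xH yH fH UE ef eH exy dx dy.
have HU : H \subset U by rewrite UE subsetUl.
have [X [N pH]] := partsP H; have [[pX [symN N0] AE _] supp hN _] := pH.
set x := f ord0 in xH exy dx eH; set y := f ord_max in yH exy dy eH.
pose M : 'M[R]_k.+2 := pathm k.+2 - loops k.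
have symM : M^T = M.
  rewrite [LHS]linearB /= pathm_sym; congr (_ - _).
  apply/matrixP => i j; rewrite !mxE eq_sym.
  by case: (eqVneq i j) => // ->.
have [Z [N' [[pZ _ _ EZ] _ _ _]]] := pos_neg_parts symM.
pose E : 'M[R]_(n, k.+2) := \matrix_(v, i) (v == f i)%:R.
have EE : E^T *m E = 1%:M.
  apply/matrixP => i j; rewrite !mxE (bigD1 (f i)) //= big1 ?addr0 => [|v vi].
    by rewrite !mxE eqxx mul1r (inj_eq finj).
  by rewrite !mxE (negPf vi) mul0r.
have EME (Q : 'M[R]_n) i j : (E^T *m Q *m E) i j = Q (f i) (f j).
  rewrite mxE (bigD1 (f j)) //= big1 ?addr0 => [|v vj]; last first.
    by rewrite [E v j]mxE (negPf vj) mulr0.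
  rewrite [E _ _]mxE eqxx mulr1 mxE (bigD1 (f i)) //= big1 ?addr0 => [|v vi].
    by rewrite !mxE eqxx mul1r.
  by rewrite !mxE (negPf vi) mul0r.
have := senergy_gain HU pH (psd_conj E pZ); apply: le_trans.
have -> : \tr (E *m Z *m E^T *m (E *m Z *m E^T)) = \tr (Z *m Z).
  rewrite [RHS]mxtrace_mulC !mulmxA -(mulmxA _ E^T E) EE mulmx1.
  by rewrite mxtrace_mulC !mulmxA EE mul1mx.
have -> : \tr ((adjm U - X) *m (E *m Z *m E^T)) =
    \tr ((E^T *m (adjm U - X) *m E) *m Z).
  by rewrite !mulmxA mxtrace_mulC !mulmxA.
(* It is enough that the restriction of [adjm U - X] to the path dominates the path with loops in
   the semidefinite order. *)
suff h : 0 <= \tr ((E^T *m (adjm U - X) *m E - M) *m Z).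
  have := pos_energy_loops k; rewrite -/M -EZ => hk.
  by move: h; rewrite mulmxBl [\tr (_ - _)]raddfB /=; lra.
apply: psd_tr_ge0 pZ.
have fU i : f i \in U by rewrite UE inE imset_f ?orbT.
have key i j : (E^T *m (adjm U - X) *m E - M) i j = loops k i j - N (f i) (f j).
  have -> : adjm U - X = (adjm U - adjm H) - N.
    by apply/matrixP => v w; rewrite AE !mxE; ring.
  rewrite mxE EME !mxE !fU ef /=.
  suff -> : [&& f i \in H, f j \in H & (i.+1 == j) || (j.+1 == i)] = false by rewrite mulr0n; ring.
  apply/negbTE/and3P => -[iH jH]; rewrite -ef.
  have hi (l : 'I_k.+2) : f l \in H -> l = ord0 \/ l = ord_max.
    move=> lH; case: (eqVneq l ord0) => [->|l0]; first by left.
    by case: (eqVneq l ord_max) => [->|l1]; [right | case/negP: (fH l l0 l1)].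
  by case: (hi _ iH) => ->; case: (hi _ jH) => ->; rewrite -/x -/y ?e_irr //;
    [apply/negP | rewrite e_sym; apply/negP].
split.
  apply/matrixP => i j; rewrite [LHS]mxE !key -[in LHS]symN [_^T _ _]mxE !mxE.
  by case: (eqVneq i j) => [->|ij] //; rewrite eq_sym (negPf ij).
move=> w.
have -> : E^T *m (adjm U - X) *m E - M = loops k - E^T *m N *m E.
  by apply/matrixP => i j; rewrite key [RHS]mxE [X in _ = _ + X]mxE EME.
pose w0 := w ord0 0; pose w1 := w ord_max 0; pose q := E *m w.
have om : (ord_max : 'I_k.+2) != ord0 by [].
pose u : 'cV[R]_n := w0 *: ind [set x] + w1 *: ind [set y].
(* Only the two ends of the path lie in [H], and [N] vanishes outside [H]. *)
have qu v : v \in H -> q v 0 = u v 0.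
  move=> vH; rewrite mxE (bigD1 ord0) //= (bigD1 ord_max) //= big1 => [|j].
    by rewrite !mxE !inE addr0 -/x -/y /w0 /w1; ring.
  case/andP => j0 j1; rewrite mxE; case: eqP => [vf|_]; last by rewrite mul0r.
  by have := fH j j0 j1; rewrite -vf vH.
have Nq : N *m q = N *m u.
  apply/colP => i; rewrite !mxE; apply: eq_bigr => v _.
  have [vH|vH] := boolP (v \in H); first by rewrite qu.
  by rewrite (supp i v _).2 ?vH ?orbT // !mul0r.
rewrite mulmxBl dotBr; have -> : dot w (E^T *m N *m E *m w) = dot u (N *m u).
  rewrite -!mulmxA (dot_mulmx w) trmxK -/q Nq dot_mulmx symN Nq dotC.
  by [].
have xy : x != y by rewrite (inj_eq finj).
have dx1 : dot (ind [set x]) (ind [set x]) = 1 :> R by rewrite dot_indC setIid cards1.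
have dy1 : dot (ind [set y]) (ind [set y]) = 1 :> R by rewrite dot_indC setIid cards1.
have dxy : dot (ind [set x]) (ind [set y]) = 0 :> R.
  rewrite dot_indC (_ : _ :&: _ = set0) ?cards0 //; apply/setP => z.
  by rewrite !inE; case: eqP => [->|]; rewrite ?(negPf xy).
have uu : dot u u = w0 ^+ 2 + w1 ^+ 2.
  rewrite !dotDl !dotDr !dotZl !dotZr dx1 dy1 dxy (dotC (ind [set y])) dxy; ring.
have Axx z t : e z t = false -> dot (ind [set z]) (adjm H *m ind [set t]) = 0 :> R.
  move=> zt; rewrite dot_ind big_set1 adjm_ind (_ : _ :&: _ = set0) ?cards0 ?mulr0 //.
  by apply/setP => v; rewrite !inE; case: eqP => [->|]; rewrite ?zt ?andbF.
have uAu : dot u (adjm H *m u) = 0.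
  rewrite mulmxDr -!scalemxAr !dotDl !dotDr !dotZl !dotZr !Axx ?e_irr //; first ring.
    by rewrite e_sym; exact: negbTE.
  exact: negbTE.
(* As [x] and [y] are not adjacent and have degree at most 2 in [H], [t = 2] bounds [dot u (N *m u)]
   by [(2 + 4 / 2) / 4 = 1] times [dot u u], exactly the weight of the loops. *)
have := hN 2 u (ltr0n _ 2); rewrite uAu uu.
have := dot_adjm_sq H (erefl u).
have : (deg H x)%:R <= 2 :> R by rewrite ler_nat.
have : (deg H y)%:R <= 2 :> R by rewrite ler_nat.
have -> : dot w (loops k *m w) = w0 ^+ 2 + w1 ^+ 2.
  rewrite dotE (bigD1 ord0) //= (bigD1 ord_max) //= big1 => [|i /andP[i0 i1]].
    have lw i : (i == ord0) || (i == ord_max) -> (loops k *m w) i 0 = w i 0.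
      move=> hi; rewrite mxE (bigD1 i) //= big1 => [|j ji].
        by rewrite mxE eqxx hi mul1r addr0.
      by rewrite mxE eq_sym (negPf ji) mul0r.
    by rewrite !lw ?eqxx ?orbT // addr0 !expr2.
  rewrite [(loops k *m w) _ _]mxE big1 ?mulr0 // => j _.
  by rewrite mxE (negPf i0) (negPf i1) andbF mul0r.
have := sqr_ge0 w0; have := sqr_ge0 w1.
set a2 := w0 ^+ 2; set c2 := w1 ^+ 2; set dxr := (deg H x)%:R; set dyr := (deg H y)%:R.
set D := dot _ _; set D' := dot _ _.
move=> h1 h2 h3 h4 h5 h6.
have h7 : a2 * dxr <= a2 * 2 by apply: ler_wpM2l.
have h8 : c2 * dyr <= c2 * 2 by apply: ler_wpM2l.
rewrite subr_ge0; lra.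
Qed.

End Graph.

(** Deletions are handled by retractions [g] that send deleted vertices to a surviving one; edges
    then become walks in the smaller graph. *)
Lemma connect_map (T1 T2 : finType) (e1 : rel T1) (e2 : rel T2) (g : T1 -> T2) :
  (forall a b, e1 a b -> connect e2 (g a) (g b)) ->
  forall a b, connect e1 a b -> connect e2 (g a) (g b).
Proof.
move=> h a b /connectP[p]; elim: p a => [|c p IHp] a /=; first by move=> _ ->.
case/andP => eac /IHp hp /hp; exact: connect_trans (h _ _ eac).
Qed.

Lemma card_set_ind (T : finType) (P : {set T} -> Prop) :
  (forall U : {set T}, (forall H : {set T}, (#|H| < #|U|)%N -> P H) -> P U) ->
  forall U, P U.
Proof.
move=> IH U; have [m] := ubnP #|U|; elim: m U => // m IHm U Um.
by apply: IH => H HU; apply: IHm; exact: leq_trans HU _.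
Qed.

(** * Induced subgraphs and their 2-regular components *)

Section Induced.
Variables (n : nat) (e : rel 'I_n).
Hypotheses (e_sym : symmetric e) (e_irr : irreflexive e).
Implicit Types (U H W B C D : {set 'I_n}) (x y z v : 'I_n).
Local Notation nbr := (nbr e).
Local Notation deg := (deg e).

Definition erel U : rel 'I_n := [rel x y | [&& x \in U, y \in U & e x y]].

Lemma erel_sym U : symmetric (erel U).
Proof. by move=> x y; rewrite /erel /= e_sym andbCA. Qed.

Lemma conn_sym U : connect_sym (erel U).
Proof. exact: sym_connect_sym (@erel_sym U). Qed.

(** The empty set satisfies this; nonemptiness is asked for separately where it matters. *)
Definition conn U := [forall x in U, forall y in U, connect (erel U) x y].

Lemma connP U : reflect {in U &, forall x y, connect (erel U) x y} (conn U).
Proof.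
apply: (iffP forall_inP) => h x; last by move=> xU; apply/forall_inP => y; exact: h.
by move=> y xU; apply/forall_inP; exact: h.
Qed.

(** For [C] inside [U]: a union of connected components. *)
Definition closedin U C := [forall x in C, nbr U x \subset C].

Lemma closedinP U C :
  reflect (forall x y, x \in C -> y \in U -> e x y -> y \in C) (closedin U C).
Proof.
apply: (iffP forall_inP) => [h x y xC yU exy|h x xC].
  by apply: (subsetP (h x xC)); rewrite inE yU.
by apply/subsetP => y; rewrite inE => /andP[]; exact: h.
Qed.

Lemma closedin_connect U C x y :
  closedin U C -> x \in C -> connect (erel U) x y -> y \in C.
Proof.
move=> /closedinP clC xC /connectP[p]; elim: p x xC => [|z p IHp] x xC /=.
  by move=> _ ->.
by case/andP => /and3P[_ zU exz] /IHp; apply; apply: clC exz.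
Qed.

Lemma conn_closed U C : conn U -> closedin U C -> C \subset U -> C != set0 -> C = U.
Proof.
move=> /connP cU clC CU /set0Pn[x xC]; apply/eqP; rewrite eqEsubset CU.
apply/subsetP => y yU; apply: (closedin_connect clC xC); apply: cU => //.
exact: (subsetP CU).
Qed.

Lemma conn_from U x : (forall y, y \in U -> connect (erel U) x y) -> conn U.
Proof.
move=> h; apply/connP => y z yU zU; apply: connect_trans (h z zU).
by rewrite conn_sym h.
Qed.

Definition component U x : {set 'I_n} := [set y in U | connect (erel U) x y].

Lemma component_closed U x : x \in U -> closedin U (component U x).
Proof.
move=> xU; apply/closedinP => y z; rewrite !inE => /andP[yU cxy] zU eyz.
rewrite zU; apply: connect_trans cxy (connect1 _).
by rewrite /erel /= yU zU.
Qed.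

Lemma nbr_sub U H x : H \subset U -> nbr H x \subset nbr U x.
Proof. by move=> HU; apply/subsetP => y; rewrite !inE => /andP[/(subsetP HU) ->]. Qed.

Lemma deg_sub U H x : H \subset U -> (deg H x <= deg U x)%N.
Proof. by move=> HU; apply/subset_leq_card/nbr_sub. Qed.

Lemma erel_sub U H x y : H \subset U -> erel H x y -> erel U x y.
Proof.
by rewrite /erel /= => HU /and3P[xH yH ->]; rewrite !(subsetP HU).
Qed.

Lemma connect_erel_sub U H x y :
  H \subset U -> connect (erel H) x y -> connect (erel U) x y.
Proof. by move=> HU; apply: connect_sub => a b /(erel_sub HU) /connect1. Qed.

Lemma nbr_closed U C x : C \subset U -> closedin U C -> x \in C -> nbr C x = nbr U x.
Proof.
move=> CU clC xC; apply/eqP; rewrite eqEsubset nbr_sub //=.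
apply/subsetP => y; rewrite !inE => /andP[yU exy]; rewrite exy andbT.
by move/closedinP: clC; apply; eassumption.
Qed.

Lemma deg_closed U C x : C \subset U -> closedin U C -> x \in C -> deg C x = deg U x.
Proof. by move=> CU clC xC; rewrite /deg (nbr_closed CU). Qed.

Lemma closedinD U C : C \subset U -> closedin U C -> closedin U (U :\: C).
Proof.
move=> CU /closedinP clC; apply/closedinP => x y; rewrite !inE => /andP[xC xU] yU exy.
by rewrite yU andbT; apply: contraNN xC => yC; apply: clC yC _ _; rewrite // e_sym.
Qed.

(* The 2-regular components of the subgraph induced on [U]. *)
Definition cyc U C :=
  [&& C != set0, C \subset U, conn C, closedin U C & [forall x in C, deg U x == 2%N]].

Definition ncyc U : nat := #|[set C | cyc U C]|.

Lemma cycP U C : cyc U C ->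
  [/\ C != set0, C \subset U, conn C, closedin U C & forall x, x \in C -> deg U x = 2%N].
Proof. by case/and5P => -> -> -> -> /forall_inP h; split => // x /h/eqP. Qed.

Lemma cyc_eq U C D x : cyc U C -> cyc U D -> x \in C -> x \in D -> C = D.
Proof.
move=> /cycP[_ CU cC clC _] /cycP[_ DU cD clD _] xC xD.
apply/setP => y; apply/idP/idP => [yC|yD].
  apply: (closedin_connect clD xD); apply: connect_erel_sub CU _.
  by move/connP: cC; apply.
apply: (closedin_connect clC xC); apply: connect_erel_sub DU _.
by move/connP: cD; apply.
Qed.

Lemma ncyc_split U C : C \subset U -> closedin U C ->
  (ncyc C + ncyc (U :\: C) <= ncyc U)%N.
Proof.
move=> CU clC.
have h D : D \subset U -> closedin U D -> forall E, cyc D E -> cyc U E.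
  move=> DU clD E /cycP[E0 ED cE clE d2]; apply/and5P; split => //.
  - exact: subset_trans DU.
  - apply/closedinP => x y xE yU exy.
    move/closedinP: (clE) => /(_ x y xE); apply => //.
    by move/closedinP: clD => /(_ x y (subsetP ED x xE) yU exy).
  - apply/forall_inP => x xE; rewrite -(deg_closed DU) ?d2 //.
    exact: (subsetP ED).
rewrite /ncyc; set P := [set E | cyc C E]; set Q := [set E | cyc (U :\: C) E].
have dPQ : P :&: Q = set0.
  apply/setP => E; rewrite !inE; apply/negbTE/andP => -[/cycP[E0 EC _ _ _] /cycP[_ ED _ _ _]].
  case/set0Pn: E0 => x xE; have := subsetP ED x xE.
  by rewrite inE (subsetP EC).
have := cardsUI P Q; rewrite dPQ cards0 addn0 => <-; apply: subset_leq_card.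
apply/subsetP => E; rewrite !inE => /orP[]; first exact: h.
by apply: h; [exact: subsetDl | exact: closedinD].
Qed.

Definition cdeg U x := minn (deg U x) 2.

Lemma nbrD1 U v x : nbr (U :\ v) x = nbr U x :\ v.
Proof. by apply/setP => y; rewrite !inE andbA. Qed.

Lemma nbr_irr U x : x \notin nbr U x.
Proof. by rewrite inE e_irr andbF. Qed.

Lemma degD1 U v x : deg U x = ((v \in nbr U x) + deg (U :\ v) x)%N.
Proof. by rewrite /deg nbrD1 (cardsD1 v). Qed.

Lemma sum_degD1 U v : v \in U ->
  (\sum_(x in U) deg U x = 2%N * deg U v + \sum_(x in U :\ v) deg (U :\ v) x)%N.
Proof.
move=> vU; rewrite (big_setD1 v) //= mul2n -addnn -addnA; congr addn.
under eq_bigr => x _ do rewrite (degD1 U v).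
rewrite big_split /=; congr addn; rewrite /deg -sum1_card -big_mkcondr /=.
apply: eq_bigl => x; rewrite !inE vU andTb e_sym -andbA.
by case: eqP => [->|]; rewrite ?e_irr ?andbF.
Qed.

Lemma even_sum_deg U : ~~ odd (\sum_(x in U) deg U x).
Proof.
elim/card_set_ind: U => U IHU.
have [->|/set0Pn[v vU]] := eqVneq U set0; first by rewrite big_set0.
rewrite (sum_degD1 vU) oddD oddM /=; apply: IHU; exact/proper_card/properD1.
Qed.

(** The spanning tree bound of [|U| - 1] edges: a largest set containing [x0] that satisfies it is
    closed, since adjoining an adjacent vertex adds at least one edge. *)
Lemma sum_deg_conn U : conn U -> U != set0 ->
  (2 * #|U| <= \sum_(x in U) deg U x + 2)%N.
Proof.
move=> cU /set0Pn[x0 x0U].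
pose P (W : {set 'I_n}) := [&& W \subset U, x0 \in W &
   (2 * #|W| <= \sum_(x in W) deg W x + 2)%N].
have P0 : P [set x0] by rewrite /P sub1set x0U set11 cards1 leq_addl.
case: (arg_maxnP (fun W : {set 'I_n} => #|W|) P0) => W /and3P[WU x0W hW] maxW.
suff <- : W = U by [].
apply: (conn_closed cU _ WU); last by apply/set0Pn; exists x0.
apply/closedinP => x y xW yU exy; apply/negPn/negP => yW.
have : P (y |: W).
  rewrite /P subUset sub1set yU WU !inE x0W orbT cardsU1 yW mulnDr.
  rewrite (@sum_degD1 _ y) ?setU11 // setU1K // -addnA leq_add // leq_mul2l /=.
  by apply/card_gt0P; exists x; rewrite !inE xW orbT e_sym.
move/maxW; rewrite cardsU1 yW; lia.
Qed.

Lemma cdeg_split U C : C \subset U -> closedin U C ->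
  (\sum_(x in U) cdeg U x =
   \sum_(x in C) cdeg C x + \sum_(x in U :\: C) cdeg (U :\: C) x)%N.
Proof.
move=> CU clC; rewrite (bigID (mem C)) /=; congr addn.
  apply: eq_big => [x|x /andP[_ xC]]; last by rewrite /cdeg (deg_closed CU).
  by rewrite andb_idl //; exact: (subsetP CU).
apply: eq_big => [x|x /andP[xU xC]]; first by rewrite inE andbC.
by rewrite /cdeg (deg_closed (subsetDl U C)) ?closedinD // inE xC.
Qed.

(** The capped degree of a neighbour drops only if its degree was at most 2, and [v] itself
    contributes at most 2. *)
Lemma cdeg_remove U v : v \in U ->
  (\sum_(x in U) cdeg U x <= \sum_(x in U :\ v) cdeg (U :\ v) x
     + 2 + #|[set x in nbr U v | (deg U x <= 2)%N]|)%N.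
Proof.
move=> vU; rewrite (big_setD1 v) //= addnC addnAC leq_add //; last exact: geq_minr.
rewrite -sum1_card (_ : (\sum_(i in [set x in nbr U v | deg U x <= 2]) 1 =
    \sum_(i in U :\ v | e v i && (deg U i <= 2)) 1)%N); last first.
  apply: eq_bigl => x; rewrite !inE.
  by case: eqP => [->|]; rewrite ?e_irr ?andbF //= andbA.
rewrite [X in (_ + X)%N]big_mkcondr -big_split; apply: leq_sum => x /=.
rewrite !inE => /andP[xv xU]; rewrite /cdeg (degD1 U v) !inE vU e_sym /=.
by case: (e v x) => /=; [case: leqP => h; lia | lia].
Qed.

(** By connectedness each 2-regular component of [U :\ v] contains a neighbour of [v], and one is
    chosen from each; counting new components becomes counting neighbours of [v]. *)
Lemma cyc_reps U v : conn U -> v \in U ->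
  exists X : {set 'I_n}, [/\ X \subset nbr U v, #|X| = ncyc (U :\ v) &
    forall x, x \in X -> exists2 C, cyc (U :\ v) C & x \in C /\
      forall y, y \in X -> y \in C -> y = x].
Proof.
move=> cU vU; set H := U :\ v.
(* By [repP] the default [v] is never taken on a 2-regular component. *)
pose rep (C : {set 'I_n}) := odflt v [pick x in C :&: nbr U v].
have repP C : cyc H C -> rep C \in C :&: nbr U v.
  case/cycP => C0 CH cC clC d2; rewrite /rep; case: pickP => [x|no] //.
  have vC : v \notin C.
    by apply/negP => vC; have := subsetP CH v vC; rewrite !inE eqxx.
  have CU : C \subset U by apply: subset_trans CH (subsetDl _ _).
  case/negP: vC; rewrite (conn_closed cU _ CU C0) //.
  apply/closedinP => x y xC yU exy; case: (eqVneq y v) => [yv|yv].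
    by have := no x; rewrite !inE xC (subsetP CU) // e_sym -yv exy.
  by move/closedinP: clC; apply; rewrite ?inE ?yv //; eassumption.
exists [set rep C | C in [set C | cyc H C]]; split.
- by apply/subsetP => _ /imsetP[C + ->]; rewrite inE => /repP; rewrite inE => /andP[].
- rewrite card_in_imset // => C D; rewrite !inE => cC cD E.
  have := repP _ cC; have := repP _ cD; rewrite !inE E => /andP[h1 _] /andP[h2 _].
  exact: cyc_eq cC cD h2 h1.
- move=> _ /imsetP[C + ->]; rewrite inE => cC; exists C => //.
  have := repP _ cC; rewrite inE => /andP[rC _]; split => // _ /imsetP[D + ->].
  rewrite inE => cD rDC; have := repP _ cD; rewrite inE => /andP[rDD _].
  by rewrite (cyc_eq cC cD rDC rDD).
Qed.

(** Walks of length two are counted from their first vertex instead of from their midpoint. *)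
Lemma codeg_sumE H B : B \subset H ->
  (codeg_sum e H B = \sum_(b in B) \sum_(x in nbr H b) #|nbr H x :&: B|)%N.
Proof.
move=> BH; rewrite /codeg_sum (exchange_big_dep (mem H)) /=; last first.
  by move=> b x _; rewrite inE => /andP[].
apply: eq_bigr => x xH; rewrite sum_nat_cond_const -mulnn; congr muln.
apply: eq_card => b; rewrite !inE xH e_sym andbC /=.
by case: (boolP (b \in B)) => //= bB; rewrite (subsetP BH).
Qed.

End Induced.

(** * Graphs whose cycles meet the vertices of degree 3 at most once *)

Section Gain.
Variables (R : rcfType) (n : nat) (e : rel 'I_n).
Hypotheses (e_sym : symmetric e) (e_irr : irreflexive e).
Implicit Types (U H W B C D : {set 'I_n}) (x y z v : 'I_n).
Local Notation nbr := (nbr e).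
Local Notation deg := (deg e).
Local Notation erel := (erel e).
Local Notation conn := (conn e).
Local Notation senergy := (senergy R e).

Lemma nbr_subD1 U v : nbr U v \subset U :\ v.
Proof.
apply/subsetP => x; rewrite !inE => /andP[-> exv]; rewrite andbT.
by apply: contraTneq exv => ->; rewrite e_irr.
Qed.

Lemma vertex_gain U v (xi Lam : R) : v \in U -> 0 < xi -> 0 < Lam ->
  (codeg_sum e (U :\ v) (nbr U v))%:R / Lam
   + xi ^+ 2 * (1 + 2 * xi) ^+ 2 * (deg U v)%:R
   - 2 * xi * (1 + 2 * xi) * (inner_deg e (U :\ v) (nbr U v))%:R / Num.sqrt Lam
   <= 4 * xi * (1 + xi) ^+ 3 * ((deg U v)%:R - Lam) ->
  senergy (U :\ v) + Lam <= senergy U.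
Proof.
move=> vU xi0 Lam0 hyp.
apply: (@join_gain R n e e_sym U (U :\ v) [set v] (nbr U v) _ _ _ _ xi) => //.
- by rewrite setUC setD1K.
- by rewrite disjoint_sym disjoints1 !inE eqxx.
- exact: nbr_subD1.
- by move=> w i /set1P-> iU; rewrite inE iU.
- by rewrite cards1.
- by rewrite cards1 !mul1r.
Qed.

Lemma vertex_gain0 U v (xi Lam : R) : v \in U -> 0 < xi -> 0 < Lam ->
  (codeg_sum e (U :\ v) (nbr U v))%:R / Lam
   + xi ^+ 2 * (1 + 2 * xi) ^+ 2 * (deg U v)%:R
   <= 4 * xi * (1 + xi) ^+ 3 * ((deg U v)%:R - Lam) ->
  senergy (U :\ v) + Lam <= senergy U.
Proof.
move=> vU xi0 Lam0 hyp; apply: (vertex_gain vU xi0 Lam0); apply: le_trans hyp.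
rewrite lerBlDr lerDl divr_ge0 ?sqrtr_ge0 // !mulr_ge0 ?ler0n ?ltW //.
by rewrite addr_gt0 // mulr_gt0.
Qed.

Definition gcycle U s := [&& (2 < size s)%N, uniq s & cycle (erel U) s].

Lemma gcycle_rot U s k : gcycle U (rot k s) = gcycle U s.
Proof. by rewrite /gcycle size_rot rot_uniq rot_cycle. Qed.

Lemma gcycle_sub U H s : H \subset U -> gcycle H s -> gcycle U s.
Proof.
move=> HU; rewrite /gcycle => /and3P[-> ->]; case: s => //= x p.
by apply: sub_path => a b; apply: erel_sub.
Qed.

Lemma gcycle_in U s x : gcycle U s -> x \in s -> x \in U.
Proof.
move=> /and3P[_ _ cs] xs; have := next_cycle cs xs.
by rewrite /erel /= => /and3P[].
Qed.

Lemma gcycle_deg_ge2 U s x : gcycle U s -> x \in s -> (2 <= deg U x)%N.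
Proof.
move=> gs xs; have [k q sE] := rot_to xs.
have : gcycle U (x :: q) by rewrite -sE gcycle_rot.
case/and3P => + + +; case: q {sE} => [|a q] //= q2 /and3P[xq aq _].
case/andP => /and3P[_ aU exa]; rewrite rcons_path => /andP[_ /and3P[zU _ ezx]].
have c2 : #|[set a; last a q]| = 2.
  rewrite cards2; suff -> : a != last a q by [].
  apply: contraNneq aq; case: q q2 {xq zU ezx} => //= b q _ ->.
  exact: mem_last.
rewrite -[X in (X <= _)%N]c2.
apply/subset_leq_card/subsetP => z; rewrite !inE => /orP[]/eqP->.
  by rewrite aU.
by rewrite zU e_sym.
Qed.

Lemma gcycle_nbr2 U a x b r : gcycle U (a :: x :: b :: r) -> deg U x = 2%N ->
  nbr U x = [set a; b].
Proof.
case/and3P => _ /= /and4P[]; rewrite !inE !negb_or => /and3P[_ ab _] _ _ _.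
case/and3P => /and3P[aU _ eax] /and3P[_ bU exb] _ d2.
apply/esym/eqP; rewrite eqEcard subUset !sub1set !inE aU bU e_sym eax exb /=.
by rewrite cards2 ab -[#|nbr _ _|]/(deg U x) d2.
Qed.

(** A vertex [v] is removed and the rest coloured. If two neighbours of [v] in one component have
    different colours, a path between them has odd length and closes through [v] to an odd cycle;
    otherwise components can be recoloured independently. *)
Lemma odd_cycle_or_coloring U :
  (exists2 s, gcycle U s & odd (size s)) \/
  exists chi : pred 'I_n,
    forall x y, x \in U -> y \in U -> e x y -> chi x != chi y.
Proof.
elim/card_set_ind: U => U IHU.
have [->|/set0Pn[v vU]] := eqVneq U set0.
  by right; exists xpred0 => x y; rewrite inE.
set H := U :\ v; have HU : H \subset U by exact: subsetDl.
case: (IHU H); first by rewrite /H (cardsD1 v U) vU.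
  by case=> s gs os; left; exists s => //; exact: gcycle_sub gs.
case=> chi hchi.
have alt x p : path (erel H) x p -> chi (last x p) = chi x (+) odd (size p).
  elim: p x => [|y p IHp] x /=; first by rewrite addbF.
  case/andP => /and3P[xH yH exy] /IHp ->; have := hchi x y xH yH exy.
  by case: (chi x); case: (chi y); case: odd.
case: (boolP [exists x in nbr U v, exists y in nbr U v,
          connect (erel H) x y && (chi x != chi y)]).
  case/exists_inP => x xv /exists_inP[y yv /andP[/connectP[p pp yE] cxy]].
  left; case/shortenP: pp yE => q pq uq _ yE.
  have xH : x \in H by exact: (subsetP (nbr_subD1 U v)).
  have qH z : z \in x :: q -> z \in H.
    rewrite inE => /orP[/eqP->//|zq]; case/splitPr: zq pq => q1 q2.
    by rewrite cat_path /= => /and3P[_ /and3P[]].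
  have oq : odd (size q).
    by move: cxy; rewrite yE alt //; case: (chi x); case: odd.
  exists [:: v, x & q]; last by rewrite /= oq.
  apply/and3P; split.
  - by case: (q) oq.
  - rewrite [uniq _]/=; apply/andP; split => //.
    by apply/negP => /qH; rewrite !inE eqxx.
  - rewrite /= rcons_path -yE; move: xv yv; rewrite !inE => /andP[xU evx] /andP[yU evy].
    rewrite /erel /= vU xU yU evx e_sym evy !andbT.
    by apply: sub_path pq => a b; apply: erel_sub.
move/exists_inPn => no; right.
(* Every component in which some neighbour of [v] has colour [true] is flipped, so that all
   neighbours of [v] become [false]. *)
pose chi' z := if z == v then true else
  chi z (+) [exists x in nbr U v, connect (erel H) x z && chi x].
exists chi'.
have nb x : x \in nbr U v -> chi' x = false.
  move=> xv; rewrite /chi'; case: eqP => [xE|_].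
    by move: xv; rewrite xE inE e_irr andbF.
  case: (boolP (chi x)) => cx.
    by apply/negbTE; rewrite negbK; apply/exists_inP; exists x; rewrite ?connect0.
  apply/negbTE; rewrite addFb; apply/exists_inPn => y yv.
  apply/negP => /andP[cyx cy]; have /exists_inPn/(_ x xv) := no y yv.
  by rewrite cyx cy (negPf cx).
have main x y : x \in H -> y \in H -> e x y -> chi' x != chi' y.
  move=> xH yH exy; rewrite /chi'.
  have [/negPf -> /negPf ->] : x != v /\ y != v.
    by move: xH yH; rewrite !inE => /andP[-> _] /andP[-> _].
  have -> : [exists z in nbr U v, connect (erel H) z x && chi z] =
            [exists z in nbr U v, connect (erel H) z y && chi z].
    apply: eq_existsb => z; congr (_ && (_ && _)).
    have c1 : connect (erel H) x y by apply: connect1; rewrite /erel /= xH yH.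
    have c2 : connect (erel H) y x by rewrite conn_sym.
    by apply/idP/idP => h; [exact: connect_trans h c1 | exact: connect_trans h c2].
  have := hchi x y xH yH exy.
  by case: (chi x); case: (chi y); case: [exists _ in _, _].
have chiv : chi' v = true by rewrite /chi' eqxx.
move=> x y xU yU exy.
case: (eqVneq x v) => [xv|xv].
  by rewrite xv chiv nb // inE yU -xv.
case: (eqVneq y v) => [yv|yv].
  by rewrite yv chiv nb // inE xU -yv e_sym.
by apply: main; rewrite ?inE ?xv ?yv.
Qed.

Lemma path_restrict U H x s :
  path (erel U) x s -> {subset x :: s <= H} -> path (erel H) x s.
Proof.
elim: s x => //= y s IHs x /andP[/and3P[_ _ exy] ps] sH.
rewrite IHs // => [|z zs]; last by apply: sH; rewrite inE zs orbT.
by rewrite /erel /= exy !sH // !inE eqxx ?orbT.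
Qed.

Lemma gcycle_path U p a q : gcycle U (p :: a :: q) -> path (erel (U :\ p)) a q.
Proof.
move=> gs; have /and3P[_ /= /andP[paq _]] := gs.
rewrite rcons_path => /and3P[_ pq _]; apply: (path_restrict pq) => z zq.
have zU : z \in U by apply: gcycle_in gs _; rewrite inE zq orbT.
by rewrite !inE zU andbT; apply: contraNneq paq => <-.
Qed.

Lemma gcycle_connect U p a q :
  gcycle U (p :: a :: q) -> connect (erel (U :\ p)) a (last a q).
Proof. by move=> /gcycle_path pq; apply/connectP; exists q. Qed.

(** Sending [p] to [a] turns every walk in [U] into a walk in [U :\ p]. *)
Lemma conn_remove U p a : conn U -> a \in U :\ p ->
  {in nbr U p, forall z, connect (erel (U :\ p)) a z} -> conn (U :\ p).
Proof.
move=> cU aH h.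
pose g z := if z == p then a else z.
have step x y : erel U x y -> connect (erel (U :\ p)) (g x) (g y).
  move=> /and3P[xU yU exy]; rewrite /g.
  case: (eqVneq x p) => [xp|xp]; case: (eqVneq y p) => [yp|yp].
  - exact: connect0.
  - by apply: h; rewrite inE yU -xp.
  - by rewrite conn_sym //; apply: h; rewrite inE xU -yp e_sym.
  - by apply: connect1; rewrite /erel /= !inE xp yp xU yU.
apply: (@conn_from _ _ e_sym _ a) => z; rewrite !inE => /andP[zp zU].
have /connP/(_ a z) := cU; move: aH; rewrite !inE => /andP[ap aU] /(_ aU zU).
by move/(connect_map step); rewrite /g (negPf ap) (negPf zp).
Qed.

Lemma conn_remove2 U p a c : conn U -> nbr U p = [set a; c] ->
  connect (erel (U :\ p)) a c -> conn (U :\ p).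
Proof.
move=> cU np cac; apply: (@conn_remove _ _ a) => // [|z].
  by apply: (subsetP (nbr_subD1 U p)); rewrite np !inE eqxx.
by rewrite np !inE => /orP[]/eqP->.
Qed.

Definition thin U := forall s, gcycle U s -> forall x y,
  x \in s -> y \in s -> deg U x = 3%N -> deg U y = 3%N -> x = y.

Lemma thin_remove U p : (forall x, x \in U -> deg U x <= 3)%N -> thin U -> thin (U :\ p).
Proof.
move=> d3 th s gs x y xs ys dx dy; have sub := subsetDl U [set p].
have d z : z \in s -> deg (U :\ p) z = 3%N -> deg U z = 3%N.
  move=> zs dz; apply/eqP; rewrite eqn_leq d3 ?(subsetP sub) ?(gcycle_in gs) //.
  rewrite -[X in (X <= _)%N]dz; exact: deg_sub.
by apply: (th s) => //; [exact: gcycle_sub gs | exact: d | exact: d].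
Qed.

(** Rotation puts the only possible vertex of degree 3 in front. *)
Lemma thin_cycle_split U s : thin U -> (forall x, x \in U -> deg U x <= 3)%N ->
  gcycle U s ->
  exists o q, [/\ gcycle U (o :: q), size (o :: q) = size s &
    forall x, x \in q -> deg U x = 2%N].
Proof.
move=> th d3 gs.
have d2 q x : gcycle U q -> x \in q -> deg U x != 3%N -> deg U x = 2%N.
  move=> gq xq dx; have := gcycle_deg_ge2 gq xq; have := d3 x (gcycle_in gq xq).
  by move: dx; case: (deg U x) => [|[|[|[|]]]].
have [/hasP[o os /eqP do3]|no] := boolP (has (fun x => deg U x == 3%N) s).
  have [k q sE] := rot_to os; have gq : gcycle U (o :: q) by rewrite -sE gcycle_rot.
  exists o, q; split => // [|x xq]; first by rewrite -sE size_rot.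
  have xq' : x \in o :: q by rewrite inE xq orbT.
  apply: (d2 _ _ gq xq'); apply/eqP => dx.
  have xo : x = o by apply: (th _ gq) => //; exact: mem_head.
  by case/and3P: gq => _ /andP[/negP]; rewrite -xo xq.
case: s gs no => [|o q] // gs no; exists o, q; split => // x xq.
have xq' : x \in o :: q by rewrite inE xq orbT.
apply: (d2 _ _ gs xq'); apply: contraNN no => dx; apply/hasP; by exists x.
Qed.

Lemma sum_card2 (a c : 'I_n) (F : 'I_n -> nat) : a != c ->
  (\sum_(b in [set a; c]) F b = F a + F c)%N.
Proof. by move=> ac; rewrite big_setU1 ?inE //= big_set1. Qed.

Lemma card_set2I (a c : 'I_n) (A : {set 'I_n}) :
  (#|A :&: [set a; c]| <= (a \in A) + (c \in A))%N.
Proof.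
rewrite setIUr; apply: leq_trans (leq_card_setU _ _) _.
have h z : #|A :&: [set z]| = (z \in A).
  case: (boolP (z \in A)) => zA.
    by rewrite (setIidPr _) ?sub1set // cards1.
  rewrite (_ : _ :&: _ = set0) ?cards0 //; apply/setP => w; rewrite !inE.
  by case: eqP => [->|_]; rewrite ?(negPf zA) ?andbF.
by rewrite !h.
Qed.

(** With [Lam = 3 / 2] and [xi = 1 / 2], [vertex_gain0] admits a codegree sum of 2 but not of 3; in
    the second case the edge between the two neighbours makes up the difference. The cases serve
    cycles of length at least 5 and triangles. *)
Lemma gain_deg2 U p : p \in U -> deg U p = 2%N ->
  (codeg_sum e (U :\ p) (nbr U p) <= 2)%N \/
  ((codeg_sum e (U :\ p) (nbr U p) <= 3)%N /\
   (2 <= inner_deg e (U :\ p) (nbr U p))%N) ->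
  senergy (U :\ p) + 3 / 2 <= senergy U.
Proof.
move=> pU dp [|[]]; rewrite -!(ler_nat R).
  move=> h; apply: (vertex_gain0 (xi := 1 / 2) pU); rewrite ?dp; try lra.
set m1 := (inner_deg _ _ _)%:R => h hm1.
apply: (vertex_gain (xi := 1 / 2) pU); rewrite ?dp; try lra.
rewrite -/m1; set q := Num.sqrt _.
have q0 : 0 < q by rewrite sqrtr_gt0; lra.
have q2 : q <= 2.
  rewrite -[leRHS](ger0_norm (ler0n R 2)) -sqrtr_sqr ler_wsqrtr // expr2; lra.
have : 1 <= m1 / q by rewrite ler_pdivlMr // mul1r; lra.
have -> : 2 * (1 / 2) * (1 + 2 * (1 / 2)) * m1 / q = 2 * (m1 / q) :> R by field; rewrite lt0r_neq0.
lra.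
Qed.

Lemma sum_le_card (A : {set 'I_n}) (F : 'I_n -> nat) k :
  (forall x, x \in A -> F x <= k)%N -> (\sum_(x in A) F x <= #|A| * k)%N.
Proof. by move=> h; rewrite -sum_nat_const; apply: leq_sum. Qed.

Lemma thin_odd_vertex U s : thin U -> (forall x, x \in U -> deg U x <= 3)%N ->
  gcycle U s -> odd (size s) ->
  exists p a c, [/\ p \in U, deg U p = 2%N, nbr U p = [set a; c],
    connect (erel (U :\ p)) a c & senergy (U :\ p) + 3 / 2 <= senergy U].
Proof.
move=> th d3 gs0 os0; have [o [q0 [gs sE d2]]] := thin_cycle_split th d3 gs0.
rewrite -sE in os0; case: q0 gs os0 d2 {sE} => [|a [|p [|c [|d r]]]] //.
(* Triangle: [a] is deleted. Its neighbours are adjacent, and only [o] can have an edge leaving the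
   triangle. *)
- move=> gs _ d2; exists a, o, p.
  have inU x : x \in [:: o; a; p] -> x \in U by exact: gcycle_in gs.
  have aU : a \in U by apply: inU; rewrite !inE eqxx orbT.
  have pU : p \in U by apply: inU; rewrite !inE eqxx !orbT.
  have oU : o \in U by apply: inU; rewrite !inE eqxx.
  have /and3P[_ /= /and3P[]] := gs; rewrite !inE negb_or => /andP[oa op] ap _.
  case/and4P => /and3P[_ _ eoa] /and3P[_ _ eap] /and3P[_ _ epo] _.
  have da : deg U a = 2%N by apply: d2; rewrite inE eqxx.
  have na : nbr U a = [set o; p] by exact: gcycle_nbr2 gs da.
  have gs1 : gcycle U [:: a; p; o] by rewrite -(gcycle_rot U [:: o; a; p] 1) in gs.
  have dp : deg U p = 2%N by apply: d2; rewrite !inE eqxx orbT.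
  have np : nbr U p = [set a; o] by exact: gcycle_nbr2 gs1 dp.
  split => //; first by rewrite conn_sym //; exact: gcycle_connect gs1.
  apply: gain_deg2 => //; right; split; last first.
    rewrite /inner_deg na sum_card2 // (leq_add (m1 := 1) (m2 := 1)) //; apply/card_gt0P.
      by exists p; rewrite !inE eqxx pU orbT (e_sym o) epo eq_sym ap.
    by exists o; rewrite !inE eqxx oU oa epo.
  rewrite codeg_sumE ?nbr_subD1 // na sum_card2 //.
  have e1 : nbr (U :\ a) p = [set o].
    rewrite nbrD1 np; apply/setP => x; rewrite !inE.
    by case: eqP => [->|] //=; rewrite eq_sym (negPf oa).
  have F1 x : x \in nbr (U :\ a) o -> (#|nbr (U :\ a) x :&: [set o; p]| <= 1)%N.
    move=> xo; apply: leq_trans (card_set2I _ _ _) _.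
    rewrite [p \in _](_ : _ = false) ?addn0 ?leq_b1 //.
    apply/negbTE/negP => px; have : x \in nbr (U :\ a) p.
      have xH : x \in U :\ a by move: xo; rewrite inE => /andP[].
      by move: px; rewrite [_ \in nbr _ x]inE [_ \in nbr _ p]inE xH e_sym => /andP[].
    by rewrite e1 => /set1P xE; move: xo; rewrite xE (negPf (nbr_irr e_irr _ _)).
  have F2 : (#|nbr (U :\ a) o :&: [set o; p]| <= 1)%N.
    apply: leq_trans (card_set2I _ _ _) _.
    by rewrite (negPf (nbr_irr e_irr _ _)) leq_b1.
  have do2 : (deg (U :\ a) o <= 2)%N.
    have := degD1 e U a o; rewrite inE aU eoa /= => dE.
    by have := d3 o oU; rewrite dE.
  rewrite e1 big_set1 (leq_add (n1 := 2) (n2 := 1)) //.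
  apply: leq_trans (sum_le_card F1) _; rewrite muln1 //.
(* Length at least 5: [p] is deleted, whose neighbours [a] and [c] have degree 2. Their other
   neighbours [o] and [d] are distinct because the length is not 4, so the codegree sum is at most
   2. *)
- move=> gs _ d2; exists p, a, c.
  have inU x : x \in [:: o, a, p, c, d & r] -> x \in U by exact: gcycle_in gs.
  have pU : p \in U by apply: inU; rewrite !inE eqxx !orbT.
  have gs1 := gs; rewrite -(gcycle_rot U _ 1) /= in gs1.
  have gs2 := gs; rewrite -(gcycle_rot U _ 2) /= in gs2.
  have da : deg U a = 2%N by apply: d2; rewrite !inE eqxx.
  have dp : deg U p = 2%N by apply: d2; rewrite !inE eqxx orbT.
  have dc : deg U c = 2%N by apply: d2; rewrite !inE eqxx !orbT.
  have na : nbr U a = [set o; p] by exact: gcycle_nbr2 gs da.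
  have np : nbr U p = [set a; c] by exact: gcycle_nbr2 gs1 dp.
  have nc : nbr U c = [set p; d] by exact: gcycle_nbr2 gs2 dc.
  have /and3P[_ us _] := gs; have := us; rewrite /= !inE !negb_or.
  case/and5P => /and5P[oa op oc od _] /and4P[ap ac ad _] /and3P[pc pd _] /andP[cd _] _.
  split => //.
    by have := gcycle_connect gs2; rewrite /= last_cat conn_sym.
  apply: gain_deg2 => //; left; rewrite codeg_sumE ?nbr_subD1 // np sum_card2 //.
  have ea : nbr (U :\ p) a = [set o].
    rewrite nbrD1 na; apply/setP => x; rewrite !inE.
    by case: (eqVneq x p) => [->|] //=; rewrite ?orbF // eq_sym (negPf op).
  have ec : nbr (U :\ p) c = [set d].
    rewrite nbrD1 nc; apply/setP => x; rewrite !inE.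
    by case: (eqVneq x p) => [->|] //=; rewrite (negPf pd).
  rewrite ea ec !big_set1 (leq_add (n1 := 1) (n2 := 1)) //.
    apply: leq_trans (card_set2I _ _ _) _.
    suff -> : (c \in nbr (U :\ p) o) = false by rewrite addn0 leq_b1.
    apply/negbTE; rewrite inE e_sym; apply/negP => /andP[_ eco].
    have : o \in nbr U c by rewrite inE eco inU // !inE eqxx.
    by rewrite nc !inE (negPf op) (negPf od).
  apply: leq_trans (card_set2I _ _ _) _.
  suff -> : (a \in nbr (U :\ p) d) = false by rewrite add0n leq_b1.
  apply/negbTE; rewrite inE e_sym; apply/negP => /andP[_ ead].
  have : d \in nbr U a by rewrite inE ead inU // !inE eqxx !orbT.
  by rewrite na !inE eq_sym (negPf od) eq_sym (negPf pd).
Qed.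

(** In terms of edges this reads [|E| + |U| <= 2 F + 1]. Deleting a vertex of degree 2 lowers the
    left side by 3, matched by a gain of 3/2; in the bipartite case [F = |E|], and connectedness
    gives [|U| <= |E| + 1]. *)
Lemma thin_energy U : conn U -> (forall x, x \in U -> deg U x <= 3)%N -> thin U ->
  (\sum_(x in U) (deg U x + 2))%:R <= 4 * senergy U + 2 :> R.
Proof.
elim/card_set_ind: U => U IHU cU d3 th.
have [->|U0] := eqVneq U set0; first by rewrite big_set0 addr_ge0 // mulr_ge0 // senergy_ge0.
case: (odd_cycle_or_coloring U) => [[s gs os]|[chi hchi]].
  have [p [a [c [pU dp np cac gain]]]] := thin_odd_vertex th d3 gs os.
  have HU : U :\ p \subset U by exact: subsetDl.
  have := IHU (U :\ p); rewrite [X in (_ < X)%N](cardsD1 p) pU add1n ltnSn => /(_ isT).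
  have d3' x : x \in U :\ p -> (deg (U :\ p) x <= 3)%N.
    by move=> xH; apply: leq_trans (deg_sub e x HU) (d3 x (subsetP HU x xH)).
  move=> /(_ (conn_remove2 cU np cac) d3' (thin_remove d3 th)).
  suff -> : (\sum_(x in U) (deg U x + 2) =
     \sum_(x in U :\ p) (deg (U :\ p) x + 2) + 6)%N by rewrite natrD; lra.
  rewrite !big_split /= (sum_degD1 e_sym e_irr pU) dp !sum_nat_const (cardsD1 p U) pU.
  by move: (\sum_(x in U :\ p) _)%N #|U :\ p| => S k; clear; lia.
have := senergy_bipartite R e_sym hchi => E.
have := sum_deg_conn e_sym e_irr cU U0; rewrite -(ler_nat R).
rewrite big_split /= sum_nat_const !natrD !natrM; lra.
Qed.
End Gain.

(** * Maximum degree 3 *)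

Section Cubic.
Variables (R : rcfType) (n : nat) (e : rel 'I_n).
Hypotheses (e_sym : symmetric e) (e_irr : irreflexive e).
Implicit Types (U H W B C D : {set 'I_n}) (x y z v : 'I_n).
Local Notation nbr := (nbr e).
Local Notation deg := (deg e).
Local Notation cdeg := (cdeg e).
Local Notation erel := (erel e).
Local Notation conn := (conn e).
Local Notation closedin := (closedin e).
Local Notation cyc := (cyc e).
Local Notation ncyc := (ncyc e).
Local Notation gcycle := (gcycle e).
Local Notation thin := (thin e).
Local Notation senergy := (senergy R e).

(* The bound proved by induction: degrees count for at most 2, and each
   2-regular component may miss it by 1. *)
Definition star U := (\sum_(x in U) cdeg U x)%:R <= 2 * senergy U + (ncyc U)%:R.

Lemma thin_cdeg U : conn U -> (forall x, x \in U -> deg U x <= 3)%N -> thin U ->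
  ~ (forall x, x \in U -> deg U x = 2%N) ->
  (\sum_(x in U) cdeg U x)%:R <= 2 * senergy U.
Proof.
move=> cU d3 th no2.
have [x0 x0U x02] : exists2 x, x \in U & deg U x != 2%N.
  apply/exists_inP; apply: contraT => /exists_inPn h; case: no2 => x xU.
  by have := h x xU; rewrite negbK => /eqP.
(* An isolated vertex of a connected graph is the whole graph. *)
case: (boolP [exists x in U, deg U x == 0%N]) => [/exists_inP[x xU /eqP dx]|].
  have UE : [set x] = U.
    apply: (conn_closed cU); rewrite ?sub1set //; last first.
      by apply/set0Pn; exists x; rewrite inE.
    apply/closedinP => y z /set1P-> zU exz.
    have : z \in nbr U x by rewrite inE zU.
    by move/eqP: dx; rewrite cards_eq0 => /eqP->; rewrite inE.
  rewrite -{1}UE big_set1 /cdeg dx min0n mulr_ge0 // senergy_ge0 //.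
move=> /exists_inPn d0.
have := thin_energy R e_sym e_irr cU d3 th.
suff : (2 * \sum_(x in U) cdeg U x + 2 <= \sum_(x in U) (deg U x + 2))%N.
  rewrite -(ler_nat R) natrD natrM; lra.
have -> : (\sum_(x in U) (deg U x + 2) =
   2 * \sum_(x in U) cdeg U x + \sum_(x in U) odd (deg U x))%N.
  rewrite big_distrr -big_split; apply: eq_bigr => x xU /=.
  have := d3 x xU; have := d0 x xU; rewrite /cdeg.
  by case: (deg U x) => [|[|[|[|]]]].
rewrite leq_add2l.
have : ~~ odd (\sum_(x in U) odd (deg U x)).
  have := even_sum_deg e_sym e_irr U.
  suff -> : odd (\sum_(x in U) deg U x) = odd (\sum_(x in U) odd (deg U x)) by [].
  elim/big_rec2: _ => // x a b _; rewrite !oddD => ->.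
  by case: (odd (deg U x)).
have : (0 < \sum_(x in U) odd (deg U x))%N.
  rewrite (big_setD1 x0) //=; have := d3 x0 x0U; have := d0 x0 x0U; move: x02.
  by case: (deg U x0) => [|[|[|[|]]]].
by case: (\sum_(x in U) _)%N => [|[|]].
Qed.

(** [thin_energy] gives [4 |U| <= 4 F + 2], and [U] counts as its own 2-regular component, which
    covers the missing 1. *)
Lemma star_regular2 U : conn U -> U != set0 ->
  (forall x, x \in U -> deg U x = 2%N) -> star U.
Proof.
move=> cU U0 d2; rewrite /star.
have th : thin U.
  move=> s gs x y xs ys dx; have := d2 x (gcycle_in gs xs); by rewrite dx.
have d3 x : x \in U -> (deg U x <= 3)%N by move/d2->.
have := thin_energy R e_sym e_irr cU d3 th.
rewrite (eq_bigr (fun=> 4%N)) => [|x /d2 -> //].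
rewrite [X in _ -> X%:R <= _](eq_bigr (fun=> 2%N)) => [|x /d2]; last by rewrite /cdeg => ->.
have : 1 <= (ncyc U)%:R :> R.
  rewrite (_ : 1 = 1%:R) // ler_nat; apply/card_gt0P; exists U.
  rewrite inE; apply/and5P; split => //; last by apply/forall_inP => x /d2 ->.
  by apply/closedinP.
rewrite !sum_nat_const !natrM; lra.
Qed.

Lemma codeg_sum_pairs H B : B \subset H ->
  codeg_sum e H B = (\sum_(b in B) \sum_(c in B) #|nbr H b :&: nbr H c|)%N.
Proof.
move=> BH; rewrite codeg_sumE //; apply: eq_bigr => b bB.
rewrite (eq_bigr (fun z => \sum_(c in B) (c \in nbr H z : nat))%N); last first.
  move=> z _; rewrite -sum1_card big_mkcond [RHS]big_mkcond; apply: eq_bigr => c _.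
  by rewrite in_setI andbC; case: (c \in B).
rewrite exchange_big; apply: eq_bigr => c cB.
rewrite -sum1_card big_mkcond [RHS]big_mkcond; apply: eq_bigr => z _.
rewrite in_setI !inE (subsetP BH c cB) (e_sym c).
by case: (z \in H); case: (e b z); case: (e z c).
Qed.

Lemma codeg0 H C b c : closedin H C -> b \in C -> c \in H -> c \notin C ->
  #|nbr H b :&: nbr H c| = 0%N.
Proof.
move=> /closedinP cl bC cH cC; apply/eqP; rewrite cards_eq0; apply/eqP/setP => z.
rewrite !inE; apply/negbTE; apply: contraNN cC => /andP[/andP[zH ebz] /andP[_ ecz]].
by apply: (cl z) => //; [exact: cl bC zH ebz | rewrite e_sym].
Qed.

Lemma sum_set3 (a b c : 'I_n) (F : 'I_n -> nat) : a != b -> a != c -> b != c ->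
  (\sum_(z in [set a; b; c]) F z = F a + F b + F c)%N.
Proof.
move=> ab ac bc; rewrite -setUA big_setU1 ?big_setU1 ?big_set1 ?inE ?negb_or ?ab //=.
by rewrite addnA.
Qed.

(* Delete [x].  Its neighbours [y] and [last y r] stay connected, so at most two
   neighbours of [x] drop to degree at most 1 or represent a new 2-regular
   component. *)
Lemma star_adjacent_cubic U x y r :
  (forall H, (#|H| < #|U|)%N -> star H) ->
  conn U -> (forall z, z \in U -> deg U z <= 3)%N -> gcycle U [:: x, y & r] ->
  deg U x = 3%N -> deg U y = 3%N ->
  (\sum_(z in U) cdeg U z)%:R <= 2 * senergy U.
Proof.
move=> IH cU d3 gs dx dy; set u := last y r; set H := U :\ x; set B := nbr U x.
have xU : x \in U by apply: gcycle_in gs _; exact: mem_head.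
have HU : H \subset U by exact: subsetDl.
have BH : B \subset H by exact: nbr_subD1.
have cyu : connect (erel H) y u by exact: gcycle_connect gs.
have [yB uB uy] : [/\ y \in B, u \in B & u != y].
  have /and3P[+ /= /and3P[_ yr _]] := gs.
  rewrite rcons_path -/u => r0 /andP[/and3P[_ yU exy] /andP[_ /and3P[uU _ eux]]].
  split; first by rewrite inE yU.
    by rewrite inE uU e_sym.
  by apply: contraNneq yr => <-; rewrite /u; case: (r) r0 => //= a l _; exact: mem_last.
have [w Bw] : exists w, B :\ y :\ u = [set w].
  apply/cards1P; have := cardsD1 y B; have := cardsD1 u (B :\ y).
  rewrite yB in_setD1 uy uB -[#|B|]/(deg U x) dx.
  by move: #|_| #|_| => a b; clear => *; apply/eqP; lia.
have [wB wy wu] : [/\ w \in B, w != y & w != u].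
  have : w \in B :\ y :\ u by rewrite Bw inE.
  by rewrite in_setD1 in_setD1 => /and3P[-> -> ->].
have BE : B = [set y; u; w].
  apply/setP => z; move/setP/(_ z): Bw; rewrite !inE.
  have := yB; have := uB; rewrite !inE.
  case: (eqVneq z u) => [->|zu] uB'; first by rewrite uB' orbT.
  by case: (eqVneq z y) => [->|zy] yB'; rewrite ?yB' //= orbF.
have degH b : b \in B -> deg U b = (deg H b).+1.
  rewrite inE => /andP[bU exb].
  by rewrite (degD1 e U x b) (_ : x \in nbr U b) // inE xU e_sym.
have degH2 b : b \in B -> (deg H b <= 2)%N.
  by move=> bB; have := d3 b; rewrite degH //; apply; move: bB; rewrite inE => /andP[].
set L := [set z in nbr U x | (deg U z <= 2)%N].
have rem : (\sum_(z in U) cdeg U z <= \sum_(z in H) cdeg H z + 2 + #|L|)%N.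
  exact: cdeg_remove.
have [X [XB Xc Xu]] := cyc_reps e_sym cU xU.
have IHH : star H.
  by apply: IH; rewrite /H [X in (_ < X)%N](cardsD1 x) xU.
have Xd z : z \in X -> deg U z = 3%N.
  move=> zX; have [C /cycP[_ _ _ _ C2] [zC _]] := Xu z zX.
  by rewrite degH ?(subsetP XB) // C2.
have LX0 : [disjoint L & X].
  apply/pred0P => z /=; rewrite !inE; apply/negP => /andP[/andP[_ dz] /Xd zX].
  by rewrite zX in dz.
have LXB : L :|: X \subset B.
  by rewrite subUset XB andbT; apply/subsetP => z; rewrite inE => /andP[].
have tauE : (#|L| + #|X| = #|L :|: X|)%N by rewrite cardsU disjoint_setI0 // cards0 subn0.
have CyuP C : cyc H C -> (y \in C) = (u \in C).
  by move=> /cycP[_ _ _ /(closedinP) cl _]; apply: (closed_connect _ cyu) => a b /and3P[aH bH eab];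
    apply/idP/idP => [/cl|/cl]; apply => //; rewrite e_sym.
(* If [y] represents a component, [u] lies in it too and belongs neither to [L] nor to [X];
   otherwise [y] itself belongs to neither. *)
have tau2 : (#|L| + #|X| <= 2)%N.
  rewrite tauE; have [yX|yX] := boolP (y \in X).
    have [C cC [yC uniC]] := Xu y yX.
    have uC : u \in C by rewrite -CyuP.
    have /subset_leq_card/leq_trans -> // : L :|: X \subset [set y; w].
      apply/subsetP => z zLX; have := subsetP LXB z zLX; rewrite BE !inE.
      move=> /orP[/orP[->//|/eqP zu]|-> //]; last by rewrite orbT.
      move: zLX; rewrite zu in_setU => /orP[|uX]; last by rewrite (uniC u uX uC) eqxx.
      by rewrite inE degH //; case/cycP: cC => _ _ _ _ ->; rewrite ?andbF.
    by rewrite cards2; case: (_ != _).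
  have /subset_leq_card/leq_trans -> // : L :|: X \subset [set u; w].
    apply/subsetP => z zLX; have := subsetP LXB z zLX; rewrite BE !inE.
    move=> /orP[/orP[/eqP zy|-> //]|-> //]; last by rewrite orbT.
    by move: zLX; rewrite zy in_setU (negPf yX) orbF inE dy andbF.
  by rewrite cards2; case: (_ != _).
have gain (Lam : R) : senergy H + Lam <= senergy U -> 1 + (#|L| + #|X|)%:R / 2 <= Lam ->
    (\sum_(z in U) cdeg U z)%:R <= 2 * senergy U.
  move: IHH rem; rewrite /star -Xc -/H -(ler_nat R) !natrD.
  by move: (\sum_(z in U) _)%N (\sum_(z in H) _)%N => s1 s2; clear => *; lra.
set g := fun b c => #|nbr H b :&: nbr H c|.
have gC b c : g b c = g c b by rewrite /g setIC.
have gl b c : (g b c <= deg H b)%N by rewrite /g subset_leq_card // subsetIl.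
have gg b : g b b = deg H b by rewrite /g setIid.
have SE : codeg_sum e H B =
    (deg H y + deg H u + deg H w + 2 * (g y u + g y w + g u w))%N.
  rewrite codeg_sum_pairs // BE.
  have yu : y != u by rewrite eq_sym.
  have yw : y != w by rewrite eq_sym.
  have uw : u != w by rewrite eq_sym.
  rewrite !(sum_set3 _ yu yw uw) -!/(g _ _) !gg (gC u y) (gC w y) (gC w u).
  by clear; lia.
have [tau1|tau1] := leqP (#|L| + #|X|) 1.
  apply: (gain (3 / 2)); last first.
    by move: tau1; rewrite -(ler_nat R) !natrD; clear; lra.
  apply: (@vertex_gain0 _ _ _ e_sym e_irr _ _ 1); rewrite ?ltr01 ?divr_gt0 ?ltr0n //.
  rewrite -/H -/B -/(deg U x) dx.
  have : (codeg_sum e H B <= 18)%N.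
    move: (degH2 y yB) (degH2 u uB) (degH2 w wB) (gl y u) (gl y w) (gl u w); rewrite SE.
    by clear; lia.
  by rewrite -(ler_nat R); clear; lra.
apply: (gain 2); last first.
  by move: tau2; rewrite -(ler_nat R) !natrD; clear; lra.
apply: (@vertex_gain0 _ _ _ e_sym e_irr _ _ 1); rewrite ?ltr01 ?divr_gt0 ?ltr0n //.
rewrite -/H -/B -/(deg U x) dx.
(* For [xi = 1], [Lam = 2] and degree 3 the criterion is [S / 2 + 27 <= 32]. The bound 10 arises as
   4 + 6 when [u] and [w] have degree at most 1 in [H], and as 6 + 4 when [w] has no common
   neighbour with [y] or [u]. *)
suff : (codeg_sum e H B <= 10)%N by rewrite -(ler_nat R); clear; lra.
have [X0|[z zX]] := set_0Vmem X.
  have LE : [set u; w] \subset L.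
    rewrite X0 cards0 addn0 in tau1.
    have LS : L \subset [set u; w].
      apply/subsetP => z zL; have := subsetP LXB z; rewrite in_setU zL => /(_ isT).
      rewrite BE !inE => /orP[/orP[/eqP zy|-> //]|->]; last by rewrite orbT.
      by move: zL; rewrite zy inE dy andbF.
    suff -> : L = [set u; w] by [].
    by apply/eqP; rewrite eqEcard LS cards2 (leq_trans _ tau1) // ; case: (_ != _).
  have dL b : b \in [set u; w] -> (deg H b <= 1)%N.
    by move/(subsetP LE); rewrite inE => /andP[bB]; rewrite degH.
  move: (degH2 y yB) (dL u) (dL w) (gl u y) (gl w y) (gl u w); rewrite SE (gC u y) (gC w y).
  rewrite !inE !eqxx ?orbT /= => a /(_ isT) b /(_ isT).
  by move: a b; clear; lia.
have [C cC [zC uniC]] := Xu z zX.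
have [_ CH _ cl C2] := cycP cC.
have zB := subsetP XB z zX.
have BsH : {subset B <= H} by exact/subsetP.
(* [C] cannot contain all of [B], since [L :|: X] would then reduce to the single vertex [z]; hence
   [C] separates [w] from [y] and [u]. *)
have [g1 g2] : g y w = 0%N /\ g u w = 0%N.
  have [wC|wC] := boolP (w \in C); last first.
    have yC : y \in C.
      move: zB; rewrite -/B BE !inE => /orP[/orP[/eqP<- //|/eqP zu]|/eqP zw].
        by rewrite (CyuP C cC) -zu.
      by rewrite -zw zC in wC.
    have uC : u \in C by rewrite -CyuP.
    by split; apply: codeg0 cl _ _ wC; rewrite ?BsH.
  have [yC|yC] := boolP (y \in C); last first.
    have uC : u \notin C by rewrite -CyuP.
    by split; rewrite gC; apply: codeg0 cl wC _ _; rewrite ?BsH.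
  have uC : u \in C by rewrite -CyuP.
  have BC b : b \in B -> b \in C by rewrite BE !inE => /orP[/orP[]|] /eqP->.
  have : (#|L :|: X| <= #|[set z]|)%N.
    apply/subset_leq_card/subsetP => t tLX; have tB := subsetP LXB t tLX.
    have tC := BC t tB; move: tLX; rewrite in_setU => /orP[|tX].
      by rewrite [t \in L]inE degH // C2 // andbF.
    by rewrite inE (uniC t tX tC).
  by rewrite cards1 -tauE leqNgt tau1.
move: (degH2 y yB) (degH2 u uB) (degH2 w wB) (gl y u); rewrite SE g1 g2.
by clear; lia.
Qed.
End Cubic.

(** * Two vertices of degree 3 on a common cycle *)

Section Ear.
Variables (R : rcfType) (n : nat) (e : rel 'I_n).
Hypotheses (e_sym : symmetric e) (e_irr : irreflexive e).
Implicit Types (U H W B C D : {set 'I_n}) (x y z v : 'I_n).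
Local Notation nbr := (nbr e).
Local Notation deg := (deg e).
Local Notation cdeg := (cdeg e).
Local Notation erel := (erel e).
Local Notation conn := (conn e).
Local Notation closedin := (closedin e).
Local Notation cyc := (cyc e).
Local Notation ncyc := (ncyc e).
Local Notation gcycle := (gcycle e).
Local Notation thin := (thin e).
Local Notation senergy := (senergy R e).
Local Notation star := (star R e).

(* Deleting [x] leaves a connected graph: a component avoiding [y] would contain at
   most one neighbour of [x], hence have an odd degree sum. *)
Lemma theta_energy U x y a u q : conn U -> x != y -> ~~ e x y ->
  gcycle U (x :: a :: q) -> u = last a q -> a != u -> y \in a :: q ->
  deg U x = 3%N -> deg U y = 3%N ->
  {in U, forall z, z != x -> z != y -> deg U z = 2%N} ->
  (\sum_(z in U) cdeg U z)%:R <= 2 * senergy U.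
Proof.
move=> cU xy nexy gs ua au yq dx dy d2; set H := U :\ x.
have xU : x \in U by apply: gcycle_in gs _; exact: mem_head.
have yU : y \in U by apply: gcycle_in gs _; rewrite inE yq orbT.
have yH : y \in H by rewrite !inE eq_sym xy.
have aq := gcycle_path gs.
have cay z : z \in a :: q -> connect (erel H) y z.
  move=> zq; apply: (@connect_trans _ _ a); first rewrite conn_sym //.
    exact: (path_connect aq).
  exact: (path_connect aq).
have degH z : z \in U -> ((x \in nbr U z) + deg H z)%N = deg U z.
  by move=> zU; rewrite (degD1 e U x z).
have nx z : (x \in nbr U z) = e x z by rewrite inE xU e_sym.
have conH : conn H.
  apply: (conn_remove e_sym cU yH) => z zx; apply: contraT => nyz.
  have zH : z \in H by exact: (subsetP (nbr_subD1 e_irr U x)).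
  set D := component e H z.
  have DH : D \subset H by apply/subsetP => t; rewrite inE => /andP[].
  have Dy t : t \in D -> ~~ connect (erel H) y t.
    rewrite inE => /andP[_ zt]; apply: contra nyz => /connect_trans; apply.
    by rewrite conn_sym.
  have zD : z \in D by rewrite inE zH connect0.
  have cD : closedin H D by exact: component_closed.
  have : (\sum_(t in D) deg U t = #|D :&: nbr U x| + \sum_(t in D) deg D t)%N.
    rewrite -sum1_card [X in (X + _)%N](eq_bigl (fun t => (t \in D) && (t \in nbr U x)));
      last first.
      by move=> t; rewrite in_setI.
    rewrite big_mkcondr -big_split; apply: eq_bigr => t tD.
    have tU : t \in U by have := subsetP DH t tD; rewrite inE => /andP[].
    rewrite -degH // (deg_closed DH cD tD) nx [t \in nbr _ _]inE tU.
    by case: (e x t).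
  rewrite (eq_bigr (fun=> 2%N)) => [|t tD]; last first.
    have := subsetP DH t tD; rewrite !inE => /andP[tx tU]; apply: d2 => //.
    by apply: contraNneq (Dy t tD) => ->.
  have := even_sum_deg e_sym e_irr D.
  have : (0 < #|D :&: nbr U x|)%N by apply/card_gt0P; exists z; rewrite inE zD.
  have : (#|D :&: nbr U x| <= 1)%N.
    have /subset_leq_card/leq_trans -> // : D :&: nbr U x \subset nbr U x :\ a :\ u.
      apply/subsetP => t; rewrite in_setI => /andP[tD tx]; rewrite !in_setD1 tx andbT.
      apply/andP; split; apply: contraNneq (Dy t tD) => ->; apply: cay.
        by rewrite ua mem_last.
      exact: mem_head.
    have : u \in nbr U x :\ a.
      rewrite in_setD1 eq_sym au inE; have /and3P[_ _] := gs.
      rewrite /= rcons_path -ua => /and3P[_ _ /and3P[uU _]]; by rewrite e_sym uU.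
    have : a \in nbr U x.
      by rewrite inE; have /and3P[_ _ /= /andP[/and3P[_ -> ->]]] := gs.
    move=> an un; have := cardsD1 u (nbr U x :\ a); have := cardsD1 a (nbr U x).
    by rewrite an un -/(deg U x) dx; move: #|_| #|_| => ? ?; clear; lia.
  rewrite sum_nat_const; move: #|D| (\sum_(t in D) _)%N #|_| => k S m; clear.
  move=> m1 m0 oS E; have m1E : m = 1%N by lia.
  by move: oS; rewrite -(odd_double k) -muln2 E m1E add1n /= => /negPf->.
have dH3 z : z \in H -> (deg H z <= 3)%N.
  rewrite !inE => /andP[zx zU]; have := degH z zU.
  by have [->|zy] := eqVneq z y; [rewrite dy|rewrite d2 //]; clear; lia.
(* After the deletion only [y] can still have degree 3. *)
have thH : thin H.
  have only z : z \in H -> deg H z = 3%N -> z = y.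
    rewrite !inE => /andP[zx zU] dz; apply/eqP; apply: contraT => zy.
    by have := degH z zU; rewrite d2 // dz; clear; lia.
  move=> s cs z t zs ts dz dt.
  by rewrite (only z (gcycle_in cs zs) dz) (only t (gcycle_in cs ts) dt).
have := thin_energy R e_sym e_irr conH dH3 thH.
have gain : senergy H + 2 <= senergy U.
  apply: (@vertex_gain0 _ _ _ e_sym e_irr _ _ 1); rewrite ?ltr01 ?ltr0n // -/H -/(deg U x) dx.
  suff : (codeg_sum e H (nbr U x) <= 10)%N by rewrite -(ler_nat R); clear; lra.
  rewrite codeg_sumE ?nbr_subD1 //; apply: leq_trans (_ : (#|nbr U x| * 3 <= _)%N); last first.
    by rewrite -/(deg U x) dx.
  apply: sum_le_card => b bx; apply: leq_trans (_ : (#|nbr H b| * 3 <= _)%N).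
    apply: sum_le_card => z _; rewrite -dx.
    by apply/subset_leq_card/subsetIr.
  have [bU exb] : b \in U /\ e x b by move: bx; rewrite inE => /andP[].
  have : deg U b = 2%N.
    by apply: d2 => //; [apply: contraTneq exb => ->; rewrite e_irr|apply: contraNneq nexy => <-].
  by rewrite -(degH b bU) nx exb -/(deg H b); clear; lia.
have S1 : (\sum_(z in U) deg U z = 2 * #|U| + 2)%N.
  rewrite (big_setD1 x xU) (big_setD1 y) //= dx dy.
  rewrite (eq_bigr (fun=> 2%N)) => [|z]; last by rewrite !inE => /and3P[zy zx zU]; exact: d2.
  rewrite sum_nat_const (cardsD1 x U) xU (cardsD1 y (U :\ x)) yH.
  by move: #|_|; clear; lia.
have S2 : (\sum_(z in U) cdeg U z = 2 * #|U|)%N.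
  rewrite (eq_bigr (fun=> 2%N)) ?sum_nat_const 1?mulnC // => z zU; rewrite /cdeg.
  have [->|zx] := eqVneq z x; first by rewrite dx.
  have [->|zy] := eqVneq z y; first by rewrite dy.
  by rewrite d2.
have S3 : (\sum_(z in H) (deg H z + 2) + 6 = 4 * #|U|)%N.
  move: S1; rewrite big_split /= (sum_degD1 e_sym e_irr xU) dx sum_nat_const.
  rewrite (cardsD1 x U) xU -/H; move: (\sum_(z in H) _)%N #|H| => S k; clear; lia.
have S3R : (\sum_(z in H) (deg H z + 2))%:R + 6 = 4 * #|U|%:R :> R.
  by rewrite -(natrM _ 4) -S3 natrD.
(* [4 |U| - 6 <= 4 F(H) + 2] and [F(H) + 2 <= F(U)] combine to [|U| <= F(U)]. *)
rewrite S2 natrM; move: S3R gain; move: (\sum_(z in H) _)%N #|U| => S k; clear; lra.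
Qed.

(* Delete the interior [K] of a path of degree-2 vertices from [x] to the next
   vertex [y] of degree 3 on the cycle. *)
Lemma star_ear U s x y :
  (forall H, (#|H| < #|U|)%N -> star H) ->
  conn U -> (forall z, z \in U -> deg U z <= 3)%N ->
  (forall a b r, gcycle U [:: a, b & r] -> deg U a = 3%N -> deg U b <> 3%N) ->
  gcycle U s -> x \in s -> y \in s -> x != y -> deg U x = 3%N -> deg U y = 3%N ->
  (\sum_(z in U) cdeg U z)%:R <= 2 * senergy U.
Proof.
move=> IH cU d3 nadj gs xs; case/rot_to: xs (gs) => m s' sE _.
rewrite -(mem_rot m s) sE => ys' xy dx dy'.
move: gs; rewrite -(gcycle_rot e U s m) sE {s m sE} => gs.
have : has (fun z => deg U z == 3%N) s'.
  apply/hasP; exists y; last by rewrite dy'.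
  by move: ys'; rewrite inE eq_sym (negPf xy).
(* The given [y] is replaced by the first vertex of degree 3 met after [x], so that the stretch [K]
   before it has degree 2 throughout; [r] is the rest of the cycle. *)
move=> {y ys' xy dy'} h3; move: gs; case: (split_find h3) => y K r /eqP dy.
rewrite -all_predC => /allP K3 gs {h3 s'}.
have s3 : uniq (x :: rcons K y ++ r) by case/and3P: gs.
have xU : x \in U by apply: gcycle_in gs _; exact: mem_head.
have yU : y \in U by apply: gcycle_in gs _; rewrite inE mem_cat mem_rcons mem_head orbT.
have KU z : z \in K -> z \in U.
  by move=> zK; apply: gcycle_in gs _; rewrite inE mem_cat mem_rcons inE zK !orbT.
have K2 z : z \in K -> deg U z = 2%N.
  move=> zK; have := d3 z (KU z zK); have := K3 z zK => /= n3.
  have : (1 < deg U z)%N.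
    by apply: (gcycle_deg_ge2 e_sym gs); rewrite inE mem_cat mem_rcons inE zK !orbT.
  by move: n3; case: (deg U z) => [|[|[|[|]]]].
(* With [K] or [r] empty, [x] and [y] would be consecutive on the cycle, against [nadj]. *)
have Kne : K != [::].
  by apply: contraTneq isT => K0; case: (nadj x y r _ dx dy); rewrite K0 in gs.
have rne : r != [::].
  apply: contraTneq isT => r0; case: (nadj y x K _ dy dx).
  by rewrite -(gcycle_rot e U _ 1) rot1_cons /= -[rcons K y]cats0 -r0.
set p := x :: rcons K y; have [k kE] : exists k, size K = k by exists (size K).
have sp : size p = k.+2 by rewrite /= size_rcons kE.
have up : uniq p.
  by move: s3; rewrite -cat_cons cat_uniq => /andP[].
have /and3P[_ _ cs] := gs.
have pp : path (erel U) x (rcons K y).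
  by move: cs; rewrite /= rcons_cat cat_path => /andP[].
have pr : path (erel U) y (rcons r x).
  by move: cs; rewrite /= rcons_cat cat_path last_rcons => /andP[].
(* A chord would close [x], [K], [y] to a cycle on which [y] and [x] are consecutive. *)
have nexy : ~~ e x y.
  apply/negP => exy; case: (nadj y x K _ dy dx).
  apply/and3P; split.
  - by rewrite /=; case: (K) Kne.
  - by rewrite -(rot_uniq 1) rot1_cons.
  - by apply/andP; split; [rewrite /erel /= yU xU e_sym|].
pose f (i : 'I_k.+2) := nth x p i.
have fin (i : 'I_k.+2) : f i \in p by rewrite mem_nth // sp.
have fsurj z : z \in p -> exists i, f i = z.
  move=> zp; have iz : (index z p < k.+2)%N by rewrite -sp index_mem.
  by exists (Ordinal iz); rewrite /f /= nth_index.
have finj : injective f.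
  by move=> i j /eqP; rewrite nth_uniq ?sp // => /eqP/val_inj.
set Ks := [set z in K]; set H := U :\: Ks.
have HU : H \subset U by exact: subsetDl.
have f0 : f ord0 = x by [].
have fm : f ord_max = y by rewrite /f /p /= nth_rcons kE ltnn eqxx.
have fK (i : 'I_k.+2) : i != ord0 -> i != ord_max -> f i \in K.
  case: i => [[|i] ilt] // _; rewrite -val_eqE /= => im.
  have ik : (i < k)%N by move: ilt im; clear; lia.
  by rewrite /f /= nth_rcons kE ik mem_nth // kE.
have fe (i j : 'I_k.+2) : i.+1 = j -> e (f i) (f j).
  move=> ij; have := pathP x pp i; rewrite size_rcons kE -ltnS ij => /(_ (ltn_ord j))/and3P[].
  by move=> _ _; rewrite /f -ij.
have fU (i : 'I_k.+2) : f i \in U.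
  by apply: gcycle_in gs _; rewrite -cat_cons mem_cat fin.
have fnbr (i : 'I_k.+2) z : i != ord0 -> i != ord_max -> z \in U -> e (f i) z ->
    exists2 j : 'I_k.+2, (i.+1 == j) || (j.+1 == i) & z = f j.
  move=> i0 im zU eiz.
  have i0' : (0 < i)%N by move: i0; rewrite -val_eqE lt0n.
  have im' : (i.+1 < k.+2)%N.
    by move: (ltn_ord i) im; rewrite -val_eqE /=; clear; lia.
  have ip' : (i.-1 < k.+2)%N by move: im'; clear; lia.
  pose a := Ordinal ip'; pose b := Ordinal im'.
  have ab : f a != f b.
    by rewrite (inj_eq finj) -val_eqE /= neq_ltn ltnS leq_pred.
  have sub : [set f a; f b] \subset nbr U (f i).
    apply/subsetP => t; rewrite !inE => /orP[] /eqP->; rewrite fU /=.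
      by rewrite e_sym fe //= prednK.
    by rewrite fe.
  have : z \in nbr U (f i) by rewrite inE zU.
  have -> : nbr U (f i) = [set f a; f b].
    apply/esym/eqP; rewrite eqEcard sub cards2 ab -/(deg U (f i)) K2 //; exact: fK.
  rewrite !inE => /orP[]/eqP->.
    by exists a; rewrite //= prednK // eqxx orbT.
  by exists b; rewrite //= eqxx.
have KP z : z \in K -> exists i, f i = z.
  by move=> zK; apply: fsurj; rewrite inE mem_rcons inE zK !orbT.
have xK : x \notin K.
  by move: s3; rewrite /= mem_cat mem_rcons inE !negb_or => /andP[/andP[/andP[_ ->]]].
have yK : y \notin K.
  by move: up; rewrite /= rcons_uniq => /and3P[].
have xy : x != y by move: up; rewrite /= mem_rcons inE negb_or => /andP[/andP[]].
have xH : x \in H by rewrite !inE xK.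
have yH : y \in H by rewrite !inE yK.
have fH (i : 'I_k.+2) : f i \in H -> i = ord0 \/ i = ord_max.
  have [->|i0] := eqVneq i ord0; first by left.
  have [->|im] := eqVneq i ord_max; first by right.
  by rewrite !inE (fK i i0 im).
have Knbr z t : z \in K -> t \in H -> e z t -> t = x \/ t = y.
  move=> zK tH ezt.
  have [i fz] := KP z zK.
  have [||||j _ tE] := fnbr i t.
  - by apply: contraNneq xK => E; rewrite -f0 -E fz.
  - by apply: contraNneq yK => E; rewrite -fm -E fz.
  - exact: (subsetP HU).
  - by rewrite fz.
  by move: tH; rewrite tE => /fH[]->; [left|right].
have k0 : (0 < k)%N by rewrite -kE lt0n size_eq0.
have degEnd (o i : 'I_k.+2) : f o \notin K -> deg U (f o) = 3%N -> f i \in K ->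
    e (f o) (f i) -> (forall j : 'I_k.+2, (j.+1 == o) || (o.+1 == j) -> j = i) ->
    deg H (f o) = 2%N.
  move=> oK do3 iK eoi uniqi.
  have nE : nbr H (f o) = nbr U (f o) :\ f i.
    apply/setP => z; rewrite !inE -!andbA; case zU: (z \in U); rewrite ?andbF //=.
    case ez : (e (f o) z); rewrite ?andbF ?andbT //=; congr (~~ _).
    apply/idP/eqP => [zK|->//]; have [j fz] := KP z zK.
    have [||||l jl oE] := fnbr j (f o).
    - by apply: contraNneq xK => E; rewrite -f0 -E fz.
    - by apply: contraNneq yK => E; rewrite -fm -E fz.
    - exact: fU.
    - by rewrite fz e_sym.
    by rewrite -fz (uniqi j) // (finj _ _ oE).
  by move: do3; rewrite /deg (cardsD1 (f i) (nbr U (f o))) -nE inE fU eoi; case.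
have degHx : deg H x = 2%N.
  have i1 : (1 < k.+2)%N by [].
  rewrite -f0; apply: (degEnd ord0 (Ordinal i1)) => //; last 1 first.
  - by move=> j /= /eqP jE; exact: val_inj.
  - by apply: fK => //; rewrite -val_eqE /=; move: k0; clear; lia.
  - exact: fe.
have degHy : deg H y = 2%N.
  have ik : (k < k.+2)%N by [].
  rewrite -fm; apply: (degEnd ord_max (Ordinal ik)); rewrite ?fm //; last 1 first.
  - by move=> j /= jE; apply: val_inj; move: jE (ltn_ord j) => /=; clear; lia.
  - by apply: fK => //; rewrite -val_eqE /=; move: k0; clear; lia.
  - by rewrite -fm e_sym fe.
have degHz z : z \in H -> z != x -> z != y -> deg H z = deg U z.
  move=> zH zx zy; congr #|pred_of_set _|; apply/setP => t; rewrite !inE.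
  have [tK|//] := boolP (t \in K); rewrite /=; apply/esym/negP => /andP[tU ezt].
  have [E|E] := Knbr t z tK zH (etrans (e_sym _ _) ezt).
    by rewrite E eqxx in zx.
  by rewrite E eqxx in zy.
have gain : senergy H + k%:R <= senergy U.
  apply: (@ear_gain _ _ _ e_sym e_irr U H k f) => //.
  - by rewrite fm.
  - by move=> i i0 im; rewrite !inE (fK i i0 im).
  - apply/setP => z; rewrite in_setU in_setD inE; apply/idP/idP => [zU|]; last first.
      by move=> /orP[/andP[]//|/imsetP[i _ ->]].
    rewrite zU andbT; have [zK|//] := boolP (z \in K); rewrite /=.
    by have [i <-] := KP z zK; apply/imsetP; exists i.
  - move=> i j; apply/idP/idP => [eij|/orP[/eqP/fe//|/eqP/fe]]; last by rewrite e_sym.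
    have [i0|i0] := eqVneq i ord0; last first.
      have [im|im] := eqVneq i ord_max; last first.
        by have [t h /finj->] := fnbr i (f j) i0 im (fU j) eij.
      have [j0|j0] := eqVneq j ord0.
        by move: eij; rewrite im j0 fm f0 e_sym (negPf nexy).
      have [jm|jm] := eqVneq j ord_max; first by move: eij; rewrite im jm e_irr.
      have [t h /finj->] := fnbr j (f i) j0 jm (fU i) (etrans (e_sym _ _) eij).
      by rewrite orbC.
    have [j0|j0] := eqVneq j ord0; first by move: eij; rewrite i0 j0 e_irr.
    have [jm|jm] := eqVneq j ord_max.
      by move: eij; rewrite i0 jm f0 fm (negPf nexy).
    have [t h /finj->] := fnbr j (f i) j0 jm (fU i) (etrans (e_sym _ _) eij).
    by rewrite orbC.
  - move=> i z i0 im zH eiz; rewrite f0 fm; apply: Knbr eiz => //; exact: fK.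
  - by rewrite f0 fm.
  - by rewrite f0 degHx.
  - by rewrite fm degHy.
(* The ends drop from degree 3 to 2, which the cap does not see, so each deleted vertex costs just
   2, matched by the gain [k]. *)
have sumE : (\sum_(z in U) cdeg U z = \sum_(z in H) cdeg H z + 2 * k)%N.
  rewrite (big_setID Ks) [LHS]addnC; congr addn.
    apply: eq_bigr => z zH; rewrite /cdeg.
    have [->|zx] := eqVneq z x; first by rewrite dx degHx.
    have [->|zy] := eqVneq z y; first by rewrite dy degHy.
    by rewrite degHz.
  have -> : U :&: Ks = Ks by apply/setIidPr/subsetP => z; rewrite inE => /KU.
  rewrite (eq_bigr (fun=> 2%N)) => [|z]; last by rewrite inE /cdeg => /K2->.
  rewrite sum_nat_const mulnC -kE; congr muln.
  have /card_uniqP <- : uniq K by move: up; rewrite /= rcons_uniq => /and3P[].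
  by apply: eq_card => z; rewrite inE.
(* The rest of the cycle joins [y] to [x] outside [K]; hence retracting [K] to [x] turns walks of
   [U] into walks of [H]. *)
have xyH : connect (erel H) y x.
  apply/connectP; exists (rcons r x); last by rewrite last_rcons.
  apply: (path_restrict pr) => z; rewrite inE mem_rcons inE.
  case/or3P => [/eqP->//|/eqP->//|zr]; rewrite !inE.
  rewrite (gcycle_in gs) ?inE ?mem_cat ?zr ?orbT // andbT.
  apply: contraTN zr => zK; move: s3; rewrite -cat_cons cat_uniq => /and3P[_ + _].
  by move=> /hasPn h; apply/negP => /h /=; rewrite inE mem_rcons inE zK !orbT.
have conH : conn H.
  pose g z := if z \in K then x else z.
  have step a b : erel U a b -> connect (erel H) (g a) (g b).
    have h c d : c \in K -> d \in U -> d \notin K -> e c d -> connect (erel H) x d.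
      move=> cK dU dK ecd; have dH : d \in H by rewrite !inE dK.
      by have [->|->] := Knbr c d cK dH ecd; rewrite ?connect0 // (conn_sym e_sym).
    move=> /and3P[aU bU eab]; rewrite /g.
    have [aK|aK] := boolP (a \in K); have [bK|bK] := boolP (b \in K).
    - exact: connect0.
    - exact: h aK bU bK eab.
    - by rewrite (conn_sym e_sym); apply: h bK aU aK _; rewrite e_sym.
    - by apply: connect1; rewrite /erel /= !inE aK bK aU bU.
  apply: (@conn_from _ _ e_sym _ x) => z; rewrite !inE => /andP[zK zU].
  have /connP/(_ x z xU zU)/(connect_map step) := cU.
  by rewrite /g (negPf xK) (negPf zK).
have [a [K' KE]] : exists a K', K = a :: K' by case: (K) Kne => // a K' _; exists a, K'.
have aK : a \in K by rewrite KE mem_head.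
have HltU : (#|H| < #|U|)%N.
  rewrite cardsD; have : (0 < #|U :&: Ks|)%N.
    by apply/card_gt0P; exists a; rewrite !inE aK KU.
  have : (#|U :&: Ks| <= #|U|)%N by rewrite subset_leq_card ?subsetIl.
  by move: #|_| #|U|; clear; lia.
have := IH H HltU; rewrite /star.
have [n0|[C]] : ncyc H = 0%N \/ exists C, cyc H C.
    rewrite /ncyc; have [->|[C]] := set_0Vmem [set C | cyc H C]; first by left; rewrite cards0.
    by rewrite inE; right; exists C.
  move: gain; rewrite sumE n0 natrD natrM.
  by move: (\sum_(z in H) _)%N => S; clear; lra.
(* Since [H] is connected, a 2-regular component is all of it, and [U] is a cycle with an ear: a
   theta graph. *)
move=> cC _; have [C0 CH _ clC C2] := cycP cC.
have CE : C = H by exact: conn_closed clC CH C0.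
apply: (@theta_energy U x y a (last y r) (rcons K' y ++ r)) => //.
- by move: gs; rewrite KE.
- by rewrite last_cat last_rcons.
- move: s3; rewrite -cat_cons cat_uniq => /and3P[_ /hasPn h _].
  apply/eqP => ae; have := h (last y r); rewrite -ae inE mem_rcons inE aK !orbT.
  suff -> : a \in r by move/(_ isT).
  by rewrite ae; case: (r) rne => //= c l _; exact: mem_last.
- by rewrite inE mem_cat mem_rcons mem_head orbT.
- move=> z zU zx zy; have [/K2//|zK] := boolP (z \in K).
  have zH : z \in H by rewrite !inE zK.
  by rewrite -degHz // C2 // CE.
Qed.
End Ear.

(** * Maximum degree at least 4 *)

(* The values of [xi] come from numerical optimisation.  Writing [d] as its least
   admissible value plus [t >= 0], the difference of the two sides times [Lam] has
   nonnegative coefficients in [t], except for [tau = 4, 5]. *)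
Lemma big_degree_arith (R : realFieldType) (tau d S : nat) :
  (tau <= 9)%N -> (4 <= d)%N -> (tau <= d)%N ->
  (S <= d * (tau + (d - tau) * d.-1))%N ->
  (d = 4 -> tau = 4 -> S <= 8)%N -> (d = 5 -> tau = 5 -> S <= 20)%N ->
  exists2 xi : R, 0 < xi & let Lam := 1 + tau%:R / 2 in
    S%:R / Lam + xi ^+ 2 * (1 + 2 * xi) ^+ 2 * d%:R <=
    4 * xi * (1 + xi) ^+ 3 * (d%:R - Lam).
Proof.
move=> t9 d4 td Sle h4 h5; pose D : R := d%:R.
have Sle' : S%:R <= D * (tau%:R + (D - tau%:R) * (D - 1)).
  move: Sle; rewrite -(ler_nat R) natrM natrD natrM natrB // -subn1 natrB //.
  by apply: leq_trans d4.
have D0 (k : nat) : (k <= d)%N -> exists2 t : R, D = k%:R + t & 0 <= t.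
  by move=> kd; exists (d%:R - k%:R); rewrite ?subr_ge0 ?ler_nat // /D addrC subrK.
have red (xi : R) : let Lam := 1 + tau%:R / 2 in
    S%:R <= (4 * xi * (1 + xi) ^+ 3 * (D - Lam) - xi ^+ 2 * (1 + 2 * xi) ^+ 2 * D) * Lam ->
    S%:R / Lam + xi ^+ 2 * (1 + 2 * xi) ^+ 2 * D <= 4 * xi * (1 + xi) ^+ 3 * (D - Lam).
  by move=> Lam; rewrite -lerBrDr ler_pdivrMr // ltr_wpDr ?divr_ge0 ?ler0n ?ltr01.
have [t3|t3] := leqP tau 3.
  exists (D / 5 + 1 / 4); first by rewrite ltr_wpDl ?divr_ge0 ?ler0n ?divr_gt0 ?ltr01 ?ltr0n.
  rewrite /= -/D; apply: red => /=; have [t DE t0] := D0 4 d4.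
  have t20 : 0 <= t ^+ 2 by rewrite exprn_ge0.
  have t30 : 0 <= t ^+ 3 by rewrite exprn_ge0.
  have t40 : 0 <= t ^+ 4 by rewrite exprn_ge0.
  move: Sle'; rewrite DE; move: S%:R => s {D0 DE D h4 h5 d4 td Sle t9 d S}.
  by case: tau t3 => [|[|[|[|]]]] // _ h; lra.
exists (D / 10 + 1 / 4); first by rewrite ltr_wpDl ?divr_ge0 ?ler0n ?divr_gt0 ?ltr01 ?ltr0n.
rewrite /= -/D; apply: red => /=.
have [E4|n4] := eqVneq tau 4.
  (* The general bound on [S] is 16 here, while this [xi] leaves room for little more than 8. *)
  have [E|n] := eqVneq d 4.
    have := h4 E E4; rewrite -(ler_nat R) /D E E4; move: S%:R => s; clear; lra.
  have d5 : (5 <= d)%N by rewrite ltn_neqAle eq_sym n.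
  have [t DE t0] := D0 5 d5.
  have t30 : 0 <= t ^+ 3 by rewrite exprn_ge0.
  have s1 : 0 <= (t * (t - 7)) ^+ 2 by rewrite sqr_ge0.
  have s2 : 0 <= t * (t - 10) ^+ 2 by rewrite mulr_ge0 ?sqr_ge0.
  move: Sle'; rewrite DE E4; move: S%:R => s {D0 DE D h4 h5 d4 td Sle t9 d S E4 n d5 t3 tau}.
  by lra.
have [E5|n5] := eqVneq tau 5.
  (* The general bound on [S] is 25 here, while this [xi] leaves room for a little less than 23. *)
  have [E|n] := eqVneq d 5.
    have := h5 E E5; rewrite -(ler_nat R) /D E E5; move: S%:R => s; clear; lra.
  have d6 : (6 <= d)%N by move: n td; rewrite E5; clear; lia.
  have [t DE t0] := D0 6 d6.
  have t20 : 0 <= t ^+ 2 by rewrite exprn_ge0.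
  have s1 : 0 <= (t * (t - 3)) ^+ 2 by rewrite sqr_ge0.
  have t40 : 0 <= t ^+ 4 by rewrite exprn_ge0.
  move: Sle'; rewrite DE E5; move: S%:R => s {D0 DE D h4 h5 d4 td Sle t9 d S E5 n4 n d6 t3 tau}.
  by lra.
have [t DE t0] := D0 tau td.
have t20 : 0 <= t ^+ 2 by rewrite exprn_ge0.
have t30 : 0 <= t ^+ 3 by rewrite exprn_ge0.
have t40 : 0 <= t ^+ 4 by rewrite exprn_ge0.
move: Sle'; rewrite DE; move: S%:R => s {D0 DE D h4 h5 d4 td Sle d S}.
by case: tau t3 n4 n5 t9 => [|[|[|[|[|[|[|[|[|[|]]]]]]]]]] // _ _ _ _ h; lra.
Qed.

Section Twins.
Variables (R : rcfType) (n : nat) (e : rel 'I_n).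
Hypotheses (e_sym : symmetric e) (e_irr : irreflexive e).
Implicit Types (U H W B C D : {set 'I_n}) (x y z v : 'I_n).
Local Notation nbr := (nbr e).
Local Notation deg := (deg e).
Local Notation cdeg := (cdeg e).
Local Notation erel := (erel e).
Local Notation conn := (conn e).
Local Notation closedin := (closedin e).
Local Notation cyc := (cyc e).
Local Notation ncyc := (ncyc e).
Local Notation gcycle := (gcycle e).
Local Notation thin := (thin e).
Local Notation senergy := (senergy R e).
Local Notation star := (star R e).

(** Without [W], both [v] and [w] keep at most one edge. A 2-regular component of the rest would
    avoid them and so be closed in [U], against connectedness; hence no component term appears. *)
Lemma star_twins U v w W :
  (forall H, (#|H| < #|U|)%N -> star H) ->
  conn U -> v \in U -> w \in U -> v != w -> W \subset U -> (2 < #|W|)%N ->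
  {in W, forall b, nbr U b = [set v; w]} ->
  (deg U v <= #|W|.+1)%N -> (deg U w <= #|W|.+1)%N ->
  (\sum_(z in U) cdeg U z)%:R <= 2 * senergy U.
Proof.
move=> IH cU vU wU vw WU W3 nW dv dw; set H := U :\: W.
have HU : H \subset U by exact: subsetDl.
have eW b i : b \in W -> i \in U -> e b i = (i \in [set v; w]).
  by move=> bW iU; rewrite -(nW b bW) inE iU.
have nWvw z : z \in [set v; w] -> z \notin W.
  by move=> zvw; apply/negP => zW; have := nbr_irr e_irr U z; rewrite nW // zvw.
have vH : v \in H by rewrite !inE vU andbT nWvw // !inE eqxx.
have wH : w \in H by rewrite !inE wU andbT nWvw // !inE eqxx orbT.
have WE z : z \in [set v; w] -> z \in U -> deg U z = (deg H z + #|W|)%N.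
  move=> zvw zU; rewrite /deg -(cardsID W) addnC; congr addn; last first.
    apply: eq_card => t; rewrite in_setI inE andbC; have [tW /=|//] := boolP (t \in W).
    by rewrite (subsetP WU t tW) e_sym eW.
  by apply: eq_card => t; rewrite !inE andbA.
have dHv : (deg H v <= 1)%N.
  by move: dv; rewrite WE ?inE ?eqxx //; move: #|W| (deg H v); clear => *; lia.
have dHw : (deg H w <= 1)%N.
  by move: dw; rewrite WE ?inE ?eqxx ?orbT //; move: #|W| (deg H w); clear => *; lia.
have dHz z : z \in H -> z \notin [set v; w] -> deg H z = deg U z.
  move=> zH zvw; apply: eq_card => t; rewrite !inE.
  have [tW|//] := boolP (t \in W); apply/esym/negP => /andP[tU ezt].
  by move: ezt; rewrite e_sym eW ?(negPf zvw) // (subsetP HU).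
have n0 : ncyc H = 0%N.
  apply/eqP; rewrite cards_eq0; apply/eqP/setP => C; rewrite !inE.
  apply/negP => cC; have [C0 CH _ clC C2] := cycP cC.
  have Cvw z : z \in C -> z \notin [set v; w].
    move=> /C2 dz; rewrite !inE; apply/negP => /orP[]/eqP zE; move: dz; rewrite zE.
      by move=> E; rewrite E in dHv.
    by move=> E; rewrite E in dHw.
  have CE : C = U.
    apply: conn_closed cU _ (subset_trans CH HU) C0; apply/closedinP => a b aC bU eab.
    have bH : b \in H.
      rewrite !inE bU andbT; apply/negP => bW; have := Cvw a aC.
      by rewrite -(eW b) // 1?e_sym ?eab // (subsetP (subset_trans CH HU)).
    by have /closedinP/(_ a b aC bH eab) := clC.
  by have := Cvw v; rewrite CE vU !inE eqxx => /(_ isT).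
have HltU : (#|H| < #|U|)%N.
  rewrite /H cardsD (setIidPr WU); have := subset_leq_card WU; move: W3.
  by move: #|W| #|U|; clear => *; lia.
have IHH := IH H HltU; move: IHH; rewrite /star n0 addr0 => IHH.
have sumE : (\sum_(z in U) cdeg U z + deg H v + deg H w =
             \sum_(z in H) cdeg H z + 2 * #|W| + 4)%N.
  have wv : w \in H :\ v by rewrite in_setD1 eq_sym vw.
  rewrite (big_setID W) /= (setIidPr WU) -/H (eq_bigr (fun=> 2%N)); last first.
    by move=> z zW; rewrite /cdeg /deg nW // cards2 vw.
  rewrite sum_nat_const.
  rewrite (big_setD1 v vH) (big_setD1 w wv) [in RHS](big_setD1 v vH) (big_setD1 w wv) /=.
  have -> : (\sum_(z in H :\ v :\ w) cdeg U z = \sum_(z in H :\ v :\ w) cdeg H z)%N.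
    apply: eq_bigr => z; rewrite !in_setD1 => /and3P[zw zv zH].
    by rewrite /cdeg dHz // !inE negb_or zv.
  rewrite /cdeg !WE ?inE ?eqxx ?orbT //.
  move: W3 dHv dHw; move: (\sum_(z in H :\ v :\ w) _)%N #|W| (deg H v) (deg H w); clear => *; lia.
(* Half the drop of the capped degree sum in [sumE]. *)
pose Lam : R := #|W|%:R + 2 - (deg H v + deg H w)%:R / 2.
have q2 : (deg H v + deg H w)%:R <= 2 :> R by rewrite (ler_nat _ _ 2) (leq_add dHv dHw).
have W3' : 3 <= #|W|%:R :> R by rewrite (ler_nat _ 3).
have gain : senergy H + Lam <= senergy U.
  have BH : [set v; w] \subset H by rewrite subUset !sub1set vH.
  have UE : U = H :|: W by rewrite -{1}(setID U W) (setIidPr WU) setUC.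
  have HW : [disjoint H & W].
    by rewrite disjoint_sym disjoints_subset /H setDE setCI setCK subsetUr.
  have W0 : (0 < #|W|)%N by exact: leq_trans W3.
  have L0 : 0 < Lam by rewrite /Lam; move: q2 W3'; clear; lra.
  have xi0 : 0 < 1 / 2 :> R by lra.
  apply: (@join_gain0 _ _ _ e_sym U H W [set v; w] UE HW BH eW (1/2) Lam W0 xi0 L0) => /=.
  have S0 : (codeg_sum e H [set v; w])%:R <= 2 * (deg H v + deg H w)%:R :> R.
    rewrite -natrM ler_nat codeg_sum_pairs // !sum_card2 // !setIid.
    rewrite [nbr H w :&: nbr H v]setIC -/(deg H v) -/(deg H w).
    have := subset_leq_card (subsetIl (nbr H v) (nbr H w)); rewrite -/(deg H v).
    have := subset_leq_card (subsetIr (nbr H v) (nbr H w)); rewrite -/(deg H w).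
    move: #|nbr H v :&: _| (deg H v) (deg H w); clear => *; lia.
  have -> : #|[set v; w]| = 2%N by rewrite cards2 vw.
  have q0 : 0 <= (deg H v + deg H w)%:R :> R by exact: ler0n.
  have : #|W|%:R * (codeg_sum e H [set v; w])%:R / Lam <= 2 * (deg H v + deg H w)%:R :> R.
    rewrite ler_pdivrMr // mulrC ler_pM ?ler0n //.
    by rewrite /Lam; move: q2; clear; lra.
  move: (_ / Lam) => Q; rewrite /Lam.
  move: (deg H v + deg H w)%:R #|W|%:R q2 q0 W3' => q s.
  by clear; lra.
have sumR : (\sum_(z in U) cdeg U z)%:R + (deg H v)%:R + (deg H w)%:R =
    (\sum_(z in H) cdeg H z)%:R + 2 * #|W|%:R + 4 :> R.
  by rewrite -natrM -!natrD sumE.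
move: gain sumR IHH; rewrite /Lam natrD.
move: (deg H v)%:R (deg H w)%:R #|W|%:R (\sum_(z in U) _)%:R (\sum_(z in H) _)%:R; clear => *; lra.
Qed.
End Twins.

(** The hypothesis of [join_gain_sub] for [Lam = 1 + t / 2] and [a = 3 / 2]. The quadratic
    coefficients add up to 1/2 + 3/16 + 1/6 = 41/48, and the linear term [11 t / 8] fits into the
    remainder from [t = 66 / 7] on, whence the threshold 10. *)
Lemma many_components_arith (R : realFieldType) (t S : R) : 10 <= t -> S <= t * t ->
  (1 + t / 2) * t + ((1 + t / 2) * (3 / 2) * t + S / (3 / 2)) / 4 <= t ^+ 2.
Proof.
move=> t10 St; have : 0 <= t * (t - 10) by rewrite mulr_ge0 //; lra.
have -> : S / (3 / 2) = S * (2 / 3) by rewrite invf_div.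
lra.
Qed.

Section BigDegree.
Variables (R : rcfType) (n : nat) (e : rel 'I_n).
Hypotheses (e_sym : symmetric e) (e_irr : irreflexive e).
Implicit Types (U H W B C D : {set 'I_n}) (x y z v : 'I_n).
Local Notation nbr := (nbr e).
Local Notation deg := (deg e).
Local Notation cdeg := (cdeg e).
Local Notation erel := (erel e).
Local Notation conn := (conn e).
Local Notation closedin := (closedin e).
Local Notation cyc := (cyc e).
Local Notation ncyc := (ncyc e).
Local Notation gcycle := (gcycle e).
Local Notation thin := (thin e).
Local Notation senergy := (senergy R e).
Local Notation star := (star R e).

(** [T] collects the neighbours of [v] that cost: those left with degree at most 1 and the
    representatives of new 2-regular components. They start few walks of length two back to [B]: the
    former have at most one neighbour in [H], and the neighbours of the latter have degree 2 there.
    If [T] has ten elements or more, the test vector is constant on [T]; below that the arithmetic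
    of [big_degree_arith] applies. *)
Lemma star_big_degree U v :
  (forall H, (#|H| < #|U|)%N -> star H) -> conn U -> v \in U ->
  {in U, forall z, (deg U z <= deg U v)%N} -> (3 < deg U v)%N ->
  (\sum_(z in U) cdeg U z)%:R <= 2 * senergy U.
Proof.
move=> IH cU vU dmax d4; set H := U :\ v; set B := nbr U v; set d := deg U v in dmax d4 *.
have BH : B \subset H by exact: nbr_subD1.
have HU : H \subset U by exact: subsetDl.
have dH b : b \in B -> deg U b = (deg H b).+1.
  rewrite inE => /andP[bU evb].
  by rewrite (degD1 e U v b) (_ : v \in nbr U b) // inE vU e_sym.
set L := [set b in nbr U v | (deg U b <= 2)%N].
have rem : (\sum_(z in U) cdeg U z <= \sum_(z in H) cdeg H z + 2 + #|L|)%N.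
  exact: cdeg_remove.
have [X [XB Xc Xu]] := cyc_reps e_sym cU vU.
have IHH : star H by apply: IH; rewrite /H [X in (_ < X)%N](cardsD1 v) vU.
set T := L :|: X; set tau := #|T|.
have LB : L \subset B by apply/subsetP => z; rewrite inE => /andP[].
have TB : T \subset B by rewrite subUset LB.
have dL b : b \in L -> (deg H b <= 1)%N.
  by move=> bL; have := dH b (subsetP LB b bL); move: bL; rewrite inE => /andP[_] + E; rewrite E.
have XP b : b \in X -> exists2 C, cyc H C & b \in C /\ {in T, forall t, t \in C -> t = b}.
  move=> bX; have [C cC [bC uC]] := Xu b bX; exists C => //; split=> // t.
  rewrite in_setU => /orP[tL tC|]; last exact: uC.
  by have := dL t tL; case/cycP: cC => _ _ _ _ ->.
have LX0 : [disjoint L & X].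
  apply/pred0P => z /=; apply/negP => /andP[/dL dz zX].
  by have [C /cycP[_ _ _ _ C2] [zC _]] := XP z zX; rewrite C2 in dz.
have tauE : tau = (#|L| + #|X|)%N.
  by rewrite /tau cardsU disjoint_setI0 // cards0 subn0.
have gain : senergy H + (1 + tau%:R / 2) <= senergy U ->
    (\sum_(z in U) cdeg U z)%:R <= 2 * senergy U.
  move: IHH rem; rewrite /star -Xc -/H tauE -(ler_nat R) !natrD.
  move: (\sum_(z in U) _)%:R (\sum_(z in H) _)%:R #|L|%:R #|X|%:R; clear => *; lra.
pose c w := #|nbr H w :&: B|.
have cle w : (c w <= d)%N by exact: subset_leq_card (subsetIr _ _).
pose s b := (\sum_(w in nbr H b) c w)%N.
have SE : codeg_sum e H B = (\sum_(b in B) s b)%N by rewrite codeg_sumE.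
(* A neighbour of a representative lies in the same component, which meets [T] only in that
   representative. *)
have Xnbr b w : b \in X -> w \in nbr H b -> (#|nbr H w :&: T| <= 1)%N /\ deg H w = 2%N.
  move=> bX; have [C cC [bC uC]] := XP b bX; have [_ CH _ /closedinP cl C2] := cycP cC.
  rewrite inE => /andP[wH ebw]; have wC := cl b w bC wH ebw.
  split; last exact: C2.
  rewrite -(cards1 b); apply/subset_leq_card/subsetP => t; rewrite in_setI [t \in nbr _ _]inE.
  by move=> /andP[/andP[tH ewt] tT]; rewrite inE (uC t tT (cl w t wC tH ewt)).
have dX b : b \in X -> deg H b = 2%N.
  by move=> bX; have [C /cycP[_ _ _ _ C2] [bC _]] := XP b bX; exact: C2.
have sB b : b \in B -> (s b <= d.-1 * d)%N.
  move=> bB; apply: (@leq_trans (#|nbr H b| * d)).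
    by apply: sum_le_card => w _; exact: cle.
  rewrite leq_mul2r; apply/orP; right; have := dmax b; rewrite dH //.
  move: bB; rewrite inE => /andP[bU _] /(_ bU); rewrite -/(deg H b).
  by move: (deg H b) d4; clear; lia.
have sT b : b \in T -> (s b <= d)%N.
  rewrite in_setU => /orP[bL|bX].
    apply: (@leq_trans (#|nbr H b| * d)); first by apply: sum_le_card => w _; exact: cle.
    by rewrite -[leqRHS]mul1n leq_mul2r dL ?orbT.
  apply: (@leq_trans (#|nbr H b| * 2)); last by rewrite -/(deg H b) dX.
  apply: sum_le_card => w wb; have [_ <-] := Xnbr b w bX wb.
  exact: subset_leq_card (subsetIl _ _).
have Sle : (codeg_sum e H B <= d * (tau + (d - tau) * d.-1))%N.
  rewrite SE (big_setID T) /= (setIidPr TB).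
  have := sum_le_card sT.
  have : (\sum_(b in B :\: T) s b <= #|B :\: T| * (d.-1 * d))%N.
    by apply: sum_le_card => b; rewrite in_setD => /andP[_ /sB].
  rewrite cardsD (setIidPr TB) -/tau -/(deg U v) -/d => h1 h2.
  by rewrite mulnDr [(d * tau)%N]mulnC [(d * (_ * _))%N]mulnC -mulnA leq_add.
have [tau9|tau10] := leqP tau 9; last first.
  apply: gain; apply: (@join_gain_sub _ _ _ e_sym U H [set v] B _ _ BH _ T (3 / 2)) => //.
  - by rewrite setUC setD1K.
  - by rewrite disjoint_sym disjoints1 !inE eqxx.
  - by move=> w i /set1P-> iU; rewrite inE iU.
  - by rewrite cards1.
  - exact: leq_trans tau10.
  - by rewrite divr_gt0 ?ltr0n.
  - by rewrite ltr_wpDr ?divr_ge0 ?ler0n ?ltr01.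
  have : (codeg_sum e H T <= tau * tau)%N.
    rewrite codeg_sumE ?(subset_trans TB) //; apply: sum_le_card => b.
    rewrite in_setU => /orP[bL|bX].
      apply: (@leq_trans (#|nbr H b| * tau)).
        by apply: sum_le_card => w _; exact: subset_leq_card (subsetIr _ _).
      by rewrite -[leqRHS]mul1n leq_mul2r dL ?orbT.
    apply: (@leq_trans (#|nbr H b| * 1)).
      by apply: sum_le_card => w wb; have [] := Xnbr b w bX wb.
    by rewrite -/(deg H b) dX // muln1; apply: leq_trans tau10.
  rewrite -/tau -(ler_nat R) natrM; apply: many_components_arith.
  by rewrite (ler_nat _ 10).
have xi_gain : (d = 4 -> tau = 4 -> codeg_sum e H B <= 8)%N ->
    (d = 5 -> tau = 5 -> codeg_sum e H B <= 20)%N ->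
    (\sum_(z in U) cdeg U z)%:R <= 2 * senergy U.
  move=> h4 h5; apply: gain.
  have td : (tau <= d)%N by exact: subset_leq_card.
  have [xi xi0 h] := big_degree_arith R tau9 d4 td Sle h4 h5.
  apply: (@vertex_gain0 _ _ _ e_sym e_irr _ _ xi) => //.
  by rewrite ltr_wpDr ?divr_ge0 ?ler0n ?ltr01.
(* Here [T] is all of [B], and [w] sees at least three of its vertices and misses at most one. Those
   it sees are not representatives, hence have degree 2 and are twins with neighbourhood
   [[set v; w]]. *)
have [/existsP[w /and5P[wH /eqP td c2 dc _]]|no] :=
  boolP [exists w, [&& w \in H, tau == d, (2 < c w)%N, (d <= (c w).+1)%N & true]].
  have TE : T = B by apply/eqP; rewrite eqEcard TB -/tau td leqnn.
  have [vw wU] : v != w /\ w \in U by move: wH; rewrite !inE eq_sym => /andP[].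
  apply: (@star_twins _ _ _ e_sym e_irr U v w (nbr H w :&: B)) => //.
  - by apply: subset_trans (subsetIr _ _) (subset_trans BH HU).
  - move=> b; rewrite in_setI => /andP[bw bB].
    have bH : b \in H by exact: (subsetP BH).
    have wb : w \in nbr H b by move: bw; rewrite [b \in _]inE => /andP[_ ewb]; rewrite inE wH e_sym.
    have : b \in T by rewrite TE.
    rewrite in_setU => /orP[|bX]; last first.
      by have [+ _] := Xnbr b w bX wb; rewrite TE => /(leq_trans c2).
    rewrite inE => /andP[_ d2]; apply/esym/eqP; rewrite eqEcard subUset !sub1set.
    rewrite (subsetP (nbr_sub e b HU) w wb) cards2 vw d2 !andbT.
    by move: bB; rewrite !inE e_sym vU => /andP[].
  - by apply: leq_trans (dmax w wU) _.
(* Failing that, every [c w] is at most 2 or at most [d - 2], which brings the codegree sum down to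
   8 for [d = 4] and to 15 for [d = 5]. *)
have cB w : w \in H -> tau = d -> (c w <= 2)%N || (c w <= d - 2)%N.
  move=> wH td; apply: contraR no; rewrite negb_or -!ltnNge => /andP[c2 cd].
  apply/existsP; exists w; rewrite wH td eqxx c2 /=.
  by move: cd; move: (c w); clear; lia.
have Sk k : (2 <= k)%N -> tau = d -> {in H, forall w, c w <= k}%N ->
    (codeg_sum e H B <= d * k)%N.
  move=> k2 td ck; have TE : T = B by apply/eqP; rewrite eqEcard TB -/tau td leqnn.
  rewrite SE; apply: sum_le_card => b; rewrite -TE in_setU => /orP[bL|bX].
    apply: (@leq_trans (#|nbr H b| * k)).
      by apply: sum_le_card => w; rewrite inE => /andP[wH _]; exact: ck.
    by rewrite -[leqRHS]mul1n leq_mul2r dL ?orbT.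
  apply: (@leq_trans (#|nbr H b| * 1)); last by rewrite -/(deg H b) dX.
  by apply: sum_le_card => w wb; rewrite /c -TE; have [] := Xnbr b w bX wb.
apply: xi_gain => dE tE.
  apply: (@leq_trans (d * 2)); last by rewrite dE.
  apply: Sk => //; first by rewrite tE dE.
  by move=> w wH; have := cB w wH (etrans tE (esym dE)); rewrite dE orbb.
apply: (@leq_trans (d * 3)); last by rewrite dE.
apply: Sk => //; first by rewrite tE dE.
by move=> w wH; have := cB w wH (etrans tE (esym dE)); rewrite dE => /orP[/leqW|].
Qed.

Lemma star_all U : star U.
Proof.
elim/card_set_ind: U => U IH.
have [->|/set0Pn[v0 v0U]] := eqVneq U set0.
  by rewrite /star big_set0 addr_ge0 ?mulr_ge0 ?senergy_ge0.
have [cU|ncU] := boolP (conn U); last first.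
  have [x xU [y yU nxy]] : exists2 x, x \in U & exists2 y, y \in U & ~~ connect (erel U) x y.
    by move: ncU => /forall_inPn[x xU /forall_inPn[y yU nxy]]; exists x => //; exists y.
  (* Over a component and its complement the capped degrees add up exactly, while the energy and the
     number of 2-regular components are superadditive. *)
  set C := component e U x; have CU : C \subset U by apply/subsetP => t; rewrite inE => /andP[].
  have cC : closedin U C by exact: component_closed.
  have xC : x \in C by rewrite inE xU connect0.
  have yC : y \notin C by rewrite inE yU.
  have lt1 : (#|C| < #|U|)%N.
    by rewrite proper_card // properE CU; apply/subsetPn; exists y.
  have lt2 : (#|U :\: C| < #|U|)%N.
    rewrite proper_card // properE subsetDl; apply/subsetPn; exists x => //.
    by rewrite in_setD xC.
  have := IH _ lt1; have := IH _ lt2; rewrite /star.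
  rewrite (cdeg_split e_sym CU cC) natrD.
  have := ncyc_split e_sym CU cC; rewrite -(ler_nat R) natrD.
  have : [disjoint C & U :\: C] by rewrite disjoints_subset setDE setCI setCK subsetUr.
  move/(senergyU R e_sym); rewrite (_ : C :|: U :\: C = U); last first.
    by rewrite -{1}(setIidPr CU) setID.
  move: (\sum_(z in C) _)%:R (\sum_(z in _) _)%:R (ncyc _)%:R (ncyc _)%:R (ncyc _)%:R.
  by clear => *; lra.
have [/forall_inP d2|nreg] := boolP [forall z in U, deg U z == 2%N].
  by apply: star_regular2 => // [|x /d2/eqP //]; apply/set0Pn; exists v0.
suff h : (\sum_(z in U) cdeg U z)%:R <= 2 * senergy U.
  by apply: le_trans h _; rewrite lerDl.
case: (arg_maxnP (deg U) v0U) => v vU dmax.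
have [v4|v3] := leqP 4 (deg U v); first exact: star_big_degree vU dmax v4.
have d3 z : z \in U -> (deg U z <= 3)%N by move/dmax => h; exact: leq_trans h v3.
have [[a [b [r [gs da db]]]]|nadj] :=
    EM (exists a b r, [/\ gcycle U [:: a, b & r], deg U a = 3%N & deg U b = 3%N]).
  exact: star_adjacent_cubic gs da db.
have [[s [x [y [[gs xs ys] xy dx dy]]]]|nthin] :=
    EM (exists s x y, [/\ [/\ gcycle U s, x \in s & y \in s], x != y,
        deg U x = 3%N & deg U y = 3%N]).
  apply: (star_ear e_sym e_irr IH cU d3 _ gs xs ys xy dx dy) => a b r gs' da db.
  by apply: nadj; exists a, b, r.
apply: thin_cdeg => //.
  move=> s gs x y xs ys dx dy; apply/eqP; apply: contraT => xy.
  by case: nthin; exists s, x, y.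
by move=> h; case/negP: nreg; apply/forall_inP => z /h ->.
Qed.
End BigDegree.

(** * Connected 2-regular graphs are cycles *)

Section CycleGraph.
Variables (R : rcfType) (n : nat) (e : rel 'I_n).
Hypotheses (e_sym : symmetric e) (e_irr : irreflexive e).
Implicit Types (U H W B C D : {set 'I_n}) (x y z v : 'I_n).
Local Notation nbr := (nbr e).
Local Notation deg := (deg e).
Local Notation cdeg := (cdeg e).
Local Notation erel := (erel e).
Local Notation conn := (conn e).
Local Notation closedin := (closedin e).
Local Notation cyc := (cyc e).
Local Notation ncyc := (ncyc e).
Local Notation gcycle := (gcycle e).
Local Notation thin := (thin e).
Local Notation senergy := (senergy R e).
Local Notation star := (star R e).

(** A path is extended at its head until all neighbours of the head lie on it, which happens within
    [n] steps as its vertices are distinct. A neighbour other than the second vertex then closes a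
    cycle of length at least 3. *)
Lemma gcycle_exists U : U != set0 -> {in U, forall x, (1 < deg U x)%N} ->
  exists s, gcycle U s.
Proof.
move=> /set0Pn[x0 x0U] d2.
suff grow m : (exists s, gcycle U s) \/
    exists x s, [/\ uniq (x :: s), path (erel U) x s, x \in U & size s = m].
  have [//|[x [s [us _ _ ss]]]] := grow n.
  by have := max_card [in x :: s]; rewrite (card_uniqP us) card_ord /= ss ltnn.
elim: m => [|m [|[x [s [us ps xU ss]]]]]; [|by left|].
  by right; exists x0, [::].
have [sub|] := boolP (nbr U x \subset s); last first.
  case/subsetPn => b; rewrite inE => /andP[bU exb] bs; right; exists b, (x :: s).
  split=> //=; last by rewrite ss.
    rewrite inE negb_or bs andbT; move: us => /= ->; rewrite andbT.
    by apply: contraTneq exb => ->; rewrite e_irr.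
  by rewrite ps andbT /erel /= bU xU e_sym.
left; case: s us ps {ss} sub => [|a s] us ps sub.
  have := d2 x xU; rewrite /deg (_ : nbr U x = set0) ?cards0 //.
  by apply/eqP; rewrite -subset0; apply: subset_trans sub _; apply/subsetP.
have [b bx ba] : exists2 b, b \in nbr U x & b != a.
  have : (0 < #|nbr U x :\ a|)%N.
    have := d2 x xU; rewrite /deg (cardsD1 a (nbr U x)).
    by case: (_ \in _) => //; exact: ltnW.
  by move=> /card_gt0P[b]; rewrite in_setD1 => /andP[]; exists b.
have bs : b \in s by have := subsetP sub b bx; rewrite inE (negPf ba).
case/splitPr: bs us ps => p1 p2 us ps; exists (x :: a :: rcons p1 b).
move: us; rewrite -cat_rcons -!cat_cons cat_uniq => /and3P[us _ _].
move: ps => /= /andP[xa]; rewrite -cat_rcons cat_path => /andP[p1b _].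
apply/and3P; split=> //; first by rewrite /= size_rcons.
apply/andP; split; first exact: xa.
rewrite -/(path _ _ _) -/(rcons (rcons p1 b) x) rcons_path p1b last_rcons /erel /= xU.
by move: bx; rewrite inE e_sym.
Qed.

(** With all degrees 2, the neighbours of a vertex of the cycle are its two cyclic neighbours, so
    the cycle is closed under adjacency. *)
Lemma gcycle_spans U s : conn U -> {in U, forall x, deg U x = 2%N} ->
  gcycle U s -> U = [set z in s].
Proof.
move=> cU d2 gs; apply/esym/(conn_closed cU).
- apply/closedinP => y z; rewrite inE => ys zU eyz; rewrite inE.
  case/rot_to: ys => k p sE; rewrite -(mem_rot k) sE.
  move: gs; rewrite -(gcycle_rot _ _ _ k) sE => gs.
  case: p {sE} gs => [/and3P[]//|a p]; case/lastP: p => [/and3P[]//|p c] gs.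
  have yU : y \in U by apply: gcycle_in gs _; exact: mem_head.
  have gs' : gcycle U [:: c, y, a & p].
    by rewrite -(gcycle_rot _ _ _ 1) rot1_cons.
  have : z \in nbr U y by rewrite inE zU.
  rewrite (gcycle_nbr2 e_sym gs' (d2 y yU)) !inE => /orP[]/eqP->.
    by rewrite mem_rcons mem_head !orbT.
  by rewrite eqxx orbT.
- by apply/subsetP => z; rewrite inE; exact: (gcycle_in gs).
- by apply/set0Pn; case: s gs => [/and3P[]//|a s _]; exists a; rewrite in_set mem_head.
Qed.

(** The neighbours of [f i] are [f (ordS i)] and [f (ord_pred i)], distinct because the length
    exceeds 2; degree 2 leaves no room for chords. *)
Lemma gcycle_edge U s (f : 'I_(size s) -> 'I_n) : gcycle U s ->
  {in U, forall x, deg U x = 2%N} -> (forall i x, f i = nth x s i) ->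
  forall i j, e (f i) (f j) = cycle_edge i j.
Proof.
move=> gs d2 fE; have /and3P[s3 us cs] := gs.
have fin i : f i \in s by rewrite (fE i (f i)) mem_nth.
have fU i : f i \in U by exact: gcycle_in gs _.
have finj : injective f.
  by move=> i j; rewrite (fE j (f i)) {1}(fE i (f i)) => /eqP; rewrite nth_uniq // => /eqP/val_inj.
have step i : e (f i) (f (ordS i)).
  case: s f gs s3 us cs fE fin fU finj i => // x p f gs s3 us cs fE _ _ _ i.
  have := pathP x cs i; rewrite size_rcons => /(_ (ltn_ord i)).
  rewrite !(fE _ x) -rcons_cons nth_rcons ltn_ord /= nth_rcons => /and3P[_ _].
  have [ip|ip] := ltnP i (size p); first by rewrite modn_small.
  have -> : val i = size p by apply/eqP; rewrite eqn_leq ip andbT -ltnS; exact: (ltn_ord i).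
  by rewrite eqxx modnn.
have nbrE i : nbr U (f i) = [set f (ordS i); f (ord_pred i)].
  apply/esym/eqP; rewrite eqEcard subUset !sub1set !inE !fU step /= e_sym.
  have := step (ord_pred i); rewrite ord_predK => -> /=.
  rewrite cards2 -/(deg U (f i)) d2 // (inj_eq finj).
  suff -> : ordS i != ord_pred i by [].
  rewrite -val_eqE /=; move: (ltn_ord i) s3; move: (size s) (val i) => m k; clear.
  move=> km m3; have [k0|k0] := posnP k.
    by rewrite k0 add0n !modn_small //; lia.
  have -> : ((k + m).-1 = k.-1 + m)%N by lia.
  rewrite modnDr (modn_small (m := k.-1)); last by lia.
  have [lt|ge] := ltnP k.+1 m; first by rewrite modn_small //; lia.
  have -> : k.+1 = m by lia.
  by rewrite modnn; lia.
move=> i j; rewrite /cycle_edge /=.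
have -> : e (f i) (f j) = (f j \in nbr U (f i)) by rewrite inE fU.
rewrite nbrE !inE !(inj_eq finj).
have -> : (j == ord_pred i) = (i == ordS j).
  by apply/eqP/eqP => ->; rewrite ?ord_predK ?ordSK.
case: (eqVneq i j) => [<-|_] //=; rewrite orbb.
by apply: contraTF (step i) => /eqP <-; rewrite e_irr.
Qed.

End CycleGraph.

Theorem theorem1p1 (R : realType) (G : sgraph)
  (hconn : connected_graph G) (hdeg : (2 <= min_degree G)%N) (hcyc : ~ is_cycle G) :
  #|G|%:R <= pos_square_energy R G.
Proof.
case: hconn => G0 hconn.
pose e : rel 'I_#|G| := fun i j => edge (enum_val i) (enum_val j).
have e_sym : symmetric e by move=> i j; rewrite /e edge_sym.
have e_irr : irreflexive e by move=> i; rewrite /e edge_irrefl.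
have -> : pos_square_energy R G = senergy R e setT.
  rewrite /senergy (_ : adjm R e setT = adjacency R G) //.
  by apply/matrixP => i j; rewrite !mxE !inE.
have degE i : deg e setT i = degree (enum_val i).
  rewrite /deg /degree -(card_imset _ (@enum_val_inj _ G)); apply: eq_card => y.
  apply/imsetP/idP => [[j]|]; first by rewrite !inE => ? ->.
  by rewrite inE => ey; exists (enum_rank y); rewrite ?enum_rankK // !inE /e enum_rankK.
have d2 i : (2 <= deg e setT i)%N.
  rewrite degE; apply: leq_trans hdeg _; rewrite /min_degree.
  have := mem_index_enum (enum_val i); elim: (index_enum _) => // z r IHr.
  rewrite inE big_cons geq_min => /orP[/eqP<-|/IHr->]; first by rewrite leqnn.
  by rewrite orbT.
have cT : conn e setT.
  apply/connP => i j _ _.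
  have st (x y : G) : edge x y -> connect (erel e setT) (enum_rank x) (enum_rank y).
    by move=> exy; apply: connect1; rewrite /erel /= !inE /e !enum_rankK.
  by have := connect_map st (hconn (enum_val i) (enum_val j)); rewrite !enum_valK.
have T0 : [set: 'I_#|G|] != set0 by rewrite -card_gt0 cardsT card_ord.
(* All capped degrees equal 2, so the claim follows once the whole graph has no 2-regular
   component. *)
have := star_all R e_sym e_irr setT; rewrite /star.
rewrite (eq_bigr (fun=> 2%N)) => [|i _]; last by rewrite /cdeg; apply/minn_idPr.
have -> : ncyc e setT = 0%N; last first.
  rewrite sum_nat_const cardsT card_ord natrM addr0 mulrC.
  by rewrite ler_pM2l ?ltr0n.
apply/eqP; rewrite cards_eq0; apply/eqP/setP => C; rewrite !inE; apply/negP => cC.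
(* Such a component is the whole graph by connectedness, and positions along a cycle through all
   vertices give the isomorphism. *)
case: hcyc; have [C0 CT _ clC C2] := cycP cC.
have CE : C = setT by exact: conn_closed clC CT C0.
have r2 : {in [set: 'I_#|G|], forall i, deg e setT i = 2%N}.
  by move=> i _; apply: C2; rewrite CE inE.
have [s gs] : exists s, gcycle e setT s.
  by apply: gcycle_exists => // i _; exact: d2.
have sT i : i \in s by have := gcycle_spans e_sym cT r2 gs => /setP/(_ i); rewrite !inE.
have /and3P[s3 us _] := gs.
exists (size s) => //.
have is_ x : (index (enum_rank x) s < size s)%N by rewrite index_mem.
pose f (x : G) : 'I_(size s) := Ordinal (is_ x).
pose g (i : 'I_(size s)) : 'I_#|G| := tnth (in_tuple s) i.
have gE i x : g i = nth x s i by rewrite /g (tnth_nth x).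
have gf x : g (f x) = enum_rank x by rewrite (gE _ (enum_rank x)) nth_index.
exists f => [|x y].
  exists (fun i => enum_val (g i)) => [x|i]; first by rewrite gf enum_rankK.
  by apply/val_inj; rewrite /= enum_valK (gE i (g i)) index_uniq.
by rewrite -[LHS](gcycle_edge e_sym e_irr gs r2 gE) !gf /e !enum_rankK.
Qed.
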